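(* Let $n\geq1$, let $Q=(q_1,\dots,q_n)\in(k^\times)^n$ with no $q_i$ a root of unity, and let $\Gamma=(\gamma_{ij})$ be a multiplicatively antisymmetric $n\times n$ matrix over the field $k$. Let $Y_n=Y_n^{Q,\Gamma}(k)$ be the multiparameter quantized Weyl algebra, and let $H$ be a torus acting rationally on $Y_n$ with respect to which $Y_n$ is a CGL extension (in its standard generators $x_i,y_i$). Let $W$ be the Coxeter group of type $A_n$ with its standard generators $s_1,\dots,s_n$ and set $w_n=s_ns_{n-1}\cdots s_2s_1s_2\cdots s_n$. Then $W^{\leq w_n}\cong\operatorname{spec}_HY_n$ as partially ordered sets.
   Context: $Y_n$ is the $k$-algebra with generators $x_n,\dots,x_1,y_1,\dots,y_n$ and relations $$y_iy_j=\gamma_{ij}y_jy_i\ (\text{all }i,j),\qquad x_iy_j=\gamma_{ji}y_jx_i\ (i<j),\qquad x_iy_j=q_j\gamma_{ji}y_jx_i\ (i>j),$$ $$x_ix_j=q_i\gamma_{ij}x_jx_i\ (i<j),\qquad x_iy_i=q_iy_ix_i+1+\sum_{l<i}(q_l-1)y_lx_l\ (\text{all }i).$$ Multiplicatively antisymmetric means $\gamma_{ii}=1$ and $\gamma_{ij}\gamma_{ji}=1$. A CGL (Cauchon-Goodearl-Letzter) extension is an iterated Ore extension $k[z_1][z_2;\tau_2,\delta_2]\cdots[z_N;\tau_N,\delta_N]$ such that: (a) each $\delta_j$ is locally nilpotent and there are non-roots of unity $p_j\in k^\times$ with $\delta_j\tau_j=p_j\tau_j\delta_j$; (b) a torus $H$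 acts rationally by algebra automorphisms; (c) each $z_i$ is an $H$-eigenvector; (d) there are $h_1,\dots,h_N\in H$ with $h_j(z_i)=\tau_j(z_i)$ for $i<j$ and the $h_j$-eigenvalue of $z_j$ not a root of unity. $Y_n$ is regarded as such an extension by adjoining $x_1,y_1,x_2,y_2,\dots,x_n,y_n$ in this order; for instance $H=(k^\times)^n$ with $(\alpha_1,\dots,\alpha_n).x_i=\alpha_ix_i$, $(\alpha_1,\dots,\alpha_n).y_i=\alpha_i^{-1}y_i$ is a suitable torus. $\operatorname{spec}_HY_n$ is the set of $H$-stable prime ideals of $Y_n$ ordered by inclusion. The Coxeter group of type $A_n$ has $m_{ij}=3$ if $|i-j|=1$ and $m_{ij}=2$ if $|i-j|>1$; $W^{\leq w}=\{v\in W:v\leq w\}$ with the Bruhat order. *)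

(* Defs.v *)
From HB Require Import structures.
From mathcomp Require Import all_boot all_order all_algebra.
From mathcomp Require Import boolp classical_sets functions.
From mathcomp Require Import monalg.
From Stdlib Require Import Relation_Operators.

Set Implicit Arguments.
Unset Strict Implicit.
Unset Printing Implicit Defensive.

Import GRing.Theory.

Local Open Scope classical_set_scope.
Local Open Scope ring_scope.
Local Open Scope quotient_scope.

Definition not_root_of_unity (k : fieldType) (q : k) : Prop :=
  forall m : nat, (0 < m)%N -> q ^+ m != 1.

Definition mult_antisymmetric (k : fieldType) (n : nat) (G : 'M[k]_n) : Prop :=
  (forall i, G i i = 1) /\ (forall i j, G i j * G j i = 1).

Record is_ideal (R : nzRingType) (I : set R) : Prop := IsIdeal {
  ideal0 : I 0;
  idealD : forall a b, I a -> I b -> I (a + b);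
  idealMl : forall a b, I b -> I (a * b);
  idealMr : forall a b, I a -> I (a * b) }.

Record is_prime_ideal (R : nzRingType) (P : set R) : Prop := IsPrimeIdeal {
  prime_ideal : is_ideal P;
  prime_proper : P != setT;
  prime_mul : forall I J : set R, is_ideal I -> is_ideal J ->
    (forall a b, I a -> J b -> P (a * b)) -> I `<=` P \/ J `<=` P }.

Definition ideal_gen (R : nzRingType) (S : set R) : set R :=
  smallest (@is_ideal R) S.

Lemma ideal_gen_ideal (R : nzRingType) (S : set R) : is_ideal (ideal_gen S).
Proof.
split.
- by move=> I [idI _]; apply: ideal0.
- by move=> a b Ia Ib I HI; apply: (idealD HI.1); [apply: Ia|apply: Ib].
- by move=> a b Ib I HI; apply: (idealMl HI.1); apply: Ib.
- by move=> a b Ia I HI; apply: (idealMr HI.1); apply: Ia.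
Qed.

Record proper_2sided_ideal (R : nzRingType) := Proper2sidedIdeal {
  pideal : set R;
  pidealP : is_ideal pideal;
  pideal1 : ~ pideal 1 }.

(* The library only provides quotients of commutative rings. *)
Section QuotientAlgebra.
Variables (k : fieldType) (R : algType k) (I : proper_2sided_ideal R).

Let idI := pidealP I.

Definition ideal_rel (a b : R) : bool := `[< pideal I (a - b) >].

Lemma ideal_relP a b : reflect (pideal I (a - b)) (ideal_rel a b).
Proof. exact: asboolP. Qed.

Lemma pidealN a : pideal I a -> pideal I (- a).
Proof. by move=> Ia; rewrite -mulN1r; apply: idealMl. Qed.

Lemma pidealZ c a : pideal I a -> pideal I (c *: a).
Proof. by move=> Ia; rewrite -[a]mul1r scalerAl; apply: idealMl. Qed.

Lemma ideal_rel_equiv : equiv_class_of ideal_rel.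
Proof.
split.
- by move=> a; apply/ideal_relP; rewrite subrr; apply: ideal0.
- by move=> a b; apply/ideal_relP/ideal_relP => /pidealN; rewrite opprB.
- move=> b a c /ideal_relP Iab /ideal_relP Ibc; apply/ideal_relP.
  by rewrite -(subrKA b); apply: idealD.
Qed.

Canonical ideal_equiv := EquivRelPack ideal_rel_equiv.
Canonical ideal_equiv_direct := defaultEncModRel ideal_rel.

Definition quot_alg := {eq_quot ideal_rel}.

HB.instance Definition _ := Choice.on quot_alg.
HB.instance Definition _ := EqQuotient.on quot_alg.

Lemma quotE a b : (\pi_quot_alg a = \pi_quot_alg b) <-> pideal I (a - b).
Proof.
split; first by move/eqP; rewrite eqquotE => /ideal_relP.
by move/ideal_relP => h; apply/eqP; rewrite eqquotE.
Qed.

Lemma quot_repr a : pideal I (repr (\pi_quot_alg a) - a).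
Proof. by apply/quotE; rewrite reprK. Qed.

Definition quot_add := lift_op2 quot_alg +%R.
Definition quot_opp := lift_op1 quot_alg -%R.
Definition quot_mul := lift_op2 quot_alg *%R.
Definition quot_scale (c : k) := lift_op1 quot_alg ( *:%R c).

Lemma pi_quot_add : {morph \pi_quot_alg : a b / a + b >-> quot_add a b}.
Proof.
move=> a b; rewrite /quot_add; unlock; apply/esym/quotE.
by rewrite opprD addrACA; apply: idealD => //; apply: quot_repr.
Qed.

Lemma pi_quot_opp : {morph \pi_quot_alg : a / - a >-> quot_opp a}.
Proof.
move=> a; rewrite /quot_opp; unlock; apply/esym/quotE.
by rewrite -opprD; apply: pidealN; apply: quot_repr.
Qed.

Lemma pi_quot_mul : {morph \pi_quot_alg : a b / a * b >-> quot_mul a b}.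
Proof.
move=> a b; rewrite /quot_mul; unlock; apply/esym/quotE.
set a' := repr _; set b' := repr _.
have -> : a' * b' - a * b = (a' - a) * b' + a * (b' - b).
  by rewrite mulrBl mulrBr subrKA.
apply: idealD => //.
  by apply: idealMr => //; apply: quot_repr.
by apply: idealMl => //; apply: quot_repr.
Qed.

Lemma pi_quot_scale c :
  {morph \pi_quot_alg : a / c *: a >-> quot_scale c a}.
Proof.
move=> a; rewrite /quot_scale; unlock; apply/esym/quotE.
by rewrite -scalerBr; apply: pidealZ; apply: quot_repr.
Qed.

Let piD := pi_quot_add.
Let piN := pi_quot_opp.
Let piM := pi_quot_mul.
Let piZ := pi_quot_scale.

Lemma quot_ind (P : quot_alg -> Prop) :
  (forall a, P (\pi_quot_alg a)) -> forall u, P u.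
Proof. by move=> h u; rewrite -[u]reprK. Qed.

Lemma quot_addA : associative quot_add.
Proof.
by elim/quot_ind=> a; elim/quot_ind=> b; elim/quot_ind=> c; rewrite -!piD addrA.
Qed.
Lemma quot_addC : commutative quot_add.
Proof. by elim/quot_ind=> a; elim/quot_ind=> b; rewrite -!piD addrC. Qed.
Lemma quot_add0 : left_id (\pi_quot_alg 0) quot_add.
Proof. by elim/quot_ind=> a; rewrite -!piD add0r. Qed.
Lemma quot_addN : left_inverse (\pi_quot_alg 0) quot_opp quot_add.
Proof. by elim/quot_ind=> a; rewrite -piN -piD addNr. Qed.

HB.instance Definition _ :=
  GRing.isZmodule.Build quot_alg quot_addA quot_addC quot_add0 quot_addN.

Lemma quot_mulA : associative quot_mul.
Proof.
by elim/quot_ind=> a; elim/quot_ind=> b; elim/quot_ind=> c; rewrite -!piM mulrA.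
Qed.
Lemma quot_mul1l : left_id (\pi_quot_alg 1) quot_mul.
Proof. by elim/quot_ind=> a; rewrite -!piM mul1r. Qed.
Lemma quot_mul1r : right_id (\pi_quot_alg 1) quot_mul.
Proof. by elim/quot_ind=> a; rewrite -!piM mulr1. Qed.
Lemma quot_mulDl : left_distributive quot_mul quot_add.
Proof.
elim/quot_ind=> a; elim/quot_ind=> b; elim/quot_ind=> c.
by rewrite -piD -!piM -piD mulrDl.
Qed.
Lemma quot_mulDr : right_distributive quot_mul quot_add.
Proof.
elim/quot_ind=> a; elim/quot_ind=> b; elim/quot_ind=> c.
by rewrite -piD -!piM -piD mulrDr.
Qed.
Lemma quot_1neq0 : \pi_quot_alg 1 != \pi_quot_alg 0.
Proof. by apply/eqP/quotE; rewrite subr0; apply: pideal1. Qed.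

HB.instance Definition _ := GRing.Zmodule_isNzRing.Build quot_alg
  quot_mulA quot_mul1l quot_mul1r quot_mulDl quot_mulDr quot_1neq0.

Lemma quot_scaleA c d u :
  quot_scale c (quot_scale d u) = quot_scale (c * d) u.
Proof. by elim/quot_ind: u => a; rewrite -!piZ scalerA. Qed.
Lemma quot_scale1 : left_id 1 quot_scale.
Proof. by elim/quot_ind=> a; rewrite -!piZ scale1r. Qed.
Lemma quot_scaleDr : right_distributive quot_scale quot_add.
Proof.
move=> c; elim/quot_ind=> a; elim/quot_ind=> b.
by rewrite -piD -!piZ -piD scalerDr.
Qed.
Lemma quot_scaleDl u : {morph quot_scale^~ u : c d / c + d >-> quot_add c d}.
Proof. by elim/quot_ind: u => a c d; rewrite -!piZ -piD scalerDl. Qed.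

HB.instance Definition _ := GRing.Zmodule_isLmodule.Build k quot_alg
  quot_scaleA quot_scale1 quot_scaleDr quot_scaleDl.

Lemma quot_scaleAl (c : k) (u v : quot_alg) : c *: (u * v) = (c *: u) * v.
Proof.
elim/quot_ind: u => a; elim/quot_ind: v => b.
rewrite [LHS](_ : _ = quot_scale c (quot_mul (\pi a) (\pi b))) //.
by rewrite -piM -piZ scalerAl piM piZ.
Qed.
Lemma quot_scaleAr (c : k) (u v : quot_alg) : c *: (u * v) = u * (c *: v).
Proof.
elim/quot_ind: u => a; elim/quot_ind: v => b.
rewrite [LHS](_ : _ = quot_scale c (quot_mul (\pi a) (\pi b))) //.
by rewrite -piM -piZ scalerAr piM piZ.
Qed.

HB.instance Definition _ := GRing.Lmodule_isLalgebra.Build k quot_alg quot_scaleAl.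
HB.instance Definition _ := GRing.Lalgebra_isAlgebra.Build k quot_alg quot_scaleAr.

End QuotientAlgebra.

Section FreeAlgebra.
Variables (k : fieldType) (T : choiceType).

Lemma malg_scaleAr (c : k) (f g : {malg k[{fmonom T}]}) :
  c *: (f * g) = f * (c *: g).
Proof.
have cC : c%:MP * f = f * c%:MP.
  rewrite !malgM_def fgmulUg fgmulgU; apply: eq_bigr => m _.
  by rewrite mulrC mul1m mulm1.
apply: etrans (esym (mul_malgC c (f * g))) _.
apply: etrans (congr1 (fun u => f * u) (mul_malgC c g)).
by apply: etrans (mulrA _ _ _) _; rewrite cC; apply: esym (mulrA _ _ _).
Qed.

Definition free_alg := {malg k[{fmonom T}]}.

HB.instance Definition _ := GRing.Lalgebra.on free_alg.
HB.instance Definition _ :=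
  GRing.Lalgebra_isAlgebra.Build k free_alg malg_scaleAr.

Definition free_gen (t : T) : free_alg := mkmalgU (fmu t) 1.

End FreeAlgebra.

Section WeylRelations.
Variables (k : fieldType) (n : nat) (Q : 'I_n -> k) (G : 'M[k]_n).

Variant weyl_relator (A : algType k) (X Y : 'I_n -> A) : A -> Prop :=
| Weyl_yy (i j : 'I_n) :
    weyl_relator X Y (Y i * Y j - G i j *: (Y j * Y i))
| Weyl_xy_lt (i j : 'I_n) of (i < j)%N :
    weyl_relator X Y (X i * Y j - G j i *: (Y j * X i))
| Weyl_xy_gt (i j : 'I_n) of (j < i)%N :
    weyl_relator X Y (X i * Y j - (Q j * G j i) *: (Y j * X i))
| Weyl_xx (i j : 'I_n) of (i < j)%N :
    weyl_relator X Y (X i * X j - (Q i * G i j) *: (X j * X i))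
| Weyl_xy_eq (i : 'I_n) :
    weyl_relator X Y (X i * Y i - (Q i *: (Y i * X i) + 1
                   + \sum_(l < n | (l < i)%N) (Q l - 1) *: (Y l * X l))).

Hypothesis nrQ : forall i, not_root_of_unity (Q i).
Hypothesis asymG : mult_antisymmetric G.

(* Y_n is non-trivial: the relations hold in k for x_1 = 1, y_1 = 1 / (1 - q_1)
   and all the other generators sent to 0. *)
Definition weyl_point (t : 'I_n + 'I_n) : k :=
  match t with
  | inl i => (val i == 0%N)%:R
  | inr i => (val i == 0%N)%:R / (1 - Q i)
  end.

Lemma weyl_relators_eval (A : algType k) (X Y : 'I_n -> A) (ev : A -> k) :
    (forall f g, ev (f * g) = ev f * ev g) ->
    (forall f g, ev (f - g) = ev f - ev g) ->
    (forall f g, ev (f + g) = ev f + ev g) ->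
    (forall c f, ev (c *: f) = c * ev f) ->
    ev 1 = 1 ->
    (forall i, ev (X i) = weyl_point (inl i)) ->
    (forall i, ev (Y i) = weyl_point (inr i)) ->
  ~ ideal_gen (weyl_relator X Y) 1.
Proof.
move=> evM evB evD evZ ev1 /= evX evY.
have ev0 : ev 0 = 0 by rewrite -(subrr 1) evB subrr.
have ev_sum := big_morph ev evD ev0.
have nz0 (i j : 'I_n) : (i < j)%N -> (val j == 0%N) = false.
  by move=> ij; apply/negbTE; rewrite -lt0n (leq_trans _ ij).
move=> /(_ [set f | ev f = 0]) h.
suff : [set f | ev f = 0] 1 by rewrite /= ev1 => /eqP; rewrite oner_eq0.
apply: h; split.
  split=> /=.
  - by rewrite ev0.
  - by move=> a b; rewrite evD => -> ->; rewrite addr0.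
  - by move=> a b; rewrite evM => ->; rewrite mulr0.
  - by move=> a b; rewrite evM => ->; rewrite mul0r.
move=> _ [i j|i j ij|i j ij|i j ij|i] /=; rewrite evB.
- rewrite evZ !evM !evY; case: (eqVneq i j) => [->|ne].
    by rewrite asymG.1 mul1r subrr.
  case: (eqVneq (val i) 0%N) => i0; case: (eqVneq (val j) 0%N) => j0;
    rewrite /= ?(mul0r, mulr0) ?subrr //.
  by case/eqP: ne; apply: val_inj; rewrite i0 j0.
- by rewrite evZ !evM !evX !evY (nz0 _ _ ij) !(mul0r, mulr0) subrr.
- by rewrite evZ !evM !evX !evY (nz0 _ _ ij) !(mul0r, mulr0) subrr.
- by rewrite evZ !evM !evX (nz0 _ _ ij) !(mul0r, mulr0) subrr.
have nz (j : 'I_n) : 1 - Q j != 0.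
  by rewrite subr_eq0 eq_sym; have := nrQ j (ltn0Sn 0); rewrite expr1.
have evS l : ev ((Q l - 1) *: (Y l * X l)) = - (val l == 0%N)%:R.
  rewrite evZ !evM evX evY; case: (_ == _); rewrite ?mul0r ?mulr0 ?oppr0 //.
  by rewrite mul1r mulr1 -opprB mulNr mulfV.
rewrite !evD evZ ev1 ev_sum !evM evX evY.
under eq_bigr do rewrite evS.
case: (eqVneq (val i) 0%N) => i0 /=.
  rewrite big1 => [|l]; last by rewrite [nat_of_ord i]i0.
  rewrite addr0 !mul1r mulr1 opprD addrA.
  have -> : (1 - Q i)^-1 - Q i / (1 - Q i) = 1.
    by rewrite -{1}[_^-1]mul1r -mulrBl mulfV.
  by rewrite subrr.
have n0 : (0 < n)%N by apply: leq_ltn_trans (ltn_ord i).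
rewrite (bigD1 (Ordinal n0)) /=; last by rewrite lt0n.
rewrite big1 => [|l /andP[_ l0]]; last first.
  suff /negPf -> : val l != 0%N by rewrite oppr0.
  by apply: contra l0 => /eqP l0; apply/eqP/val_inj.
by rewrite !(mul0r, mulr0, add0r, addr0, mulr1n) subrr oppr0.
Qed.

End WeylRelations.

Section QuantizedWeyl.
Variables (k : fieldType) (n : nat) (Q : 'I_n -> k) (G : 'M[k]_n).
Hypothesis nrQ : forall i, not_root_of_unity (Q i).
Hypothesis asymG : mult_antisymmetric G.

Definition weyl_free := free_alg k ('I_n + 'I_n)%type.

HB.instance Definition _ := GRing.Algebra.on weyl_free.

Definition weyl_free_x (i : 'I_n) : weyl_free := free_gen k (inl i).
Definition weyl_free_y (i : 'I_n) : weyl_free := free_gen k (inr i).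

Definition weyl_relators : set weyl_free :=
  weyl_relator Q G weyl_free_x weyl_free_y.

Definition weyl_pointm (m : fmonom ('I_n + 'I_n)%type) : k :=
  \prod_(t <- m) weyl_point Q t.

Lemma weyl_pointm_morphism : mmorphism weyl_pointm.
Proof.
split; last by rewrite /weyl_pointm fm1 big_nil.
by move=> a b; rewrite /weyl_pointm fmM big_cat.
Qed.

HB.instance Definition _ :=
  monalg.isMultiplicative.Build _ _ weyl_pointm weyl_pointm_morphism.

Lemma weyl_relators_proper : ~ ideal_gen weyl_relators 1.
Proof.
apply: (@weyl_relators_eval _ _ _ _ nrQ asymG weyl_free weyl_free_x weyl_free_y
  (mmap idfun weyl_pointm)).
- exact: rmorphM.
- exact: rmorphB.
- exact: rmorphD.
- exact: mmap_is_linear.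
- exact: rmorph1.
- by move=> i; rewrite /= mmapU mul1r /weyl_pointm fmU big_seq1.
- by move=> i; rewrite /= mmapU mul1r /weyl_pointm fmU big_seq1.
Qed.

Definition weyl_ideal : proper_2sided_ideal weyl_free :=
  Proper2sidedIdeal (ideal_gen_ideal weyl_relators) weyl_relators_proper.

(* The hypotheses on Q and G only serve to make the quotient non-zero, as algType
   requires. *)
Definition weyl_alg := quot_alg weyl_ideal.

HB.instance Definition _ := GRing.Algebra.on weyl_alg.

Definition weyl_x (i : 'I_n) : weyl_alg := \pi_(quot_alg weyl_ideal) (weyl_free_x i).
Definition weyl_y (i : 'I_n) : weyl_alg := \pi_(quot_alg weyl_ideal) (weyl_free_y i).

(* x_1, y_1, x_2, y_2, ..., x_n, y_n *)
Definition weyl_gens : seq weyl_alg :=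
  flatten [seq [:: weyl_x i; weyl_y i] | i <- enum 'I_n].

End QuantizedWeyl.

Section Torus.
Variables (k : fieldType) (r : nat).

Definition torus := {h : {ffun 'I_r -> k} | [forall i, h i != 0]}.

HB.instance Definition _ := Choice.on torus.

Definition tcoord (h : torus) (i : 'I_r) : k := val h i.

Lemma tcoord_neq0 h i : tcoord h i != 0.
Proof. exact: (forallP (valP h)). Qed.

Lemma torus_subproof (f : 'I_r -> k) :
  (forall i, f i != 0) -> [forall i, finfun f i != 0].
Proof. by move=> nz; apply/forallP => i; rewrite ffunE. Qed.

Definition Torus (f : 'I_r -> k) (nz : forall i, f i != 0) : torus :=
  exist _ (finfun f) (torus_subproof nz).

Lemma TorusE f nz i : tcoord (@Torus f nz) i = f i.
Proof. by rewrite /tcoord ffunE. Qed.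

Lemma torusP (g h : torus) : tcoord g =1 tcoord h -> g = h.
Proof. by move=> gh; apply/val_inj/ffunP. Qed.

Definition torus_one : torus := @Torus (fun=> 1) (fun=> oner_neq0 k).

Definition torus_mul (g h : torus) : torus :=
  @Torus (fun i => tcoord g i * tcoord h i)
    (fun i => mulf_neq0 (tcoord_neq0 g i) (tcoord_neq0 h i)).

Lemma torus_inv_subproof (h : torus) i : (tcoord h i)^-1 != 0.
Proof. by rewrite invr_eq0 tcoord_neq0. Qed.

Definition torus_inv (h : torus) : torus := Torus (torus_inv_subproof h).

Lemma torus_mulA : associative torus_mul.
Proof. by move=> a b c; apply: torusP => i; rewrite !TorusE mulrA. Qed.
Lemma torus_mul1l : left_id torus_one torus_mul.
Proof. by move=> a; apply: torusP => i; rewrite !TorusE mul1r. Qed.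
Lemma torus_mul1r : right_id torus_one torus_mul.
Proof. by move=> a; apply: torusP => i; rewrite !TorusE mulr1. Qed.
Lemma torus_mulVl : left_inverse torus_one torus_inv torus_mul.
Proof.
by move=> a; apply: torusP => i; rewrite !TorusE mulVf // tcoord_neq0.
Qed.
Lemma torus_mulVr : right_inverse torus_one torus_inv torus_mul.
Proof.
by move=> a; apply: torusP => i; rewrite !TorusE mulfV // tcoord_neq0.
Qed.

HB.instance Definition _ := isGroup.Build torus
  torus_mulA torus_mul1l torus_mul1r torus_mulVl torus_mulVr.

(* The coordinate ring of (k^x)^r consists of the Laurent polynomials. *)
Definition regular_on_torus (f : torus -> k) : Prop :=
  exists s : seq (k * ('I_r -> int)),
    forall h, f h = \sum_(ce <- s) ce.1 * \prod_(i < r) tcoord h i ^ ce.2 i.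

Section Action.
Variables (A : algType k) (act : torus -> {lrmorphism A -> A}).

Definition is_action : Prop :=
  (forall a, act 1%g a = a) /\
  (forall g h a, act (g * h)%g a = act g (act h a)).

(* Every element lies in a finite-dimensional H-stable subspace (with basis v)
   on which H acts through a morphism of algebraic groups H -> GL. *)
Definition is_rational : Prop :=
  forall a, exists (m : nat) (v : 'I_m -> A) (rho : 'I_m -> 'I_m -> torus -> k),
    [/\ exists c : 'I_m -> k, a = \sum_i c i *: v i,
        forall c : 'I_m -> k, \sum_i c i *: v i = 0 -> forall i, c i = 0,
        forall i j, regular_on_torus (rho i j)
      & forall h j, act h (v j) = \sum_i rho i j h *: v i].

Definition stable_under (P : set A) : Prop :=
  forall h a, P a -> P (act h a).

Definition Hspec : set (set A) :=
  [set P | is_prime_ideal P /\ stable_under P].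

End Action.
End Torus.

Section Ore.
Variables (k : fieldType) (A : algType k).

Record is_subalgebra (B : set A) : Prop := IsSubalgebra {
  subalg1 : B 1;
  subalgZD : forall (c : k) a b, B a -> B b -> B (c *: a + b);
  subalgM : forall a b, B a -> B b -> B (a * b) }.

Definition subalgebra_gen (S : set A) : set A := smallest is_subalgebra S.

(* tau and delta are total on A, but only their values on B matter. *)
Record is_alg_automorphism_on (B : set A) (tau : A -> A) : Prop := {
  aut_bij : set_bij B B tau;
  aut1 : tau 1 = 1;
  autZD : forall (c : k) a b, B a -> B b -> tau (c *: a + b) = c *: tau a + tau b;
  autM : forall a b, B a -> B b -> tau (a * b) = tau a * tau b }.

Record is_left_derivation_on (B : set A) (tau delta : A -> A) : Prop := {
  der_fun : set_fun B B delta;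
  derZD : forall (c : k) a b, B a -> B b ->
    delta (c *: a + b) = c *: delta a + delta b;
  derM : forall a b, B a -> B b -> delta (a * b) = tau a * delta b + delta a * b }.

(* C = B[z; tau, delta]: the powers of z form a basis of C as a left B-module
   (p.[z] is \sum_i p`_i * z ^+ i, with coefficients on the left). *)
Record is_ore_extension (B : set A) (z : A) (tau delta : A -> A) (C : set A)
    : Prop := {
  ore_aut : is_alg_automorphism_on B tau;
  ore_der : is_left_derivation_on B tau delta;
  ore_comm : forall b, B b -> z * b = tau b * z + delta b;
  ore_basis : set_bij [set p : {poly A} | forall i, B p`_i] C (fun p => p.[z]) }.

Variables (r : nat) (act : torus k r -> {lrmorphism A -> A}) (z : seq A).

(* k<z_1, ..., z_j> *)
Definition step (j : nat) : set A := subalgebra_gen [set` take j z].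

(* Indices are shifted by one: z`_j, tau j, ... stand for z_{j+1}, tau_{j+1}, ...
   and step j is the coefficient algebra of the Ore extension adjoining z`_j. *)
Record is_CGL_extension : Prop := {
  cgl_gen : subalgebra_gen [set` z] = setT;
  cgl_action : is_action act;
  cgl_rational : is_rational act;
  cgl_eigen : forall j, (j < size z)%N ->
    z`_j != 0 /\ exists chi : torus k r -> k, forall h, act h z`_j = chi h *: z`_j;
  cgl_ore : exists (tau delta : nat -> A -> A) (p : nat -> k) (h : nat -> torus k r),
    forall j, (j < size z)%N ->
    [/\ is_ore_extension (step j) z`_j (tau j) (delta j) (step j.+1),
        forall a, step j a -> exists m, iter m (delta j) a = 0,
        p j != 0 /\ not_root_of_unity (p j),
        forall a, step j a -> delta j (tau j a) = p j *: tau j (delta j a)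
      & (forall i, (i < j)%N -> act (h j) z`_i = tau j z`_i) /\
        exists2 lambda, act (h j) z`_j = lambda *: z`_j & not_root_of_unity lambda] }.

End Ore.

Record coxeter_matrix (I : choiceType) := CoxeterMatrix {
  cox_m :> I -> I -> nat;  (* 0 stands for infinity *)
  cox_m_sym : forall i j, cox_m i j = cox_m j i;
  cox_m_diag : forall i j, (cox_m i j == 1%N) = (i == j) }.

Section Coxeter.
Variables (I : choiceType) (M : coxeter_matrix I).

(* The group < I | (s_i s_j)^(M i j) = 1 >, as the words in the generators modulo
   the congruence spanned by the relators. Formal inverses are not needed since
   the generators are involutions. *)
Inductive cox_equiv : seq I -> seq I -> Prop :=
| Cox_refl u : cox_equiv u u
| Cox_sym u v of cox_equiv u v : cox_equiv v u
| Cox_trans v u w of cox_equiv u v & cox_equiv v w : cox_equiv u w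
| Cox_cat u u' v v' of cox_equiv u u' & cox_equiv v v' :
    cox_equiv (u ++ v) (u' ++ v')
| Cox_rel i j : cox_equiv (flatten (nseq (M i j) [:: i; j])) [::].

Lemma cox_equiv_rev u v : cox_equiv u v -> cox_equiv (rev u) (rev v).
Proof.
elim=> {u v} [u|u v _|v u w _ uv _ vw|u u' v v' _ uu' _ vv'|i j].
- exact: Cox_refl.
- exact: Cox_sym.
- exact: Cox_trans uv vw.
- by rewrite !rev_cat; apply: Cox_cat.
have -> : rev (flatten (nseq (M i j) [:: i; j]))
    = flatten (nseq (M i j) [:: j; i]).
  elim: (M i j) => //= m IHm; rewrite -cat1s -(cat1s j) !rev_cat IHm /=.
  by elim: m {IHm} => //= m ->.
by rewrite cox_m_sym; apply: Cox_rel.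
Qed.

Lemma cox_equiv_revK u : cox_equiv (rev u ++ u) [::].
Proof.
elim: u => [|i u IHu]; first exact: Cox_refl.
rewrite rev_cons -cats1 -catA /= -[i :: i :: u]/([:: i; i] ++ u).
apply: Cox_trans IHu; apply: Cox_cat; first exact: Cox_refl.
rewrite -[X in cox_equiv _ X]cat0s; apply: Cox_cat; last exact: Cox_refl.
by have := Cox_rel i i; have /eqP -> : M i i == 1%N by rewrite cox_m_diag.
Qed.

Definition cox_rel (u v : seq I) : bool := `[< cox_equiv u v >].

Lemma cox_rel_equiv : equiv_class_of cox_rel.
Proof.
split.
- by move=> u; apply/asboolP/Cox_refl.
- by move=> u v; apply/asboolP/asboolP; apply: Cox_sym.
- by move=> v u w /asboolP uv /asboolP vw; apply/asboolP; apply: Cox_trans uv vw.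
Qed.

Canonical cox_equiv_rel := EquivRelPack cox_rel_equiv.
Canonical cox_equiv_direct := defaultEncModRel cox_rel.

Definition coxeter := {eq_quot cox_rel}.

HB.instance Definition _ := Choice.on coxeter.
HB.instance Definition _ := EqQuotient.on coxeter.

Definition cox_word (u : seq I) : coxeter := \pi_coxeter u.

Lemma cox_wordP u v : cox_word u = cox_word v <-> cox_equiv u v.
Proof.
split; first by move/eqP; rewrite eqquotE => /asboolP.
by move=> uv; apply/eqP; rewrite eqquotE; apply/asboolP.
Qed.

Lemma cox_word_surj w : exists u, w = cox_word u.
Proof. by exists (repr w); rewrite /cox_word reprK. Qed.

Lemma cox_repr u : cox_equiv (repr (cox_word u)) u.
Proof. by apply/cox_wordP; rewrite /cox_word reprK. Qed.

Definition cox_mul (v w : coxeter) : coxeter := cox_word (repr v ++ repr w).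
Definition cox_inv (w : coxeter) : coxeter := cox_word (rev (repr w)).

Lemma cox_mulE u v : cox_mul (cox_word u) (cox_word v) = cox_word (u ++ v).
Proof. by apply/cox_wordP/Cox_cat; apply: cox_repr. Qed.

Lemma cox_invE u : cox_inv (cox_word u) = cox_word (rev u).
Proof. by apply/cox_wordP/cox_equiv_rev/cox_repr. Qed.

Lemma cox_mulA : associative cox_mul.
Proof.
move=> a b c; have [u ->] := cox_word_surj a; have [v ->] := cox_word_surj b.
by have [w ->] := cox_word_surj c; rewrite !cox_mulE catA.
Qed.
Lemma cox_mul1l : left_id (cox_word [::]) cox_mul.
Proof. by move=> a; have [u ->] := cox_word_surj a; rewrite cox_mulE. Qed.
Lemma cox_mul1r : right_id (cox_word [::]) cox_mul.
Proof. by move=> a; have [u ->] := cox_word_surj a; rewrite cox_mulE cats0. Qed.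
Lemma cox_mulVl : left_inverse (cox_word [::]) cox_inv cox_mul.
Proof.
move=> a; have [u ->] := cox_word_surj a; rewrite cox_invE cox_mulE.
exact/cox_wordP/cox_equiv_revK.
Qed.
Lemma cox_mulVr : right_inverse (cox_word [::]) cox_inv cox_mul.
Proof.
move=> a; have [u ->] := cox_word_surj a; rewrite cox_invE cox_mulE.
by apply/cox_wordP; rewrite -{1}[u]revK; apply: cox_equiv_revK.
Qed.

HB.instance Definition _ := isGroup.Build coxeter
  cox_mulA cox_mul1l cox_mul1r cox_mulVl cox_mulVr.

Definition cox_gen (i : I) : coxeter := cox_word [:: i].

Lemma cox_length_subproof (w : coxeter) :
  exists m, `[< exists2 u, w = cox_word u & size u = m >].
Proof.
by have [u wu] := cox_word_surj w; exists (size u); apply/asboolP; exists u.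
Qed.

Definition cox_length (w : coxeter) : nat := ex_minn (cox_length_subproof w).

Definition is_reflection (t : coxeter) : Prop :=
  exists (g : coxeter) (i : I), t = (g * cox_gen i * g^-1)%g.

Definition bruhat_step (v w : coxeter) : Prop :=
  (exists2 t, is_reflection t & w = (v * t)%g) /\ (cox_length v < cox_length w)%N.

Definition bruhat : coxeter -> coxeter -> Prop :=
  clos_refl_trans coxeter bruhat_step.

End Coxeter.

Section TypeA.
Variable n : nat.

(* 'I_n = {0, ..., n-1}: the generator s_i of the usual labelling has index i-1. *)
Definition typeA_m (i j : 'I_n) : nat :=
  if i == j then 1%N else if (i.+1 == j) || (j.+1 == i) then 3%N else 2%N.

Lemma typeA_m_sym i j : typeA_m i j = typeA_m j i.
Proof. by rewrite /typeA_m eq_sym orbC. Qed.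

Lemma typeA_m_diag i j : (typeA_m i j == 1%N) = (i == j).
Proof. by rewrite /typeA_m; case: (i == j) => //; case: (_ || _). Qed.

Definition typeA : coxeter_matrix 'I_n := CoxeterMatrix typeA_m_sym typeA_m_diag.

(* s_n ... s_2 s_1 s_2 ... s_n *)
Definition typeA_wn : coxeter typeA :=
  cox_word typeA (rev (enum 'I_n) ++ behead (enum 'I_n)).

End TypeA.

(* Main.v *)
(* A pair of bit sequences (a, b) encodes which of the elements x_i, y_i and
   z_(i+1) = x_i y_i - y_i x_i lie outside a prime ideal: a_i for x_i, and b_i for
   z_(i+1) if z_i lies outside, for y_i otherwise.  For each admissible pair there
   is a homomorphism from Y_n to a quantum torus in the variables X_i and Z_m
   sending x_i to X_i, z_m to Z_m, and y_i to
   X_i^-1 (Z_(i+1) - Z_i) / (q_i - 1), the excluded elements being replaced by 0.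
   Modulo the ideal generated by the excluded elements Y_n is spanned by monomials
   whose images have distinct leading terms, so that this ideal is the kernel and is
   prime.  An H-prime P with the same bits contains the kernel.  If the inclusion were
   strict, a nonzero image of minimal support of an element of P would be a monomial,
   since commutation factors with torus monomials and H-weights separate exponents;
   multiplying this element by suitable others would put in P a product of
   elements that are normal modulo P and not in P.  On the Coxeter side the pair
   (a, b) deletes letters from the palindromic word of w_n; admissible pairs give
   reduced words of distinct elements, which exhaust the Bruhat interval by the strong
   exchange property, and both orders are the same explicit order on pairs. *)

From HB Require Import structures.
Require Import Defs.
From mathcomp Require Import all_boot all_order all_algebra.
From mathcomp Require Import boolp classical_sets functions.
From mathcomp Require Import finmap monalg ring zify.
From Stdlib Require Import Relation_Operators.

Set Implicit Arguments.
Unset Strict Implicit.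
Unset Printing Implicit Defensive.

Import Order.TTheory GRing.Theory Num.Theory.

Local Open Scope classical_set_scope.
Local Open Scope ring_scope.

(** * Twisted group algebras *)

(** Admissibility comes from z_i = x_i y_i - q_i y_i x_i, which puts z_i in every ideal that
    contains x_i or y_i. This also explains the double meaning of the second bit. If z_i lies
    outside P, so do x_i and y_i, and only z_(i+1) is undecided; if z_i lies in P, then x_i and y_i
    q-commute modulo P, and z_(i+1), congruent to (q_i - 1) y_i x_i, is decided by them. The
    obstacle is that y_i is not normal when z_i lies outside P, and its image may then be a
    binomial: it can only be used through q-commutators that cancel one of the two terms. The torus
    being arbitrary, its weights are known only through the elements h_j of the CGL structure;
    comparing coefficients in the Ore extensions gives the weight of x_l under h_j. On the Coxeter
    side, the case of z_i outside P is the one in which s_(i+1) commutes with all the letters kept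
    between its two occurrences: keeping only the left one or only the right one gives the same
    element, and admissible pairs keep the right one. *)

Section LinearExtension.
Variables (k : fieldType) (K : choiceType).
Implicit Types (f g : {malg k[K]}).

Lemma malg_ind (e0 : K) (P : {malg k[K]} -> Prop) :
  (forall c e, P << c *g e >>) -> (forall f g, P f -> P g -> P (f + g)) ->
  forall f, P f.
Proof.
move=> PU PD f; rewrite (monalgE f).
elim: (finmap.enum_fset _) => [|e s IHs]; last by rewrite big_cons; apply: PD.
by rewrite big_nil -(monalgU0 e0).
Qed.

Definition malg_lext (V : lmodType k) (h : K -> V) f : V :=
  \sum_(e <- msupp f) f@_e *: h e.

Lemma lextEw (V : lmodType k) (h : K -> V) (d : {fset K}) f :
  (msupp f `<=` d)%fset -> malg_lext h f = \sum_(e <- d) f@_e *: h e.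
Proof.
move=> le; rewrite /malg_lext (big_fset_incl _ le) //= => x _ /mcoeff_outdom ->.
by rewrite scale0r.
Qed.

Lemma lext_is_linear (V : lmodType k) (h : K -> V) : linear (malg_lext h).
Proof.
move=> c f g; have le1 := fsubsetUl (msupp f) (msupp g).
have le2 := fsubsetUr (msupp f) (msupp g).
rewrite (lextEw _ le1) (lextEw _ le2).
rewrite (@lextEw _ _ (msupp f `|` msupp g)%fset (c *: f + g)); last first.
  apply: fsubset_trans (msuppD_le _ _) (fsetSU _ _).
  exact: msuppZ_le.
rewrite scaler_sumr -big_split; apply: eq_bigr => e _ /=.
by rewrite mcoeffD mcoeffZ scalerDl scalerA.
Qed.

HB.instance Definition _ (V : lmodType k) (h : K -> V) :=
  GRing.isLinear.Build k {malg k[K]} V _ (malg_lext h) (lext_is_linear h).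

Lemma lextU (V : lmodType k) (h : K -> V) c e : malg_lext h << c *g e >> = c *: h e.
Proof. by rewrite (lextEw _ (msuppU_le)) big_seq_fset1 mcoeffUU. Qed.

Lemma scale_malgU c d (e : K) : c *: << d *g e >> = << c * d *g e >> :> {malg k[K]}.
Proof. by apply/malgP => x; rewrite mcoeffZ !mcoeffU mulrnAr. Qed.

End LinearExtension.

Record bicharacter (k : fieldType) (K : zmodType) := Bicharacter {
  bichar :> K -> K -> k;
  bicharDl : forall a b c, bichar (a + b) c = bichar a c * bichar b c;
  bicharDr : forall a b c, bichar a (b + c) = bichar a b * bichar a c;
  bichar_neq0 : forall a b, bichar a b != 0 }.

Section TwistedGroupAlgebra.
Variables (k : fieldType) (K : zmodType).

(** The argument [B] is a phantom: the ring structure depends on the bicharacter, the carrier does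
    not. *)
Definition twisted_malg of bicharacter k K := {malg k[K]}.
HB.instance Definition _ B := GRing.Lmodule.on (twisted_malg B).

Variable B : bicharacter k K.
Local Notation twB := (twisted_malg B).

Lemma bichar0r a : B a 0 = 1.
Proof.
by apply: (mulfI (bichar_neq0 B a 0)); rewrite -bicharDr addr0 mulr1.
Qed.

Lemma bichar0l a : B 0 a = 1.
Proof.
by apply: (mulfI (bichar_neq0 B 0 a)); rewrite -bicharDl addr0 mulr1.
Qed.

Lemma bicharNr a b : B a (- b) = (B a b)^-1.
Proof.
apply: (mulIf (bichar_neq0 B a b)).
by rewrite -bicharDr addNr bichar0r mulVf // bichar_neq0.
Qed.

Lemma bicharNl a b : B (- a) b = (B a b)^-1.
Proof.
apply: (mulIf (bichar_neq0 B a b)).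
by rewrite -bicharDl addNr bichar0l mulVf // bichar_neq0.
Qed.

Definition tw_mon (c : k) (e : K) : twB := << c *g e >>.

Lemma tw_ind (P : twB -> Prop) :
  (forall c e, P (tw_mon c e)) -> (forall f g, P f -> P g -> P (f + g)) ->
  forall f, P f.
Proof. exact: (malg_ind 0). Qed.

(** Bilinear extension of u_a u_b = B(a, b) u_(a+b). A bicharacter is a 2-cocycle, whence
    associativity. *)
Definition tw_mul (f g : twB) : twB :=
  malg_lext (fun a => malg_lext (fun b => tw_mon (B a b) (a + b)) g : twB) f.

Lemma tw_mulDl : left_distributive tw_mul +%R.
Proof. by move=> f g h; rewrite /tw_mul linearD. Qed.

Lemma tw_mulDr : right_distributive tw_mul +%R.
Proof.
move=> f g h; rewrite /tw_mul /malg_lext -big_split /=; apply: eq_bigr => a _.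
by rewrite -scalerDr; congr (_ *: _); apply: (linearD (malg_lext _)).
Qed.

Lemma scale_tw_mon (c d : k) (e : K) : c *: tw_mon d e = tw_mon (c * d) e.
Proof. exact: scale_malgU. Qed.

Lemma tw_mulU c d a b :
  tw_mul (tw_mon c a) (tw_mon d b) = tw_mon (c * d * B a b) (a + b).
Proof. by rewrite /tw_mul !lextU !scale_tw_mon mulrA. Qed.

Lemma tw_mulA : associative tw_mul.
Proof.
elim/tw_ind=> [c1 e1|f1 f2 H1 H2] f g; last by rewrite !tw_mulDl H1 H2.
elim/tw_ind: f => [c2 e2|f1 f2 H1 H2].
  elim/tw_ind: g => [c3 e3|g1 g2 H1 H2]; last by rewrite !tw_mulDr H1 H2.
  rewrite !tw_mulU addrA bicharDl bicharDr; congr (tw_mon _ _).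
  by ring.
by rewrite tw_mulDl !tw_mulDr tw_mulDl H1 H2.
Qed.

Lemma tw_mul1l : left_id (tw_mon 1 0) tw_mul.
Proof.
elim/tw_ind=> [c e|f g Hf Hg]; last by rewrite tw_mulDr Hf Hg.
by rewrite tw_mulU add0r bichar0l mul1r mulr1.
Qed.

Lemma tw_mul1r : right_id (tw_mon 1 0) tw_mul.
Proof.
elim/tw_ind=> [c e|f g Hf Hg]; last by rewrite tw_mulDl Hf Hg.
by rewrite tw_mulU addr0 bichar0r !mulr1.
Qed.

Lemma tw_1neq0 : tw_mon 1 0 != 0.
Proof. by rewrite /tw_mon (monalgU_eq0 (1 : k) (0 : K)) oner_eq0. Qed.

HB.instance Definition _ := GRing.Zmodule_isNzRing.Build (twisted_malg B)
  tw_mulA tw_mul1l tw_mul1r tw_mulDl tw_mulDr tw_1neq0.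

Lemma tw_monM c d a b : tw_mon c a * tw_mon d b = tw_mon (c * d * B a b) (a + b).
Proof. exact: tw_mulU. Qed.

Lemma tw_scaleAl (c : k) (f g : twB) : c *: (f * g) = (c *: f) * g.
Proof.
elim/tw_ind: f => [c1 e1|f1 f2 H1 H2].
  elim/tw_ind: g => [c2 e2|g1 g2 H1 H2].
    by rewrite tw_monM !scale_tw_mon tw_monM !mulrA.
  by rewrite !mulrDr scalerDr H1 H2.
by rewrite mulrDl !scalerDr mulrDl H1 H2.
Qed.

Lemma tw_scaleAr (c : k) (f g : twB) : c *: (f * g) = f * (c *: g).
Proof.
elim/tw_ind: f => [c1 e1|f1 f2 H1 H2].
  elim/tw_ind: g => [c2 e2|g1 g2 H1 H2].
    by rewrite tw_monM !scale_tw_mon tw_monM; congr (tw_mon _ _); ring.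
  by rewrite mulrDr !scalerDr mulrDr H1 H2.
by rewrite !mulrDl scalerDr H1 H2.
Qed.

HB.instance Definition _ := GRing.Lmodule_isLalgebra.Build k (twisted_malg B) tw_scaleAl.
HB.instance Definition _ := GRing.Lalgebra_isAlgebra.Build k (twisted_malg B) tw_scaleAr.

End TwistedGroupAlgebra.

(* The algebra is used only through this interface: with an abstract carrier,
   unification never unfolds the construction. *)
Record twisted_algebra (k : fieldType) (K : zmodType) (B : bicharacter k K) :=
  TwistedAlgebra {
    twisted_alg :> algType k;
    tmon : k -> K -> twisted_alg;
    tcoef : twisted_alg -> K -> k;
    tsupp : twisted_alg -> seq K;
    tmonM : forall c d a b,
      tmon c a * tmon d b = tmon (c * d * B a b) (a + b);
    tmon1 : tmon 1 0 = 1;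
    tcoef_mon : forall c a e, tcoef (tmon c a) e = c *+ (a == e);
    tcoefZD : forall c f g e, tcoef (c *: f + g) e = c * tcoef f e + tcoef g e;
    tcoef_inj : forall f g, tcoef f =1 tcoef g -> f = g;
    tsupp_uniq : forall f, uniq (tsupp f);
    mem_tsupp : forall f e, (e \in tsupp f) = (tcoef f e != 0) }.

Definition twisted_group_algebra (k : fieldType) (K : zmodType)
  (B : bicharacter k K) : twisted_algebra B.
Proof.
exists (twisted_malg B) (@tw_mon k K B) (fun f e => f@_e) (fun f => finmap.enum_fset (msupp f)).
- exact: tw_monM.
- by [].
- by move=> c a e; apply: mcoeffU.
- by move=> c f g e; rewrite [LHS](mcoeffD e) mcoeffZ.
- by move=> f g fg; apply/malgP.
- by move=> f; apply: fset_uniq.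
- by move=> f e; rewrite mcoeff_neq0.
Defined.

(** * Coefficients, supports and diagonal operators *)

Section TwistedCoefficients.
Variables (k : fieldType) (K : zmodType) (B : bicharacter k K).
Variable T : twisted_algebra B.
Implicit Types (f g : T) (e x : K) (c : k).

Local Notation tmon := (@tmon _ _ _ T).

Lemma tcoef0 e : tcoef (0 : T) e = 0.
Proof.
have := tcoefZD (- 1) (0 : T) 0 e; rewrite scaler0 add0r => ->.
by rewrite mulN1r addNr.
Qed.

Lemma tcoefD f g e : tcoef (f + g) e = tcoef f e + tcoef g e.
Proof. by rewrite -{1}[f]scale1r tcoefZD mul1r. Qed.

Lemma tcoefZ c f e : tcoef (c *: f) e = c * tcoef f e.
Proof. by rewrite -[c *: f]addr0 tcoefZD tcoef0 addr0. Qed.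

Lemma tcoefB f g e : tcoef (f - g) e = tcoef f e - tcoef g e.
Proof. by rewrite tcoefD -scaleN1r tcoefZ mulN1r. Qed.

Lemma tcoef_sum (I : Type) (s : seq I) (P : pred I) (F : I -> T) e :
  tcoef (\sum_(i <- s | P i) F i) e = \sum_(i <- s | P i) tcoef (F i) e.
Proof. exact: (big_morph (fun u : T => tcoef u e) (fun u v => tcoefD u v e) (tcoef0 e)). Qed.

Lemma tmonD c d e : tmon (c + d) e = tmon c e + tmon d e.
Proof. by apply: tcoef_inj => x; rewrite tcoefD !tcoef_mon mulrnDl. Qed.

Lemma scale_tmon c d e : c *: tmon d e = tmon (c * d) e.
Proof. by apply: tcoef_inj => x; rewrite tcoefZ !tcoef_mon mulrnAr. Qed.

Lemma tmon0 e : tmon 0 e = 0.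
Proof. by rewrite -(mul0r 1) -scale_tmon scale0r. Qed.

Lemma tmon_eq0 c e : (tmon c e == 0) = (c == 0).
Proof.
apply/eqP/eqP => [|->]; last exact: tmon0.
by move=> /(congr1 (fun u => tcoef u e)); rewrite tcoef_mon tcoef0 eqxx.
Qed.

Lemma tsupp0P f : (tsupp f == [::]) = (f == 0).
Proof.
apply/eqP/eqP => [s0|->]; last first.
  case E : (tsupp _) => [//|e s]; have := mem_head e s.
  by rewrite -E mem_tsupp tcoef0 eqxx.
apply: tcoef_inj => x; rewrite tcoef0; apply/eqP/negPn.
by rewrite -mem_tsupp s0.
Qed.

Lemma twisted_sum f : f = \sum_(a <- tsupp f) tmon (tcoef f a) a.
Proof.
apply: tcoef_inj => x; rewrite tcoef_sum.
have [xf|] := boolP (x \in tsupp f); last first.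
  rewrite mem_tsupp negbK => /eqP f0; rewrite big1_seq ?f0 // => a /andP[_ af].
  by rewrite tcoef_mon; have [->|] := eqVneq a x; rewrite ?f0.
rewrite (bigD1_seq x) ?tsupp_uniq //= tcoef_mon eqxx mulr1n big1 ?addr0 // => a ax.
by rewrite tcoef_mon (negPf ax).
Qed.

Lemma twisted_ind (P : T -> Prop) :
  (forall c e, P (tmon c e)) -> (forall f g, P f -> P g -> P (f + g)) ->
  forall f, P f.
Proof.
move=> PU PD f; rewrite (twisted_sum f).
elim: (tsupp f) => [|e s IHs]; last by rewrite big_cons; apply: PD.
by rewrite big_nil -(tmon0 0).
Qed.

Lemma tcoef_monM c a f x : tcoef (tmon c a * f) (a + x) = c * B a x * tcoef f x.
Proof.
elim/twisted_ind: f => [d e|f g Hf Hg].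
  rewrite tmonM !tcoef_mon (inj_eq (addrI a)).
  by have [->|_] := eqVneq e x; rewrite ?mulr0 // !mulr1n; ring.
by rewrite mulrDr !tcoefD Hf Hg mulrDr.
Qed.

Lemma tcoef_Mmon c a f x : tcoef (f * tmon c a) (a + x) = c * B x a * tcoef f x.
Proof.
elim/twisted_ind: f => [d e|f g Hf Hg].
  rewrite tmonM !tcoef_mon addrC (inj_eq (addrI a)).
  by have [->|_] := eqVneq e x; rewrite ?mulr0 // !mulr1n; ring.
by rewrite mulrDl !tcoefD Hf Hg mulrDr.
Qed.

Lemma tsuppD f g x : x \in tsupp (f + g) -> x \in tsupp f \/ x \in tsupp g.
Proof.
rewrite !mem_tsupp tcoefD => nz.
by have [f0|] := eqVneq (tcoef f x) 0; [right; rewrite f0 add0r in nz|left].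
Qed.

Lemma tsuppM f g x : x \in tsupp (f * g) ->
  exists a b, [/\ a \in tsupp f, b \in tsupp g & x = a + b].
Proof.
rewrite mem_tsupp {1}(twisted_sum f) mulr_suml tcoef_sum => nz.
have /existsNP[a /not_implyP[af nza]] :
    ~ (forall a, a \in tsupp f -> tcoef (tmon (tcoef f a) a * g) x = 0).
  move=> h; case/negP: nz; apply/eqP; apply: big1_seq => a /andP[_ af].
  exact: h.
exists a, (x - a); rewrite subrKC; split=> //; rewrite mem_tsupp.
apply/eqP => g0; apply: nza.
by rewrite -{1}(subrKC a x) tcoef_monM g0 mulr0.
Qed.

Lemma tsupp_mon c e x : x \in tsupp (tmon c e) -> x = e.
Proof.
by rewrite mem_tsupp tcoef_mon; have [//|] := eqVneq e x; rewrite eqxx.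
Qed.

(** The form that the action of H takes in the quantum torus, with [w] the weight of an exponent;
    see [phi_act]. *)
Definition tdiag (w : K -> k) f : T :=
  \sum_(e <- tsupp f) tmon (w e * tcoef f e) e.

Lemma tcoef_diag w f x : tcoef (tdiag w f) x = w x * tcoef f x.
Proof.
rewrite {2}(twisted_sum f) !tcoef_sum mulr_sumr; apply: eq_bigr => e _.
by rewrite !tcoef_mon; have [->|_] := eqVneq e x; rewrite ?mulr0 ?mulr1n.
Qed.

Lemma tdiagZD w c f g : tdiag w (c *: f + g) = c *: tdiag w f + tdiag w g.
Proof.
by apply: tcoef_inj => x; rewrite tcoefZD !tcoef_diag tcoefZD mulrDr; ring.
Qed.

Lemma tdiagD w f g : tdiag w (f + g) = tdiag w f + tdiag w g.
Proof. by rewrite -{1}[f]scale1r tdiagZD scale1r. Qed.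

Lemma tdiagU w c e : tdiag w (tmon c e) = tmon (w e * c) e.
Proof.
apply: tcoef_inj => x; rewrite tcoef_diag !tcoef_mon.
by have [->|_] := eqVneq e x; rewrite ?mulr0 ?mulr1n.
Qed.

Lemma tdiagM w f g : (forall a b, w (a + b) = w a * w b) ->
  tdiag w (f * g) = tdiag w f * tdiag w g.
Proof.
move=> wD; elim/twisted_ind: f => [c1 e1|f1 f2 H1 H2].
  elim/twisted_ind: g => [c2 e2|g1 g2 H1 H2].
    by rewrite !tdiagU !tmonM tdiagU wD; congr (tmon _ _); ring.
  by rewrite mulrDr !tdiagD mulrDr H1 H2.
by rewrite mulrDl !tdiagD mulrDl H1 H2.
Qed.

End TwistedCoefficients.

(** * Leading terms *)

(** The cone of a translation-invariant total order: e is larger than x when [pos (e - x)]. *)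
Record is_positive_cone (K : zmodType) (pos : K -> bool) : Prop := {
  posD : forall a b, pos a -> pos b -> pos (a + b);
  pos0 : ~~ pos 0;
  pos_total : forall a, a != 0 -> pos a || pos (- a) }.

Section LeadingTerms.
Variables (k : fieldType) (K : zmodType) (B : bicharacter k K).
Variables (pos : K -> bool) (posP : is_positive_cone pos).
Variable T : twisted_algebra B.
Implicit Types (f g : T) (e x : K) (c : k).

Local Notation tmon := (@tmon _ _ _ T).

Definition below e f := forall x, x \in tsupp f -> pos (e - x).

Definition lead f e := exists c f', [/\ c != 0, f = tmon c e + f' & below e f'].

Lemma belowD e f g : below e f -> below e g -> below e (f + g).
Proof. by move=> ef eg x /tsuppD[/ef|/eg]. Qed.

Lemma below0 e : below e 0.
Proof. by move=> x; rewrite mem_tsupp tcoef0 eqxx. Qed.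

Lemma below_mon e c x : pos (e - x) -> below e (tmon c x).
Proof. by move=> ex y /tsupp_mon ->. Qed.

Lemma lead_mon c e : c != 0 -> lead (tmon c e) e.
Proof. by exists c, 0; split; rewrite ?addr0 //; apply: below0. Qed.

Lemma lead1 : lead 1 0.
Proof. by rewrite -tmon1; apply: lead_mon; rewrite oner_neq0. Qed.

(** The values of a bicharacter are nonzero, so the product of the leading monomials survives; every
    other product of terms is strictly smaller. *)
Lemma leadM f g e e' : lead f e -> lead g e' -> lead (f * g) (e + e').
Proof.
move=> [c [f' [c0 -> bf]]] [d [g' [d0 -> bg]]].
exists (c * d * B e e'), (tmon c e * g' + f' * tmon d e' + f' * g'); split.
- by rewrite !mulf_neq0 // bichar_neq0.
- by rewrite mulrDl !mulrDr tmonM !addrA.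
have D a b : e + e' - (a + b) = (e - a) + (e' - b) by rewrite opprD addrACA.
apply: belowD; [apply: belowD|] => x /tsuppM[a [b [fa gb ->]]] /=; rewrite D.
- by rewrite (tsupp_mon fa) subrr add0r; apply: bg.
- by rewrite (tsupp_mon gb) subrr addr0; apply: bf.
- by apply: (posD posP); [apply: bf|apply: bg].
Qed.

Lemma lead_neq0 f e : lead f e -> tcoef f e != 0.
Proof.
move=> [c [f' [c0 -> bf]]]; rewrite tcoefD tcoef_mon eqxx mulr1n.
suff -> : tcoef f' e = 0 by rewrite addr0.
apply/eqP/negPn; rewrite -mem_tsupp; apply/negP => /bf.
by rewrite subrr; apply/negP/(pos0 posP).
Qed.

Lemma tcoef_above_lead f e x : lead f e -> x != e -> ~~ pos (e - x) -> tcoef f x = 0.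
Proof.
move=> [c [f' [c0 -> bf]]] xe px; rewrite tcoefD tcoef_mon eq_sym.
rewrite (negPf xe) add0r; apply/eqP/negPn; rewrite -mem_tsupp.
by apply/negP => /bf; apply/negP.
Qed.

Lemma seq_max (s : seq K) : s != [::] ->
  exists2 e, e \in s & forall x, x \in s -> x != e -> pos (e - x).
Proof.
elim: s => [//|a [|b s] IHs] _.
  exists a; first exact: mem_head.
  by move=> x; rewrite inE => ->.
have [//|e es emax] := IHs.
have [->|ae] := eqVneq a e.
  exists e; first exact: mem_head.
  by move=> x; rewrite inE => /orP[->//|]; apply: emax.
have /(pos_total posP) : a - e != 0 by rewrite subr_eq0.
rewrite opprB => /orP[pa|pe].
  exists a; first exact: mem_head.
  move=> x; rewrite inE => /orP[->//|xs] xa.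
  have [->//|xe] := eqVneq x e.
  by rewrite -(subrK e a) -addrA (posD posP) // emax.
exists e; first by rewrite inE es orbT.
by move=> x; rewrite inE => /orP[/eqP->//|]; apply: emax.
Qed.

Lemma lead_exists f : f != 0 -> exists e, lead f e.
Proof.
rewrite -tsupp0P => /seq_max[e ef emax].
exists e, (tcoef f e), (f - tmon (tcoef f e) e); rewrite subrKC; split=> //.
  by rewrite -mem_tsupp.
move=> x; rewrite mem_tsupp tcoefB tcoef_mon.
have [->|ex] := eqVneq e x.
  by rewrite mulr1n [tcoef _ _ - _]subrr eqxx.
rewrite /= mulr0n subr0 => fx; apply: emax; first by rewrite mem_tsupp.
by rewrite eq_sym.
Qed.

Lemma lead0 e : ~ lead 0 e.
Proof. by move=> /lead_neq0; rewrite tcoef0 eqxx. Qed.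

Lemma twisted_mulf_eq0 f g : f * g = 0 -> f = 0 \/ g = 0.
Proof.
move=> fg0; have [->|/lead_exists[e le]] := eqVneq f 0; first by left.
have [->|/lead_exists[e' le']] := eqVneq g 0; first by right.
by have := leadM le le'; rewrite fg0 => /lead0.
Qed.

Lemma triangular_kernel (A : lmodType k) (phi : {linear A -> T}) (N : Type)
    (E : N -> K) (F : N -> A) (s : seq (k * N)) :
  (forall m m', E m = E m' -> F m = F m') ->
  (forall m, lead (phi (F m)) (E m)) ->
  phi (\sum_(p <- s) p.1 *: F p.2) = 0 -> \sum_(p <- s) p.1 *: F p.2 = 0.
Proof.
move=> EF lF; have [n] := ubnP (size s); elim: n s => // n IHn s sn.
have [|s0] := eqVneq (map (fun p => E p.2) s) [::].
  by case: (s); rewrite ?big_nil.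
have [e es emax] := seq_max s0.
have memE p : List.In p s -> E p.2 \in [seq E p.2 | p <- s].
  elim: (s) => //= q s' IHs [->|/IHs ps]; first exact: mem_head.
  by rewrite inE ps orbT.
have [m0 em] : exists m0, E m0 = e.
  elim: (s) es => //= p s' IHs; rewrite inE => /orP[/eqP ->|//].
  by exists p.2.
(* All terms of exponent [e] collapse to a single multiple [C] of [F m0]; the others do not reach
   the coefficient at [e]. *)
rewrite (bigID (fun p => E p.2 == e)) /=.
rewrite (eq_bigr (fun p => p.1 *: F m0)); last first.
  by move=> p /eqP pe; rewrite (EF p.2 m0) // pe em.
rewrite -scaler_suml; set C := \sum_(_ <- _ | _) _ => eq0.
have rest0 : tcoef (phi (\sum_(p <- s | E p.2 != e) p.1 *: F p.2)) e = 0.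
  rewrite linear_sum tcoef_sum.
  have {memE} : forall p, List.In p s -> E p.2 != e -> pos (e - E p.2).
    by move=> p /memE; apply: emax.
  elim: (s) => [|p s' IHs] memE; first by rewrite big_nil.
  rewrite big_cons; have IH := IHs (fun q qs => memE q (or_intror qs)).
  case: ifP => // pe; rewrite IH linearZ /= tcoefZ addr0.
  have pex : pos (e - E p.2) by apply: memE => //; left.
  rewrite (tcoef_above_lead (lF _)) ?mulr0 1?eq_sym //.
  apply/negP => pos'; have := posD posP pex pos'.
  by rewrite addrA subrK subrr; apply/negP/(pos0 posP).
have C0 : C = 0.
  have := congr1 (fun u : T => tcoef u e) eq0; rewrite linearD linearZ /=.
  rewrite tcoefD tcoefZ rest0 tcoef0 addr0 => /eqP.
  by rewrite mulf_eq0 -em (negPf (lead_neq0 (lF m0))) orbF => /eqP.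
move: eq0; rewrite C0 scale0r add0r.
rewrite -big_filter; apply: IHn.
rewrite size_filter; move: sn; rewrite ltnS; apply: leq_trans.
rewrite -(count_predC (fun p => E p.2 == e) s) addnC -[X in (X < _)%N]addn0.
rewrite ltn_add2l -has_count.
elim: (s) es => //= p s' IHs; rewrite inE => /orP[/eqP ->|/IHs ->].
  by rewrite eqxx.
by rewrite orbT.
Qed.

End LeadingTerms.

(** * Spanning monomials modulo the excluded generators *)

Section QCommutation.
Variables (k : fieldType) (A : algType k).
Implicit Types (u v w : A) (c d : k).

Definition qcomm u v := exists2 c : k, c != 0 & u * v = c *: (v * u).

Lemma qcomm_sym u v : qcomm u v -> qcomm v u.
Proof.
by move=> [c c0 uv]; exists c^-1; rewrite ?invr_eq0 // uv scalerA mulVf ?scale1r.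
Qed.

Lemma qcomm1 u : qcomm u 1.
Proof. by exists 1; rewrite ?oner_neq0 // mulr1 mul1r scale1r. Qed.

Lemma qcommM u v w : qcomm u v -> qcomm u w -> qcomm u (v * w).
Proof.
move=> [c c0 uv] [d d0 uw]; exists (c * d); first exact: mulf_neq0.
by rewrite mulrA uv -scalerAl -[v * u * w]mulrA uw -scalerAr scalerA mulrA.
Qed.

Lemma qcommX u v m : qcomm u v -> qcomm u (v ^+ m).
Proof.
by move=> uv; elim: m => [|m IHm]; rewrite ?exprS; [exact: qcomm1|exact: qcommM].
Qed.

End QCommutation.

(** Indices run over all natural numbers, scalars out of range being 1 in the application; hence
    only the condition on roots of unity is restricted to [i < n]. *)
Record weyl_scalars (k : fieldType) (n : nat) (q : nat -> k) (g : nat -> nat -> k)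
  : Prop := {
  wq_neq0 : forall i, q i != 0;
  wq_nroot : forall i, (i < n)%N -> not_root_of_unity (q i);
  wg_diag : forall i, g i i = 1;
  wgV : forall i j, g i j * g j i = 1 }.

Section WeylAlgebra.
Variables (k : fieldType) (n : nat) (q : nat -> k) (g : nat -> nat -> k).
Hypothesis scal : weyl_scalars n q g.

Let q_neq0 := wq_neq0 scal.
Let gV := wgV scal.

Lemma wg_neq0 i j : g i j != 0.
Proof. by apply/eqP => g0; have /eqP := gV i j; rewrite g0 mul0r eq_sym oner_eq0. Qed.

Lemma wg_inv i j : (g i j)^-1 = g j i.
Proof. by apply: (mulfI (wg_neq0 i j)); rewrite mulfV ?wg_neq0 ?gV. Qed.

Lemma wq_neq1 i : (i < n)%N -> q i - 1 != 0.
Proof. by move=> lt_i; rewrite subr_eq0; have := wq_nroot scal lt_i (ltn0Sn 0). Qed.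

Section Relations.
Variables (A : algType k) (X Y : nat -> A).

(* For m > 0 this is x_(m-1) y_(m-1) - y_(m-1) x_(m-1): indices start at 0. *)
Fixpoint zed m : A := if m is l.+1 then zed l + (q l - 1) *: (Y l * X l) else 1.

Record weyl_rels : Prop := {
  rYY : forall i j, (i < n)%N -> (j < n)%N -> Y i * Y j = g i j *: (Y j * Y i);
  rXYlt : forall i j, (i < j)%N -> (j < n)%N -> X i * Y j = g j i *: (Y j * X i);
  rXYgt : forall i j, (j < i)%N -> (i < n)%N ->
    X i * Y j = (q j * g j i) *: (Y j * X i);
  rXX : forall i j, (i < j)%N -> (j < n)%N ->
    X i * X j = (q i * g i j) *: (X j * X i);
  rXYe : forall i, (i < n)%N -> X i * Y i = q i *: (Y i * X i) + zed i }.

Hypothesis rel : weyl_rels.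

Lemma zedS m : zed m.+1 = zed m + (q m - 1) *: (Y m * X m). Proof. by []. Qed.

(** Induction on m. For i different from m, the added term y_m x_m has the same commutation factor
    with x_i as z_m; for i = m, straightening x_m y_m produces another x_m z_m, and the coefficients
    1 and q_m - 1 add up to q_m. *)
Lemma zedX m i : (m <= n)%N -> (i < n)%N ->
  zed m * X i = (if (i < m)%N then (q i)^-1 else 1) *: (X i * zed m).
Proof.
move=> le_m lt_i; elim: m le_m => [|m IHm] lt_m.
  by rewrite /= mul1r mulr1 scale1r.
have IH := IHm (ltnW lt_m); rewrite zedS mulrDl mulrDr IH {IHm}.
rewrite ltnS scalerDr -scalerAl -scalerAr scalerA.
case: ltngtP IH => [im|mi|->] IH.
- congr (_ + _); rewrite -mulrA.
  have -> : X m * X i = (q i * g i m)^-1 *: (X i * X m).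
    by rewrite (rXX rel im lt_m) scalerA mulVf ?scale1r // mulf_neq0 ?wg_neq0.
  rewrite -scalerAr mulrA [X i * _]mulrA (rXYlt rel im lt_m) -!scalerAl !scalerA.
  by congr (_ *: _); rewrite invfM wg_inv; ring.
- congr (_ + _); rewrite -mulrA (rXX rel mi lt_i) -scalerAr mulrA [X i * _]mulrA.
  by rewrite (rXYgt rel mi lt_i) -!scalerAl !scalerA; congr (_ *: _); ring.
rewrite scale1r [X m * (_ * _)]mulrA (rXYe rel lt_m) mulrDl -scalerAl IH scale1r.
rewrite scalerDr !scalerA [RHS]addrCA -scalerDl addrC -{1}[X m * zed m]scale1r.
by congr (_ *: _ + _ *: _); field; exact: q_neq0.
Qed.

Lemma zedY m i : (m <= n)%N -> (i < n)%N ->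
  zed m * Y i = (if (i < m)%N then q i else 1) *: (Y i * zed m).
Proof.
move=> le_m lt_i; elim: m le_m => [|m IHm] lt_m.
  by rewrite /= mul1r mulr1 scale1r.
have IH := IHm (ltnW lt_m); rewrite zedS mulrDl mulrDr IH {IHm}.
rewrite ltnS scalerDr -scalerAl -scalerAr scalerA -[Y m * X m * Y i]mulrA.
case: ltngtP IH => [im|mi|->] IH.
- congr (_ + _); rewrite (rXYgt rel im lt_m) -scalerAr mulrA [Y i * _]mulrA.
  rewrite (rYY rel lt_m lt_i) -!scalerAl !scalerA.
  by congr (_ *: _); rewrite -[g m i]wg_inv; field; exact: wg_neq0.
- congr (_ + _); rewrite (rXYlt rel mi lt_i) -scalerAr mulrA [Y i * _]mulrA.
  rewrite (rYY rel lt_m lt_i) -!scalerAl !scalerA.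
  by congr (_ *: _); rewrite -[g m i]wg_inv; field; exact: wg_neq0.
rewrite scale1r (rXYe rel lt_m) mulrDr -scalerAr.
rewrite !scalerDr !scalerA addrCA -{1}[Y m * zed m]scale1r -scalerDl addrC.
by congr (_ *: _ + _ *: _); ring.
Qed.

Lemma qcomm_zedX m i : (m <= n)%N -> (i < n)%N -> qcomm (zed m) (X i).
Proof.
move=> le_m lt_i; exists (if (i < m)%N then (q i)^-1 else 1); last exact: zedX.
by case: ifP; rewrite ?invr_eq0 ?q_neq0 ?oner_neq0.
Qed.

Lemma qcomm_zedY m i : (m <= n)%N -> (i < n)%N -> qcomm (zed m) (Y i).
Proof.
move=> le_m lt_i; exists (if (i < m)%N then q i else 1); last exact: zedY.
by case: ifP; rewrite ?q_neq0 ?oner_neq0.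
Qed.

Lemma wqg_neq0 i j : q i * g i j != 0.
Proof. by rewrite mulf_neq0 ?wg_neq0. Qed.

Lemma qcommXX i j : (i < n)%N -> (j < n)%N -> qcomm (X i) (X j).
Proof.
move=> lt_i lt_j; case: (ltngtP i j) => [ij|ji|->].
- by exists (q i * g i j); [exact: wqg_neq0|exact: (rXX rel)].
- by apply: qcomm_sym; exists (q j * g j i); [exact: wqg_neq0|exact: (rXX rel)].
- by exists 1; [exact: oner_neq0|rewrite scale1r].
Qed.

Lemma qcommYY i j : (i < n)%N -> (j < n)%N -> qcomm (Y i) (Y j).
Proof. by move=> lt_i lt_j; exists (g i j); [exact: wg_neq0|exact: (rYY rel)]. Qed.

Lemma qcommXY i j : (i < n)%N -> (j < n)%N -> i != j -> qcomm (X i) (Y j).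
Proof.
move=> lt_i lt_j; case: (ltngtP i j) => // [ij|ji] _.
- by exists (g j i); [exact: wg_neq0|exact: (rXYlt rel)].
- by exists (q j * g j i); [exact: wqg_neq0|exact: (rXYgt rel)].
Qed.

End Relations.

Section Spanning.
Variables (A : algType k) (X Y : nat -> A).
Hypothesis rel : weyl_rels X Y.
Local Notation zed := (zed X Y).

Variables (a b : nat -> bool).

(* Whether z_m lies outside the prime ideal encoded by the bits a, b. *)
Definition st m := if m is l.+1 then a l && b l else true.

Record contains_gens (I : set A) : Prop := {
  cgX : forall i, (i < n)%N -> ~~ a i -> I (X i);
  cgY : forall i, (i < n)%N -> ~~ b i -> ~~ st i -> I (Y i);
  cgZ : forall i, (i < n)%N -> ~~ st i.+1 -> I (zed i.+1) }.

(** With y_i before x_i, straightening x_i y_i only creates z_i, a polynomial in generators of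
    smaller index. *)
Definition block (m : nat -> nat * nat) i := Y i ^+ (m i).1 * X i ^+ (m i).2.

Fixpoint mono (m : nat -> nat * nat) l := if l is l'.+1 then mono m l' * block m l' else 1.

Definition update (m : nat -> nat * nat) j v := fun i => if i == j then v else m i.

Lemma mono_eq m m' l : (forall i, (i < l)%N -> m i = m' i) -> mono m l = mono m' l.
Proof.
elim: l => //= l IHl mm'; rewrite IHl => [|i il]; last by apply: mm'; apply: ltnW.
by rewrite /block mm'.
Qed.

(** The only generators that do not q-commute are x_i and y_i of equal index, and index [j] does not
    occur in the first [l] blocks. *)
Lemma mono_qcomm m j l u : (l <= j)%N -> (j < n)%N ->
  (u = X j \/ u = Y j \/ exists2 i, (i <= n)%N & u = zed i) -> qcomm u (mono m l).
Proof.
move=> + lt_j Hu; elim: l => [|l IHl] lj; first exact: qcomm1.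
have lt_l : (l < n)%N := ltn_trans lj lt_j.
apply: qcommM; first by apply: IHl; apply: ltnW.
have ne : l != j by rewrite neq_ltn lj.
apply: qcommM; apply: qcommX; case: Hu => [->|[->|[i le_i ->]]].
- by apply: (qcommXY rel); rewrite // eq_sym.
- exact: (qcommYY rel).
- exact: (qcomm_zedY rel).
- exact: (qcommXX rel).
- by apply: qcomm_sym; apply: (qcommXY rel).
- exact: (qcomm_zedX rel).
Qed.

(** Isolates the block of index [j]: a factor of index [j] arriving from the left passes [L] up to a
    scalar, and [L], [R] do not depend on the content [v] of the block. *)
Lemma mono_split m j l : (j < l)%N -> (l <= n)%N -> exists L R,
  [/\ forall v, mono (update m j v) l = L * (Y j ^+ v.1 * X j ^+ v.2) * R,
      qcomm (X j) L, qcomm (Y j) L & forall i, (i <= n)%N -> qcomm (zed i) L].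
Proof.
elim: l => // l IHl; rewrite ltnS leq_eqVlt => /orP[/eqP -> {IHl j}|jl] le_l.
  exists (mono m l), 1; split=> [v|||i le_i].
  - rewrite /= mulr1 /block /update eqxx; congr (_ * _).
    by apply: mono_eq => i il; rewrite (ltn_eqF il).
  - by apply: mono_qcomm (le_l) _ => //; left.
  - by apply: mono_qcomm (le_l) _ => //; right; left.
  - by apply: mono_qcomm (le_l) _ => //; right; right; exists i.
have [//||L [R [eL qX qY qz]]] := IHl; first exact: ltnW.
exists L, (R * block m l); split=> // v.
by rewrite /= eL /block /update (gtn_eqF jl) !mulrA.
Qed.

(* The last condition is there because y_i x_i = (z_(i+1) - z_i) / (q_i - 1), where
   z_(i+1) lies in the ideal. *)
Definition allowed m := forall i, (i < n)%N ->
  [/\ (0 < (m i).2)%N -> a i, (0 < (m i).1)%N -> b i || st i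
    & st i -> ~~ b i -> (m i).1 = 0%N \/ (m i).2 = 0%N].

Hypothesis canon : forall i, (i < n)%N -> st i -> a i.
Variables (I : set A) (idI : is_ideal I) (gensI : contains_gens I).

Definition spanned (f : A) := exists s : seq (k * {m | allowed m}),
  I (f - \sum_(p <- s) p.1 *: mono (sval p.2) n).

Let idMl u v : I v -> I (u * v). Proof. exact: (idealMl idI). Qed.
Let idMr u v : I u -> I (u * v). Proof. exact: (Defs.idealMr idI). Qed.

Lemma idealZ c u : I u -> I (c *: u).
Proof. by move=> Iu; rewrite -[u]mul1r scalerAl; apply: idMl. Qed.

Lemma idealN u : I u -> I (- u).
Proof. by move=> Iu; rewrite -scaleN1r; apply: idealZ. Qed.

Lemma idealB u v : I u -> I v -> I (u - v).
Proof. by move=> Iu Iv; apply: idealD => //; apply: idealN. Qed.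

Lemma spanned_ideal u : I u -> spanned u.
Proof. by move=> Iu; exists [::]; rewrite big_nil subr0. Qed.

Lemma spannedD u v : spanned u -> spanned v -> spanned (u + v).
Proof.
move=> [s Is] [t It]; exists (s ++ t); rewrite big_cat opprD addrACA.
exact: idealD.
Qed.

Lemma spannedZ c u : spanned u -> spanned (c *: u).
Proof.
move=> [s Is]; exists [seq (c * p.1, p.2) | p <- s]; rewrite big_map /=.
under eq_bigr do rewrite -scalerA.
by rewrite -scaler_sumr -scalerBr; apply: idealZ.
Qed.

Lemma spanned_mono m : allowed m -> spanned (mono m n).
Proof.
move=> am; exists [:: (1, exist _ m am)].
by rewrite big_seq1 scale1r subrr; apply: ideal0.
Qed.

Definition lclosed (u : A) := forall f, spanned f -> spanned (u * f).

Lemma lclosed_mono u :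
  (forall m, allowed m -> spanned (u * mono m n)) -> lclosed u.
Proof.
move=> um f [s Is]; rewrite -[f](subrK (\sum_(p <- s) p.1 *: mono (sval p.2) n)).
rewrite mulrDr; apply: spannedD; first by apply: spanned_ideal; apply: idMl.
rewrite mulr_sumr; elim: s {Is} => [|[c [m am]] s IHs].
  by rewrite big_nil; apply: spanned_ideal; apply: ideal0.
rewrite big_cons; apply: spannedD => //=; rewrite -scalerAr.
by apply: spannedZ; apply: um.
Qed.

Lemma lclosedD u v : lclosed u -> lclosed v -> lclosed (u + v).
Proof. by move=> cu cv f sf; rewrite mulrDl; apply: spannedD; auto. Qed.

Lemma lclosedZ c u : lclosed u -> lclosed (c *: u).
Proof. by move=> cu f sf; rewrite -scalerAl; apply: spannedZ; auto. Qed.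

Lemma lclosedM u v : lclosed u -> lclosed v -> lclosed (u * v).
Proof. by move=> cu cv f sf; rewrite -mulrA; auto. Qed.

Lemma lclosed1 : lclosed 1.
Proof. by move=> f sf; rewrite mul1r. Qed.

Lemma upd_id m j : update m j (m j) =1 m.
Proof. by move=> i; rewrite /update; case: eqP => [->|]. Qed.

Lemma allowed_upd m j v : allowed m ->
  [/\ (0 < v.2)%N -> a j, (0 < v.1)%N -> b j || st j
    & st j -> ~~ b j -> v.1 = 0%N \/ v.2 = 0%N] -> allowed (update m j v).
Proof. by move=> am av i lt_i; rewrite /update; case: eqP => [->//|_]; apply: am. Qed.

Lemma spanned_qcomm u v w : qcomm u v -> spanned (v * u * w) -> spanned (u * v * w).
Proof. by move=> [c _ ->] sw; rewrite -scalerAl; apply: spannedZ. Qed.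

(** Strong induction on j, because z_j is a polynomial in the generators of smaller index. The case
    of y_j is settled before that of x_j, whose passage across a power of y_j produces y_j again. *)
Lemma lclosed_gens j : (j < n)%N -> lclosed (X j) /\ lclosed (Y j).
Proof.
elim/ltn_ind: j => j IHj lt_j.
have cz : lclosed (zed j).
  have: (j <= j)%N by []; elim: {1 3}j => [|l IHl] lj; first exact: lclosed1.
  have [cX cY] := IHj l lj (ltn_trans lj lt_j).
  by apply: lclosedD (IHl (ltnW lj)) _; apply/lclosedZ/lclosedM.
have cY : lclosed (Y j).
  apply: lclosed_mono => m am.
  have [L [R [eL qX qY qz]]] := mono_split m lt_j (leqnn n).
  have em : mono m n = L * (Y j ^+ (m j).1 * X j ^+ (m j).2) * R.
    by rewrite -eL; apply: mono_eq => i _; rewrite upd_id.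
  have [nY|] := boolP (b j || st j); last first.
    rewrite negb_or => /andP[bj sj]; apply: spanned_ideal.
    by apply: idMr; apply: (cgY gensI).
  rewrite em -[L * _ * R]mulrA mulrA; apply: spanned_qcomm => //.
  have [case2|ncase2] := boolP [&& st j, ~~ b j & (0 < (m j).2)%N].
    case/and3P: case2 => sj bj r0; have [_ _ /(_ sj bj) [p0|e0]] := am j lt_j; last first.
      by rewrite e0 in r0.
    rewrite p0 expr0 mul1r; case E : (m j).2 r0 => [//|r] _.
    have am' : allowed (update m j (0%N, r)).
      apply: allowed_upd am _; split=> //= _; first exact: canon.
      by left.
    have sm' : spanned (zed j * mono (update m j (0%N, r)) n) by apply/cz/spanned_mono.
    (* This replaces the forbidden product y_j x_j by a multiple of z_j, as z_(j+1) lies in [I]. *)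
    have yx : Y j * X j = (q j - 1)^-1 *: (zed j.+1 - zed j).
      by rewrite zedS addrAC subrr add0r scalerK ?wq_neq1.
    rewrite exprS !mulrA -[L * Y j * X j]mulrA yx -scalerAr -!scalerAl mulrBr !mulrBl.
    apply: spannedZ; apply: spannedD.
      apply: spanned_ideal; apply: idMr; apply: idMr; apply: idMl.
      by apply: (cgZ gensI) => //=; rewrite negb_and bj orbT.
    rewrite -scaleN1r; apply: spannedZ; rewrite -mulrA; apply: spanned_qcomm.
      by apply: qcomm_sym; apply: qz; apply: ltnW.
    by move: sm'; rewrite eL expr0 mul1r !mulrA.
  have -> : L * Y j * (Y j ^+ (m j).1 * X j ^+ (m j).2 * R) =
      mono (update m j ((m j).1.+1, (m j).2)) n by rewrite eL exprS !mulrA.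
  have [h1 h2 h3] := am j lt_j; apply: spanned_mono; apply: allowed_upd am _.
  split=> // sj bj; right; apply/eqP; rewrite -leqn0 leqNgt.
  by move: ncase2; rewrite sj bj.
split=> //; apply: lclosed_mono => m0 am0.
have [L [R [eL qX qY qz]]] := mono_split m0 lt_j (leqnn n).
(* The exponents at [j] become an explicit pair, so that the exponent of y_j can be varied by
   induction. *)
have em0 : mono m0 n = mono (update m0 j (m0 j)) n.
  by apply: mono_eq => i _; rewrite upd_id.
rewrite em0; have: allowed (update m0 j (m0 j)).
  by apply: allowed_upd => //; apply: am0.
case: (m0 j) => p r {em0}; elim: p => [|p IHp] am.
  have [aj|aj] := boolP (a j); last first.
    by apply: spanned_ideal; apply: idMr; apply: (cgX gensI).
  rewrite eL expr0 mul1r -[L * _ * R]mulrA mulrA; apply: spanned_qcomm => //.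
  have -> : L * X j * (X j ^+ r * R) = mono (update m0 j (0%N, r.+1)) n.
    by rewrite eL expr0 mul1r exprS !mulrA.
  apply: spanned_mono; apply: allowed_upd => //; split=> // _ _; by left.
have am' : allowed (update m0 j (p, r)).
  apply: allowed_upd => //; have := am j lt_j; rewrite /update eqxx /=.
  move=> [h1 h2 h3]; split=> //= [_|sj bj]; first exact: h2.
  by right; case: (h3 sj bj).
rewrite eL exprS /= -!mulrA mulrA; apply: spanned_qcomm => //.
rewrite (_ : _ * _ = L * (X j * Y j) * (Y j ^+ p * (X j ^+ r * R))); last first.
  by rewrite !mulrA.
rewrite (rXYe rel lt_j) mulrDr mulrDl; apply: spannedD.
  rewrite -scalerAr -scalerAl; apply: spannedZ.
  rewrite [L * (_ * _)]mulrA -[L * Y j * _ * _]mulrA.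
  apply: spanned_qcomm; first exact: qcomm_sym.
  rewrite -mulrA; apply: cY; rewrite mulrA.
  apply: spanned_qcomm; first exact: qcomm_sym.
  by have := IHp am'; rewrite eL /= !mulrA.
apply: spanned_qcomm; first by apply: qcomm_sym; apply: qz; apply: ltnW.
have := cz _ (spanned_mono am'); rewrite eL /=.
by rewrite !mulrA.
Qed.

Hypothesis genA : forall S : set A, is_subalgebra S ->
  (forall i, (i < n)%N -> S (X i) /\ S (Y i)) -> S = setT.

(** The elements whose left multiplication preserves the span form a subalgebra containing the
    generators; f is then applied to the empty monomial. *)
Lemma spannedT f : spanned f.
Proof.
have clT : lclosed = setT.
  apply: genA => [|i]; last exact: lclosed_gens.
  split; [exact: lclosed1| |exact: lclosedM].
  by move=> c u v cu cv; apply: lclosedD => //; apply: lclosedZ.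
have cf : lclosed f by rewrite clT.
rewrite -[f]mulr1; apply: cf.
have -> : 1 = mono (fun=> (0%N, 0%N)) n.
  by elim: (n) => //= l <-; rewrite /block !expr0 !mulr1.
by apply: spanned_mono => i _; split=> // _ _; left.
Qed.

End Spanning.
End WeylAlgebra.

(** * Homomorphisms to a quantum torus *)

Section QuantumTorus.
Variables (k : fieldType) (n : nat) (q : nat -> k) (g : nat -> nat -> k).
Hypothesis scal : weyl_scalars n q g.

Let q_neq0 := wq_neq0 scal.
Let qg_neq0 := wqg_neq0 scal.

(* The exponent (d, z) stands for prod_i X_i ^ d_i * Z_(i+1) ^ z_i, where Z_(i+1)
   is the variable corresponding to z_(i+1). *)
Definition expo : zmodType := ({poly int} * {poly int})%type.
Implicit Types (e f : expo).

(** Total exponent of the variables that do not commute with X_i, namely the Z_(m+1) with m at least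
    i; each contributes a factor q_i. *)
Definition zsum f i : int := \sum_(i <= m < n) f.2`_m.

(** A scalar appears only when X_i stands to the left of some Z_m with i < m, or of some X_j with j
    < i. The two products encode x_i z_m = q_i z_m x_i and x_j x_i = q_j g_ji x_i x_j. *)
Definition qbeta e f : k :=
  (\prod_(i < n) q i ^ (e.1`_i * zsum f i)) *
  (\prod_(l < n) \prod_(j < l) (q j * g j l) ^ (- (e.1`_l * f.1`_j))).

Lemma qbetaDl a b c : qbeta (a + b) c = qbeta a c * qbeta b c.
Proof.
rewrite /qbeta mulrACA; congr (_ * _); rewrite -big_split; apply: eq_bigr => i _ /=.
  by rewrite coefD mulrDl expfzDr.
rewrite -big_split; apply: eq_bigr => j _ /=.
by rewrite coefD mulrDl opprD expfzDr.
Qed.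

Lemma qbetaDr a b c : qbeta a (b + c) = qbeta a b * qbeta a c.
Proof.
rewrite /qbeta mulrACA; congr (_ * _); rewrite -big_split; apply: eq_bigr => i _ /=.
  rewrite -expfzDr // -mulrDr /zsum -big_split /=; congr (_ ^ (_ * _)).
  by apply: eq_bigr => m _; rewrite coefD.
rewrite -big_split; apply: eq_bigr => j _ /=.
by rewrite coefD mulrDr opprD expfzDr.
Qed.

Lemma qbeta_neq0 a b : qbeta a b != 0.
Proof.
rewrite mulf_neq0 //; apply/prodf_neq0 => i _; first exact: expfz_neq0.
by apply/prodf_neq0 => j _; apply: expfz_neq0.
Qed.

Definition qbichar : bicharacter k expo := Bicharacter qbetaDl qbetaDr qbeta_neq0.

Lemma qbetaNr a b : qbeta a (- b) = (qbeta a b)^-1.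
Proof. exact: (bicharNr qbichar). Qed.

Lemma qbetaNl a b : qbeta (- a) b = (qbeta a b)^-1.
Proof. exact: (bicharNl qbichar). Qed.

Definition expX i : expo := ('X^i, 0).
Definition expZ m : expo := (0, if m is l.+1 then 'X^l else 0).

Lemma coefXn_id i : ('X^i : {poly int})`_i = 1.
Proof. by rewrite coefXn eqxx. Qed.

Lemma coefXn_ne i j : i != j -> ('X^j : {poly int})`_i = 0.
Proof. by move=> /negPf ne; rewrite coefXn ne. Qed.

Lemma qbetaX i f : (i < n)%N -> qbeta (expX i) f =
  q i ^ zsum f i * \prod_(j < i) (q j * g j i) ^ (- f.1`_j).
Proof.
move=> lt_i; rewrite /qbeta /=; congr (_ * _).
  rewrite (bigD1 (Ordinal lt_i)) //= big1 => [|j ne].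
    by rewrite coefXn_id mul1r mulr1.
  by rewrite (coefXn_ne (ne : val j != i)) mul0r expr0z.
rewrite (bigD1 (Ordinal lt_i)) //= [X in _ * X]big1 => [|j ne].
  by rewrite mulr1; apply: eq_bigr => j _; rewrite coefXn_id mul1r.
by apply: big1 => l _; rewrite (coefXn_ne (ne : val j != i)) mul0r oppr0 expr0z.
Qed.

Lemma qbetaZ m f : qbeta (expZ m) f = 1.
Proof.
rewrite /qbeta /= big1 => [|i _]; last by rewrite coef0 mul0r expr0z.
rewrite mul1r big1 // => i _; apply: big1 => j _.
by rewrite coef0 mul0r oppr0 expr0z.
Qed.

Lemma zsumZ m i : (m <= n)%N -> zsum (expZ m) i = (i < m)%N%:R.
Proof.
case: m => [|m] lt_m; rewrite /zsum /=.
  by rewrite big1 // => j _; rewrite coef0.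
rewrite ltnS; case: leqP => [im|mi].
  rewrite (bigD1_seq m) ?iota_uniq ?mem_index_iota ?im //= coefXn_id.
  by rewrite big1 // => j jm; rewrite coefXn_ne.
rewrite big_nat big1 // => j /andP[ij _].
by rewrite coefXn_ne // neq_ltn (leq_trans mi) ?orbT.
Qed.

Lemma zsumX i j : zsum (expX i) j = 0.
Proof. by rewrite /zsum big1 // => m _; rewrite coef0. Qed.

Lemma qbetaXX i j : (i < n)%N ->
  qbeta (expX i) (expX j) = if (j < i)%N then (q j * g j i)^-1 else 1.
Proof.
move=> lt_i; rewrite qbetaX // zsumX expr0z mul1r; case: ltnP => [ji|ij].
  rewrite (bigD1 (Ordinal ji)) //= coefXn_id [X in _ * X]big1 => [|l ne].
    by rewrite mulr1.
  by rewrite (coefXn_ne (ne : val l != j)) oppr0 expr0z.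
rewrite big1 // => l _; rewrite coefXn_ne ?oppr0 ?expr0z //.
by rewrite neq_ltn (leq_trans (ltn_ord l) ij).
Qed.

Lemma qbetaXZ i m : (i < n)%N -> (m <= n)%N ->
  qbeta (expX i) (expZ m) = if (i < m)%N then q i else 1.
Proof.
move=> lt_i le_m; rewrite qbetaX // zsumZ // big1 => [|j _]; last first.
  by rewrite coef0 oppr0 expr0z.
by rewrite mulr1; case: ltnP.
Qed.

(* Lexicographic from the top, Z-part first: Z_(i+1) dominates Z_i and all X_j. *)
Definition expo_pos e := (0 < lead_coef e.2) || ((e.2 == 0) && (0 < lead_coef e.1)).

Lemma lead_coefD_gt0 (p r : {poly int}) :
  0 < lead_coef p -> 0 < lead_coef r -> 0 < lead_coef (p + r).
Proof.
move=> p0 r0; case: (ltngtP (size p) (size r)) => [pr|rp|e].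
- by rewrite lead_coefDr.
- by rewrite lead_coefDl.
have pos_c : 0 < (p + r)`_(size p).-1.
  by rewrite coefD {2}e -!lead_coefE addr_gt0.
rewrite lead_coefE (_ : (size (p + r)).-1 = (size p).-1) //.
have p_neq0 : (0 < size p)%N.
  by rewrite lt0n size_poly_eq0; apply: contraTneq p0 => ->; rewrite lead_coef0 ltxx.
apply/eqP; rewrite eqn_leq; apply/andP; split.
  by rewrite -!subn1 leq_sub2r // (leq_trans (size_polyD _ _)) // e maxnn.
rewrite leqNgt; apply: contraTN pos_c => lt_s.
by rewrite nth_default ?ltxx // (leq_trans _ lt_s) // leqSpred.
Qed.

Lemma expo_posP : is_positive_cone expo_pos.
Proof.
split=> [[a1 a2] [b1 b2]||[a1 a2]]; rewrite /expo_pos /=.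
- case/orP=> [a0|/andP[/eqP-> a0]] /orP[b0|/andP[/eqP-> b0]].
  + by rewrite lead_coefD_gt0.
  + by rewrite addr0 a0.
  + by rewrite add0r b0.
  + by rewrite addr0 eqxx lead_coefD_gt0 ?orbT.
- by rewrite lead_coef0 ltxx eqxx.
rewrite xpair_eqE negb_and !lead_coefN !oppr_gt0 oppr_eq0.
have [->|a2n0] := eqVneq a2 0; last first.
  by move: a2n0; rewrite -lead_coef_eq0 neq_lt => /orP[->|->]; rewrite ?orbT.
rewrite orbF lead_coef0 ltxx /= -lead_coef_eq0 neq_lt => /orP[->|->//].
by rewrite orbT.
Qed.

(** * The point of the quantum torus given by a pair of bits *)

Section TorusPoint.
Variable T : twisted_algebra qbichar.
Variables (a b : nat -> bool).
Local Notation st := (st a b).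
Hypothesis canon : forall i, (i < n)%N -> st i -> a i.
Local Notation tmon := (@tmon _ _ _ T).

Definition expY m i : expo := expZ m - expX i.

(* The values are forced by z_m |-> Z_m (or 0) and (q_i - 1) y_i x_i = z_(i+1) - z_i. *)
Definition phiX i : T := tmon (a i)%:R (expX i).

Definition phiY i : T :=
  (q i - 1)^-1 *: (tmon (b i)%:R (expY i.+1 i) - tmon (st i)%:R (expY i i)).

Lemma qbetaXY i m j : (i < n)%N -> (m <= n)%N -> qbeta (expX i) (expY m j) =
  (if (i < m)%N then q i else 1) * (if (j < i)%N then q j * g j i else 1).
Proof.
move=> lt_i le_m; rewrite qbetaDr qbetaXZ // qbetaNr qbetaXX //.
by case: (j < i)%N; rewrite ?invrK ?invr1.
Qed.

Lemma qbetaYX m i j : (i < n)%N ->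
  qbeta (expY m i) (expX j) = if (j < i)%N then q j * g j i else 1.
Proof.
move=> lt_i; rewrite qbetaDl qbetaZ qbetaNl qbetaXX // mul1r.
by case: (j < i)%N; rewrite ?invrK ?invr1.
Qed.

Lemma qbetaYY m i m' j : (i < n)%N -> (m' <= n)%N ->
  qbeta (expY m i) (expY m' j) =
  ((if (i < m')%N then q i else 1) * (if (j < i)%N then q j * g j i else 1))^-1.
Proof.
by move=> lt_i le_m; rewrite qbetaDl qbetaZ qbetaNl qbetaXY // mul1r.
Qed.

Lemma tmon_comm c x y e f : qbeta e f = c * qbeta f e ->
  tmon x e * tmon y f = c *: (tmon y f * tmon x e).
Proof.
move=> ef; rewrite !tmonM scale_tmon [in RHS]addrC; congr (tmon _ _).
by rewrite /= ef; ring.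
Qed.

(** The two terms of the image of y_j have exponents [expY j j] and [expY j.+1 j]; a commutation
    factor common to both passes to the sum. *)
Lemma phiY_comm c u j : (forall m x, (j <= m <= j.+1)%N ->
    u * tmon x (expY m j) = c *: (tmon x (expY m j) * u)) ->
  u * phiY j = c *: (phiY j * u).
Proof.
move=> uc; rewrite /phiY -scalerAr -scalerAl scalerA mulrC -scalerA.
by congr (_ *: _); rewrite mulrBr mulrBl scalerBr !uc ?leqnn ?leqnSn.
Qed.

Lemma phiYY_lt i j : (i < j)%N -> (j < n)%N ->
  phiY i * phiY j = g i j *: (phiY j * phiY i).
Proof.
move=> ij lt_j; have lt_i := ltn_trans ij lt_j.
apply: phiY_comm => m x /andP[jm mj].
suff -> : tmon x (expY m j) * phiY i = g j i *: (phiY i * tmon x (expY m j)).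
  by rewrite scalerA (wgV scal) scale1r.
apply: phiY_comm => l y /andP[il li].
have le_m : (m <= n)%N := leq_trans mj lt_j.
have le_l : (l <= n)%N := leq_trans li lt_i.
apply: tmon_comm; rewrite !qbetaYY //.
have -> : (i < m)%N by apply: leq_trans jm.
have -> : (j < l)%N = false by apply/negbTE; rewrite -leqNgt (leq_trans li).
rewrite ij ltnNge (ltnW ij) /= mulr1 mul1r -(wg_inv scal).
by field; rewrite q_neq0 (wg_neq0 scal).
Qed.

(** X_i picks up q_i on Z_(i+1) but commutes with Z_i; this is the whole difference with [phiY_phiX]
    and yields the relation between x_i and y_i. Admissibility absorbs the factor [a i] into
    [st i]. *)
Lemma phiX_phiY i : (i < n)%N -> phiX i * phiY i =
  (q i - 1)^-1 *: (tmon (q i * (a i && b i)%:R) (expZ i.+1)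
                   - tmon (st i)%:R (expZ i)).
Proof.
move=> lt_i; rewrite /phiX /phiY -scalerAr mulrBr !tmonM /= !qbetaXY //; last exact: ltnW.
rewrite !ltnn ltnSn !mulr1 ![expX i + _]addrC !subrK.
congr (_ *: (tmon _ _ - tmon _ _)).
  by case: (a i) (b i) => [] []; rewrite /= ?mulr0 ?mul0r ?mulr1 ?mul1r.
move: (canon lt_i); case: (st i) => [->//|_]; rewrite ?mulr1 ?mulr0 //.
Qed.

Lemma phiY_phiX i : (i < n)%N -> phiY i * phiX i =
  (q i - 1)^-1 *: (tmon (a i && b i)%:R (expZ i.+1) - tmon (st i)%:R (expZ i)).
Proof.
move=> lt_i; rewrite /phiX /phiY -scalerAl mulrBl !tmonM /= !qbetaYX //.
rewrite !ltnn !mulr1 /expY !subrK.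
congr (_ *: (tmon _ _ - tmon _ _)).
  by case: (a i) (b i) => [] []; rewrite /= ?mulr0 ?mul0r ?mulr1.
move: (canon lt_i); case: (st i) => [->//|_]; rewrite ?mulr1 ?mul0r //.
Qed.

Lemma zed_phi m : (m <= n)%N -> zed q phiX phiY m = tmon (st m)%:R (expZ m).
Proof.
elim: m => [|m IHm] lt_m; first by rewrite /= -(tmon1 T).
rewrite zedS IHm ?(ltnW lt_m) // phiY_phiX // scalerA mulfV ?(wq_neq1 scal) //.
by rewrite scale1r addrCA subrr addr0.
Qed.

Lemma phi_rels : weyl_rels n q g phiX phiY.
Proof.
split.
- move=> i j lt_i lt_j; case: (ltngtP i j) => [ij|ji|->].
  + exact: phiYY_lt.
  + by rewrite [in RHS]phiYY_lt // scalerA (wgV scal) scale1r.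
  + by rewrite (wg_diag scal) scale1r.
- move=> i j ij lt_j; have lt_i := ltn_trans ij lt_j.
  apply: phiY_comm => m x /andP[jm mj]; have le_m : (m <= n)%N := leq_trans mj lt_j.
  apply: tmon_comm.
  rewrite qbetaXY // qbetaYX // ij (leq_trans _ jm) //.
  rewrite ltnNge (ltnW ij) /= -(wg_inv scal).
  by field; rewrite (wg_neq0 scal).
- move=> i j ji lt_i; have lt_j := ltn_trans ji lt_i.
  apply: phiY_comm => m x /andP[jm mj]; have le_m : (m <= n)%N := leq_trans mj lt_j.
  apply: tmon_comm.
  rewrite qbetaXY // qbetaYX // ji ltnNge (leq_trans mj) //.
  by rewrite ltnNge (ltnW ji) mul1r mulr1.
- move=> i j ij lt_j; have lt_i := ltn_trans ij lt_j.
  by apply: tmon_comm; rewrite !qbetaXX // ij ltnNge (ltnW ij) /= mulfV.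
- move=> i lt_i; rewrite zed_phi ?(ltnW lt_i) // phiX_phiY // phiY_phiX //.
  apply: tcoef_inj => x; rewrite tcoefD !tcoefZ !tcoefB !tcoef_mon -mulrnAr.
  set u := _ *+ _; set v := _ *+ _; field; exact: (wq_neq1 scal).
Qed.

Lemma lead_phiX i : a i -> lead expo_pos (phiX i) (expX i).
Proof. by rewrite /phiX => ->; apply: lead_mon; rewrite oner_neq0. Qed.

(** The leading exponent of the image of y_i: Z_(i+1) dominates Z_i whenever its term is present. *)
Definition expLY i := if b i then expY i.+1 i else expY i i.

Lemma expoD_subX e f x : e - x - (f - x) = e - f.
Proof. by rewrite opprB addrA subrK. Qed.

Lemma leadZ (c : k) (f : T) e : c != 0 -> lead expo_pos f e -> lead expo_pos (c *: f) e.
Proof.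
move=> c0 [d [f' [d0 -> bf]]]; exists (c * d), (c *: f'); split.
- exact: mulf_neq0.
- by rewrite scalerDr scale_tmon.
- by move=> x; rewrite mem_tsupp tcoefZ mulf_eq0 negb_or -mem_tsupp => /andP[_ /bf].
Qed.

Lemma lead_phiY i : (i < n)%N -> b i || st i -> lead expo_pos (phiY i) (expLY i).
Proof.
move=> lt_i bs; apply: leadZ; first by rewrite invr_eq0 (wq_neq1 scal).
rewrite /expLY; move: bs; case: (b i) => /= [_|si].
  exists 1, (- tmon (st i)%:R (expY i i)); rewrite oner_neq0; split=> //.
  rewrite -scaleN1r scale_tmon; apply: below_mon.
  rewrite expoD_subX /expo_pos /=; case: i {lt_i} => [|i].
    by rewrite subr0 lead_coefXn ltr01.
  by rewrite lead_coefDl ?size_polyN ?size_polyXn // lead_coefXn ltr01.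
rewrite si tmon0 sub0r -scaleN1r scale_tmon; apply: lead_mon.
by rewrite mulr1 oppr_eq0 oner_neq0.
Qed.

End TorusPoint.
End QuantumTorus.

(** * The kernel of the homomorphism attached to a pair of bits *)

Section Kernel.
Variables (k : fieldType) (n : nat) (q : nat -> k) (g : nat -> nat -> k).
Hypothesis scal : weyl_scalars n q g.
Variables (T : twisted_algebra (qbichar scal)) (a b : nat -> bool).
Local Notation st := (st a b).
Hypothesis canon : forall i, (i < n)%N -> st i -> a i.
Local Notation phiX := (phiX T a).
Local Notation phiY := (phiY T a b).
Local Notation allowed := (allowed n a b).

Fixpoint lead_expo (m : nat -> nat * nat) l : expo :=
  if l is l'.+1
  then lead_expo m l' + (expLY b l' *+ (m l').1 + expX l' *+ (m l').2) else 0.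

Lemma fstMn (e : expo) m : (e *+ m).1 = e.1 *+ m.
Proof. by elim: m => // m IHm; rewrite !mulrSr -IHm. Qed.

Lemma sndMn (e : expo) m : (e *+ m).2 = e.2 *+ m.
Proof. by elim: m => // m IHm; rewrite !mulrSr -IHm. Qed.

Lemma expLY1 i : (expLY b i).1 = - 'X^i.
Proof. by rewrite /expLY; case: (b i); rewrite /= sub0r. Qed.

Lemma expLY2 i : (expLY b i).2 = (expZ (b i + i)).2.
Proof. by rewrite /expLY; case: (b i); rewrite /= subr0. Qed.

Lemma expZ2_coef m i : (m <= i)%N -> (expZ m).2`_i = 0.
Proof.
case: m => [|m] lt_m; first by rewrite coef0.
by rewrite coefXn_ne // neq_ltn lt_m orbT.
Qed.

Lemma lead_expo_out m l i : (l <= i)%N ->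
  (lead_expo m l).1`_i = 0 /\ (lead_expo m l).2`_i = 0.
Proof.
elim: l => [|l IHl] li; first by rewrite !coef0.
have [IH1 IH2] := IHl (ltnW li); rewrite /= !fstMn !sndMn !coefD !coefMn.
have h : (expZ (b l + l)).2`_i = 0.
  by apply: expZ2_coef; case: (b l); rewrite // ltnW.
rewrite expLY1 expLY2 coefN coefXn_ne ?neq_ltn ?li ?orbT //.
by rewrite coef0 h IH1 IH2 oppr0 !mul0rn !addr0.
Qed.

(** Read from the top index down. The X-coordinate gives the difference of the exponents of x and y;
    the Z-coordinate gives that of y when the bit [b] is set, and otherwise [allowed] makes the
    difference sufficient. *)
Lemma lead_expo_inj m m' : allowed m -> allowed m' ->
  lead_expo m n = lead_expo m' n -> forall i, (i < n)%N -> m i = m' i.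
Proof.
move=> am am'; have: (n <= n)%N by []; elim: {1 3 4 5}n => // l IHl lt_l E.
have c1 : (m l).2%:Z - (m l).1%:Z = (m' l).2%:Z - (m' l).1%:Z.
  have := congr1 (fun e : expo => e.1`_l) E.
  rewrite /= !fstMn !coefD !coefMn expLY1 coefN coefXn_id.
  rewrite !(lead_expo_out _ (leqnn l)).1 !add0r.
  by rewrite !mulNrn !natz; lia.
have c2 : ((m l).1 * b l = (m' l).1 * b l)%N.
  have := congr1 (fun e : expo => e.2`_l) E.
  rewrite /= !sndMn !coefD !coefMn expLY2 coef0 !mul0rn !addr0.
  rewrite !(lead_expo_out _ (leqnn l)).2 !add0r; case: (b l) => /=.
    by rewrite coefXn_id !muln1 => /eqP; rewrite eqr_nat => /eqP.
  by rewrite !muln0.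
have ml : m l = m' l.
  have [_ h2 h3] := am l lt_l; have [_ h2' h3'] := am' l lt_l.
  case: (m l) (m' l) c1 c2 h2 h3 h2' h3' => [p r] [p' r'] /=.
  case: (b l) => /=; first by move=> ? ? _ _ _ _; congr (_, _); lia.
  case: (st l) => /= c1 _ h2 h3 h2' h3'.
    by case: (h3 isT isT) => e1; case: (h3' isT isT) => e2; congr (_, _); lia.
  case: p c1 h2 {h3} => [|p] c1 h2; last by have := h2 isT.
  case: p' c1 h2' {h3'} => [|p'] c1 h2'; last by have := h2' isT.
  by congr (_, _); lia.
move=> i; rewrite ltnS leq_eqVlt => /orP[/eqP->//|il].
apply: IHl => //; first exact: ltnW.
by move: E; rewrite /= /expLY ml => /addIr.
Qed.

Variables (A : algType k) (X Y : nat -> A).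
Hypothesis rel : weyl_rels n q g X Y.
Hypothesis genA : forall S : set A, is_subalgebra S ->
  (forall i, (i < n)%N -> S (X i) /\ S (Y i)) -> S = setT.
Variable phi : {lrmorphism A -> T}.
Hypothesis phi_X : forall i, (i < n)%N -> phi (X i) = phiX i.
Hypothesis phi_Y : forall i, (i < n)%N -> phi (Y i) = phiY i.

Lemma phi_zed m : (m <= n)%N -> phi (zed q X Y m) = tmon T (st m)%:R (expZ m).
Proof.
move=> le_m; rewrite -(zed_phi T canon le_m); elim: m le_m => [|m IHm] lt_m.
  exact: rmorph1.
by rewrite !zedS linearD linearZ /= rmorphM /= IHm ?phi_X ?phi_Y // ltnW.
Qed.

Lemma leadXn (f : T) e m : lead expo_pos f e -> lead expo_pos (f ^+ m) (e *+ m).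
Proof.
move=> lf; elim: m => [|m IHm]; first exact: lead1.
by rewrite exprS mulrS; apply: leadM; [exact: expo_posP|..].
Qed.

Lemma lead_phi_mono m l : (l <= n)%N -> allowed m ->
  lead expo_pos (phi (mono X Y m l)) (lead_expo m l).
Proof.
move=> + am; elim: l => [|l IHl] lt_l; first by rewrite rmorph1; apply: lead1.
rewrite /= rmorphM; apply: leadM; [exact: expo_posP|exact: IHl (ltnW lt_l)|].
have [h1 h2 _] := am l lt_l.
rewrite rmorphM !rmorphXn /= phi_X // phi_Y //; apply: leadM; first exact: expo_posP.
  case: (m l).1 h2 => [_|p /(_ isT) bs]; first exact: lead1.
  by apply: leadXn; apply: lead_phiY.
case: (m l).2 h1 => [_|r /(_ isT) al]; first exact: lead1.
by apply: leadXn; apply: lead_phiX.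
Qed.

Definition ker : set A := [set f | phi f = 0].

Lemma ker_ideal : is_ideal ker.
Proof.
rewrite /ker; split=> /= [|u v u0 v0|u v v0|u v u0].
- exact: rmorph0.
- by rewrite rmorphD /= u0 v0 addr0.
- by rewrite rmorphM /= v0 mulr0.
- by rewrite rmorphM /= u0 mul0r.
Qed.

Definition excluded : set A := [set f |
  (exists i, [/\ (i < n)%N, ~~ a i & f = X i]) \/
  (exists i, [/\ (i < n)%N, ~~ b i, ~~ st i & f = Y i]) \/
  (exists i, [/\ (i < n)%N, ~~ st i.+1 & f = zed q X Y i.+1])].

Lemma excludedP (I : set A) : contains_gens n q X Y a b I <-> excluded `<=` I.
Proof.
split=> [[IX IY IZ] f|gI].
  by case=> [|[]] [i [lt_i]] => [ai ->|bi si ->|si ->]; auto.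
split=> i lt_i *; apply: gI.
- by left; exists i.
- by right; left; exists i.
- by right; right; exists i.
Qed.

Lemma ker_gens : contains_gens n q X Y a b ker.
Proof.
split=> i lt_i; rewrite /ker /=.
- by move=> /negPf ai; rewrite phi_X // /phiX ai tmon0.
- move=> /negPf bi /negPf si.
  by rewrite phi_Y // /phiY bi si !tmon0 subrr scaler0.
- move=> /negPf si; have := phi_zed lt_i.
  by rewrite [st i.+1]si tmon0.
Qed.

Lemma ker_sub (P : set A) : is_ideal P -> contains_gens n q X Y a b P -> ker `<=` P.
Proof.
move=> idP gP f kf.
have idI := ideal_gen_ideal excluded.
have gI : contains_gens n q X Y a b (ideal_gen excluded).
  by apply/excludedP; apply: sub_smallest.
have IP J : is_ideal J -> contains_gens n q X Y a b J -> ideal_gen excluded `<=` J.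
  by move=> idJ gJ; apply: smallest_sub => //; apply/excludedP.
have [s Is] := spannedT scal rel canon idI gI genA f.
apply: (IP P) => //; move: Is; set F := \sum_(p <- s) _ => Is.
suff F0 : F = 0 by rewrite F0 subr0 in Is.
apply: (triangular_kernel expo_posP (phi := phi)
  (E := fun m : {m | allowed m} => lead_expo (sval m) n)
  (F := fun m => mono X Y (sval m) n)).
(* The exponents agree below [n] only, which is all that [mono] depends on. *)
- by move=> [m am] [m' am'] /= E; apply: mono_eq; apply: lead_expo_inj.
- by move=> [m am]; apply: lead_phi_mono.
have := IP _ ker_ideal ker_gens _ Is; rewrite /ker /= rmorphB /= kf sub0r.
by move/eqP; rewrite oppr_eq0 => /eqP.
Qed.

Lemma ker_prime : is_prime_ideal ker.
Proof.
split; first exact: ker_ideal.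
  apply/eqP => kT; have : ker 1 by rewrite kT.
  by rewrite /ker /= rmorph1 => /eqP; rewrite oner_eq0.
move=> I J idI idJ IJ; have [|nI] := pselect (I `<=` ker); [by left|right=> v Jv].
have [u Iu ku] : exists2 u, I u & ~ ker u.
  by apply: contra_notP nI => nex u Iu; apply: contra_notP nex; exists u.
have : ker (u * v) by apply: IJ.
by rewrite /ker /= rmorphM => /(twisted_mulf_eq0 expo_posP)[/ku|].
Qed.

End Kernel.

(** * Separation of exponents by weights *)

Section Characters.
Variables (k : fieldType) (n : nat) (q : nat -> k) (g : nat -> nat -> k).
Hypothesis scal : weyl_scalars n q g.
Variables (a b : nat -> bool).
Local Notation st := (st a b).
Hypothesis canon : forall i, (i < n)%N -> st i -> a i.
Local Notation qbeta := (qbeta n q g).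
Implicit Types (d e : expo).

Lemma nroot_exprz (x : k) (z : int) : not_root_of_unity x -> x ^ z = 1 -> z = 0.
Proof.
move=> nx; case: z => [[//|m]|m] E.
  by have /eqP := nx m.+1 isT.
by have := nx m.+1 isT; rewrite -(inj_eq invr_inj) invr1 -E eqxx.
Qed.

(** The constraints on exponents occurring in the image of Y_n: if x_i is excluded, X_i enters only
    through X_i^-1 Z_(i+1); if [b i] fails, Z_(i+1) does not occur at all. *)
Definition in_lattice e := (forall i, (n <= i)%N -> e.1`_i = 0 /\ e.2`_i = 0) /\
  (forall i, (i < n)%N ->
    (~~ a i -> e.1`_i + e.2`_i = 0) /\ (~~ b i -> e.2`_i = 0)).

Lemma in_lattice0 : in_lattice 0.
Proof. by split=> i _; rewrite !coef0 ?addr0. Qed.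

Lemma in_latticeD d e : in_lattice d -> in_lattice e -> in_lattice (d + e).
Proof.
move=> [d0 dl] [e0 el]; split=> i ni; rewrite /= !coefD.
  by have [-> ->] := d0 i ni; have [-> ->] := e0 i ni; rewrite addr0.
have [h1 h2] := dl i ni; have [h3 h4] := el i ni.
by split=> [ai|bi]; [rewrite addrACA h1 ?h3 ?addr0|rewrite h2 ?h4 ?addr0].
Qed.

Lemma in_latticeN e : in_lattice e -> in_lattice (- e).
Proof.
move=> [e0 el]; split=> i ni; rewrite /= !coefN.
  by have [-> ->] := e0 i ni; rewrite oppr0.
have [h3 h4] := el i ni.
by split=> [ai|bi]; [rewrite -opprD h3 ?oppr0|rewrite h4 ?oppr0].
Qed.

Lemma in_lattice_single e i (z w : int) : (i < n)%N ->
  e.1 = z *: 'X^i -> e.2 = w *: 'X^i -> (~~ a i -> z + w = 0) -> (~~ b i -> w = 0) ->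
  in_lattice e.
Proof.
move=> lt_i e1 e2 ha hb; split=> j nj; rewrite e1 e2 !coefZ.
  by rewrite coefXn_ne ?mulr0 // neq_ltn (leq_trans lt_i) ?orbT.
have [->|ne] := eqVneq j i; first by rewrite coefXn_id !mulr1.
by rewrite coefXn_ne ?mulr0 ?addr0.
Qed.

Lemma in_latticeX i : (i < n)%N -> a i -> in_lattice (expX i).
Proof.
move=> lt_i ai; apply: (@in_lattice_single _ i 1 0) => //.
- by rewrite scale1r.
- by rewrite scale0r.
- by rewrite ai.
Qed.

Lemma in_latticeZ m : (m <= n)%N -> st m -> in_lattice (expZ m).
Proof.
case: m => [|m] lt_m sm; first exact: in_lattice0.
have /andP[am bm] : a m && b m := sm.
apply: (@in_lattice_single _ m 0 1) => //.
- by rewrite scale0r.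
- by rewrite scale1r.
- by rewrite am.
- by rewrite bm.
Qed.

Lemma in_latticeYS i : (i < n)%N -> b i -> in_lattice (expY i.+1 i).
Proof.
move=> lt_i bi; apply: (@in_lattice_single _ i (-1) 1) => //.
- by rewrite /= sub0r scaleN1r.
- by rewrite /= subr0 scale1r.
- by rewrite bi.
Qed.

Lemma in_latticeY i : (i < n)%N -> st i -> in_lattice (expY i i).
Proof.
move=> lt_i si; apply: in_latticeD; first by apply: in_latticeZ => //; apply: ltnW.
by apply/in_latticeN/in_latticeX => //; apply: canon.
Qed.

Lemma qbeta_X0 d i : (forall l, (i < l)%N -> d.1`_l = 0) -> qbeta d (expX i) = 1.
Proof.
move=> d0; rewrite /qbeta big1 => [|l _]; last by rewrite zsumX mulr0 expr0z.
rewrite mul1r big1 // => l _; apply: big1 => j _ /=.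
have [ji|ne] := eqVneq (j : nat) i; last by rewrite coefXn_ne // mulr0 oppr0 expr0z.
by rewrite d0 ?mul0r ?oppr0 ?expr0z // -ji.
Qed.

Lemma qbeta_Z d m : (m <= n)%N -> qbeta d (expZ m) = \prod_(i < m) q i ^ d.1`_i.
Proof.
move=> le_m; rewrite /qbeta [X in _ * X]big1 => [|l _]; last first.
  by apply: big1 => j _ /=; rewrite coef0 mulr0 oppr0 expr0z.
rewrite mulr1 (big_ord_widen n (fun i => q i ^ d.1`_i) le_m) [RHS]big_mkcond /=.
apply: eq_bigr => i _; rewrite zsumZ //; case: ltnP => _.
  by rewrite mulr1.
by rewrite mulr0 expr0z.
Qed.

Variables (H : Type) (chi : H -> nat -> k).
(* The weight of the monomial of exponent e: the elements z_m have weight 1. *)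
Definition omega h e : k := \prod_(i < n) chi h i ^ e.1`_i.

(** [chi h i] is the weight of x_i. The field [chi_hx] reflects the step adjoining x_i, [chi_hy] the
    one adjoining y_i, where x_i itself is already a coefficient and is scaled by q_i^-1. *)
Record weights_of_CGL : Prop := {
  chi_neq0 : forall h i, chi h i != 0;
  chi_hx : forall i, (i < n)%N -> exists2 h,
    forall l, (l < i)%N -> chi h l = (q l * g l i)^-1
    & not_root_of_unity (chi h i);
  chi_hy : forall i, (i < n)%N -> exists2 h,
    forall l, (l < i)%N -> chi h l = g l i & chi h i = (q i)^-1 }.

Hypothesis CGL : weights_of_CGL.

Lemma omegaD h d e : omega h (d + e) = omega h d * omega h e.
Proof.
rewrite /omega -big_split; apply: eq_bigr => i _ /=.
by rewrite coefD expfzDr // (chi_neq0 CGL).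
Qed.

Lemma omega_top h d i : (i < n)%N -> (forall l, (i < l)%N -> d.1`_l = 0) ->
  omega h d = (\prod_(j < i) chi h j ^ d.1`_j) * chi h i ^ d.1`_i.
Proof.
move=> lt_i d0.
have := big_ord_recr i (fun j : 'I_i.+1 => chi h j ^ d.1`_j) => /= <-.
rewrite (big_ord_widen n (fun j => chi h j ^ d.1`_j) lt_i) [RHS]big_mkcond /=.
apply: eq_bigr => j _; case: ltnP => // /d0 ->; exact: expr0z.
Qed.

(** The tests that the difference of two exponents of an element of minimal support passes:
    commutation with the monomial images of x_i, y_i and z_m, and triviality of the weight. *)
Record trivial_characters d : Prop := {
  trivX : forall i, (i < n)%N -> a i -> qbeta (expX i) d = qbeta d (expX i);
  trivY : forall i, (i < n)%N -> b i -> ~~ st i ->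
    qbeta (expY i.+1 i) d = qbeta d (expY i.+1 i);
  trivZ : forall m, (m <= n)%N -> st m -> qbeta (expZ m) d = qbeta d (expZ m);
  trivH : forall h, omega h d = 1 }.

(* Descending induction on i: once the coordinates of d above i vanish, the four kinds
   of equations at level i express powers of non-roots of unity in terms of the
   products p, p', p'' over j < i, which p * (p' * p'') = 1 allows to eliminate. *)
Lemma trivial_charactersP d : in_lattice d -> trivial_characters d -> d = 0.
Proof.
move=> [dn dl] [tX tY tZ tH].
suff d0 i : d.1`_i = 0 /\ d.2`_i = 0.
  rewrite [d]surjective_pairing; congr (_, _); apply/polyP => i; rewrite coef0.
    by case: (d0 i).
  by case: (d0 i).
have [m] := ubnP (n - i); elim: m i => // m IHm i lt_m.
have [ni|lt_i] := leqP n i; first exact: dn.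
have {IHm} IH l : (i < l)%N -> d.1`_l = 0 /\ d.2`_l = 0.
  by move=> il; apply: IHm; lia.
have zs : zsum n d i = d.2`_i.
  rewrite /zsum big_ltn // big_nat big1 ?addr0 // => l /andP[il _].
  by case: (IH l il).
have IH1 l il := (IH l il).1.
set x := d.1`_i; set y := d.2`_i in zs |- *.
pose p := \prod_(j < i) (q j * g j i) ^ (- d.1`_j).
pose p' := \prod_(j < i) g j i ^ d.1`_j.
pose p'' := \prod_(j < i) q j ^ d.1`_j.
have q0 := wq_neq0 scal; have qn := nroot_exprz (wq_nroot scal lt_i).
have ppp : p * (p' * p'') = 1.
  rewrite -!big_split /= big1 // => j _.
  rewrite -exprzMl ?unitfE ?q0 ?(wg_neq0 scal) // mulrC [g j i * _]mulrC.
  by rewrite -expfzDr ?(wqg_neq0 scal) // subrr expr0z.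
have fX : a i -> q i ^ y * p = 1.
  by move=> ai; have := tX i lt_i ai; rewrite qbetaX // zs qbeta_X0.
have [h1 h1l h1n] := chi_hx CGL lt_i.
have fhx : p * chi h1 i ^ x = 1.
  rewrite -(tH h1) (omega_top h1 lt_i IH1); congr (_ * _).
  by apply: eq_bigr => j _; rewrite h1l // exprz_inv.
have [h2 h2l h2q] := chi_hy CGL lt_i.
have fhy : p' * (q i ^ x)^-1 = 1.
  rewrite -(tH h2) (omega_top h2 lt_i IH1); congr (_ * _).
    by apply: eq_bigr => j _; rewrite h2l.
  by rewrite h2q exprz_inv invr_expz.
have fY : b i -> ~~ st i -> (q i ^ y * p)^-1 = p'' * q i ^ x.
  move=> bi si; have := tY i lt_i bi si.
  rewrite (qbetaDl scal) qbetaZ (qbetaNl scal) qbetaX // zs mul1r => ->.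
  by rewrite (qbetaDr scal) (qbetaNr scal) qbeta_X0 // invr1 mulr1 qbeta_Z // big_ord_recr.
have fZ : st i -> p'' = 1.
  by move=> si; have := tZ i (ltnW lt_i) si; rewrite qbetaZ qbeta_Z // ltnW.
have fZS : st i.+1 -> p'' * q i ^ x = 1.
  by move=> si; have := tZ i.+1 lt_i si; rewrite qbetaZ qbeta_Z // big_ord_recr.
have p1_x : p = 1 -> x = 0.
  by move=> p1; apply: (nroot_exprz h1n); rewrite -fhx p1 mul1r.
have [hA hB] := dl i lt_i; rewrite -/x -/y in hA hB.
have qx0 : q i ^ x != 0 by apply: expfz_neq0.
have E2 : p' = q i ^ x by apply: (divIf qx0); rewrite fhy divff.
have [si|si] := boolP (st i).
  have ai := canon lt_i si; have p2 := fZ si; have FX := fX ai.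
  have [bi|bi] := boolP (b i); last first.
    have y0 := hB bi; split=> //; apply: p1_x.
    by move: FX; rewrite y0 expr0z mul1r.
  (* Both z_i and z_(i+1) are present: their equations differ exactly by q_i^x. *)
  have x0 : x = 0.
    by apply: qn; rewrite -[LHS]mul1r -p2 fZS //= ai bi.
  have p1 : p = 1 by move: fhx; rewrite x0 expr0z mulr1.
  by split=> //; apply: qn; rewrite -FX p1 mulr1.
have [ai|ai] := boolP (a i); have [bi|bi] := boolP (b i).
(* The equation for y_i becomes p'' q_i^x = 1, that is p'' p' = 1, whence p = 1. *)
- have FX := fX ai; have FY := fY bi si; rewrite FX invr1 in FY.
  have p1 : p = 1 by move: ppp; rewrite E2 [_ * p'']mulrC -FY mulr1.
  by split; [apply: p1_x|apply: qn; rewrite -FX p1 mulr1].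
- have y0 := hB bi; split=> //; apply: p1_x.
  by move: (fX ai); rewrite y0 expr0z mul1r.
- have xy := hA ai; have yx : y = - x by apply/eqP; rewrite -addr_eq0 addrC xy.
  have FY := fY bi si.
  (* As x + y = 0, the equation for y_i reduces to p p'' = 1, which leaves p' = q_i^x = 1. *)
  have x0 : x = 0.
    apply: qn; rewrite -E2.
    have pp : p * p'' = 1.
      have nz : q i ^ y * p != 0.
        rewrite mulf_neq0 ?expfz_neq0 //; apply/prodf_neq0 => j _.
        by rewrite expfz_neq0 // (wqg_neq0 scal).
      have qxy : q i ^ y * q i ^ x = 1 by rewrite -expfzDr // addrC xy.
      by rewrite -(divff nz) FY -[LHS]mul1r -qxy; move: (q i ^ y) (q i ^ x) => u v; ring.
    by rewrite -ppp mulrCA pp mulr1.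
  by rewrite yx x0 oppr0.
- have y0 := hB bi; split=> //.
  by move: (hA ai); rewrite y0 addr0.
Qed.

End Characters.

(** * Classification of the stable primes *)

Section Classification.
Variables (k : fieldType) (n : nat) (q : nat -> k) (g : nat -> nat -> k).
Hypothesis scal : weyl_scalars n q g.
Variables (T : twisted_algebra (qbichar scal)) (a b : nat -> bool).
Local Notation st := (st a b).
Hypothesis canon : forall i, (i < n)%N -> st i -> a i.
Local Notation phiX := (phiX T a).
Local Notation phiY := (phiY T a b).
Local Notation qbeta := (qbeta n q g).
Local Notation tmon := (@tmon _ _ _ T).
Local Notation in_lattice := (in_lattice n a b).
Implicit Types (d e : expo).

Variables (A : algType k) (X Y : nat -> A).
Hypothesis rel : weyl_rels n q g X Y.
Hypothesis genA : forall S : set A, is_subalgebra S ->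
  (forall i, (i < n)%N -> S (X i) /\ S (Y i)) -> S = setT.
Local Notation zed := (zed q X Y).
Variable phi : {lrmorphism A -> T}.
Hypothesis phi_X : forall i, (i < n)%N -> phi (X i) = phiX i.
Hypothesis phi_Y : forall i, (i < n)%N -> phi (Y i) = phiY i.

Variables (H : Type) (chi : H -> nat -> k) (act : H -> {lrmorphism A -> A}).
Hypothesis CGL : weights_of_CGL n q g chi.
Hypothesis actX : forall h i, (i < n)%N -> act h (X i) = chi h i *: X i.
Hypothesis actY : forall h i, (i < n)%N -> act h (Y i) = (chi h i)^-1 *: Y i.
Local Notation omega := (omega n chi).

Lemma phi_XE i : (i < n)%N -> a i -> phi (X i) = tmon 1 (expX i).
Proof. by move=> lt_i ai; rewrite phi_X // /phiX ai. Qed.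

Lemma phi_YE i : (i < n)%N -> ~~ st i -> b i ->
  phi (Y i) = tmon (q i - 1)^-1 (expY i.+1 i).
Proof.
move=> lt_i /negPf si bi; rewrite phi_Y // /phiY bi si tmon0 subr0.
by rewrite scale_tmon mulr1.
Qed.

Lemma phi_ZE m : (m <= n)%N -> st m -> phi (zed m) = tmon 1 (expZ m).
Proof. by move=> le_m sm; rewrite (phi_zed canon phi_X phi_Y) // sm. Qed.

Lemma lattice_supp f e : e \in tsupp (phi f) -> in_lattice e.
Proof.
pose S : set A := [set f | forall e, e \in tsupp (phi f) -> in_lattice e].
suff ST : S = setT.
  have Sf : S f by rewrite ST.
  exact: Sf.
apply: genA => [|i lt_i]; first split.
- move=> {}e; rewrite rmorph1 -(tmon1 T) => /tsupp_mon ->; exact: in_lattice0.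
- move=> c u v Su Sv {}e; rewrite linearD linearZ /= => /tsuppD[|]; last exact: Sv.
  by rewrite mem_tsupp tcoefZ mulf_eq0 negb_or -mem_tsupp => /andP[_ /Su].
- move=> u v Su Sv {}e; rewrite rmorphM => /tsuppM[x [y [xu yv ->]]].
  by apply: in_latticeD; [apply: Su|apply: Sv].
split=> {}e.
  rewrite phi_X // /phiX; have [ai /tsupp_mon ->|ai] := boolP (a i).
    exact: in_latticeX.
  by rewrite tmon0 mem_tsupp tcoef0 eqxx.
rewrite phi_Y // /phiY mem_tsupp tcoefZ mulf_eq0 negb_or tcoefB !tcoef_mon.
case/andP=> _ nz; have [bi|bi] := boolP (b i); have [si|si] := boolP (st i).
- have [<-|ne1] := eqVneq (expY i.+1 i) e; first exact: in_latticeYS.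
  have [<-|ne2] := eqVneq (expY i i) e; first exact: in_latticeY.
  by rewrite (negPf ne1) (negPf ne2) bi si /= !mulr0n subr0 eqxx in nz.
- have [<-|ne1] := eqVneq (expY i.+1 i) e; first exact: in_latticeYS.
  by rewrite (negPf ne1) (negPf si) /= mulr0n mul0rn subr0 eqxx in nz.
- have [<-|ne2] := eqVneq (expY i i) e; first exact: in_latticeY.
  by rewrite (negPf ne2) (negPf bi) /= mulr0n mul0rn subr0 eqxx in nz.
- by rewrite (negPf si) (negPf bi) /= !mul0rn subr0 eqxx in nz.
Qed.

Lemma omega1 h e (c : int) i : (i < n)%N -> e.1 = c *: 'X^i -> omega h e = chi h i ^ c.
Proof.
move=> lt_i e1; rewrite /omega (bigD1 (Ordinal lt_i)) //= e1 coefZ coefXn_id mulr1.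
rewrite big1 ?mulr1 // => j ne.
by rewrite coefZ (coefXn_ne (ne : val j != i)) mulr0 expr0z.
Qed.

(** Both sides are algebra homomorphisms in f, so generators suffice. The two terms of the image of
    y_i have equal weight because the Z_m have weight 1. *)
Lemma phi_act h f : phi (act h f) = tdiag (omega h) (phi f).
Proof.
pose S : set A := [set f | phi (act h f) = tdiag (omega h) (phi f)].
suff ST : S = setT by rewrite -[_ = _]/(S f) ST.
apply: genA => [|i lt_i]; first split; rewrite /S /=.
- rewrite !rmorph1 -(tmon1 T) tdiagU mulr1; congr (tmon _ _).
  by rewrite /omega big1 // => i _; rewrite coef0 expr0z.
- by move=> c u v Su Sv; rewrite [X in tdiag _ X]linearP tdiagZD -Su -Sv !linearP.
- move=> u v Su Sv; rewrite !rmorphM /= Su Sv tdiagM //.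
  exact: (omegaD CGL).
rewrite actX // actY // !linearZ /= phi_X // phi_Y // /phiX /phiY.
split.
  rewrite tdiagU scale_tmon (omega1 (c := 1) h lt_i) ?scale1r //.
have w m : omega h (expY m i) = (chi h i)^-1.
  by rewrite (omega1 (c := -1) h lt_i) //= sub0r scaleN1r.
apply: tcoef_inj => x; rewrite tcoef_diag !tcoefZ !tcoefB !tcoef_mon.
have [<-|_] := eqVneq (expY i.+1 i) x; first by rewrite w; ring.
have [<-|_] := eqVneq (expY i i) x; first by rewrite w; ring.
by rewrite !mulr0n subr0 !mulr0.
Qed.

Lemma ker_stable h f : ker phi f -> ker phi (act h f).
Proof.
rewrite /ker /= phi_act => ->; apply: tcoef_inj => x.
by rewrite tcoef_diag tcoef0 mulr0.
Qed.

Variable P : set A.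
Hypothesis primeP : is_prime_ideal P.
Hypothesis stableP : forall h f, P f -> P (act h f).
Let idP := prime_ideal primeP.

(** * Elements of P whose image has minimal support *)

Section MinimalSupport.
Variable f : A.
Hypothesis Pf : P f.
Hypothesis f_min : forall f', P f' -> phi f' <> 0 ->
  (size (tsupp (phi f)) <= size (tsupp (phi f')))%N.

(* The support of phi f', translated by - s, is contained in that of phi f and misses
   e, so that phi f' = 0 by minimality. *)
Lemma minimal_shift f' s (lam : expo -> k) e e' : P f' ->
  (forall x, tcoef (phi f') (s + x) = lam x * tcoef (phi f) x) ->
  e \in tsupp (phi f) -> lam e = 0 -> e' \in tsupp (phi f) -> lam e' = 0.
Proof.
move=> Pf' E es le0 es'.
have f'0 : phi f' = 0.
  apply: contrapT => /(f_min Pf'); apply/negP; rewrite -ltnNge.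
  have sub : {subset tsupp (phi f') <= map (+%R s) (rem e (tsupp (phi f)))}.
    move=> x; rewrite mem_tsupp -{1}(subrKC s x) E mulf_eq0 negb_or => /andP[lx fx].
    apply/mapP; exists (x - s); last by rewrite subrKC.
    rewrite mem_rem_uniq ?tsupp_uniq // inE mem_tsupp fx andbT.
    by apply: contraNneq lx => ->; rewrite le0.
  apply: leq_ltn_trans (uniq_leq_size (tsupp_uniq _) sub) _.
  rewrite size_map size_rem //; case: (tsupp (phi f)) es => //= ? ? _.
have := E e'; rewrite f'0 tcoef0 => /esym/eqP; rewrite mulf_eq0.
by move: es'; rewrite mem_tsupp => /negPf ->; rewrite orbF => /eqP.
Qed.

(** The element u f - kap f u of P has the support of f translated by [s]; [kap] is chosen to cancel
    the term coming from [e], so by minimality the one coming from [e'] vanishes too. *)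
Lemma minimal_comm u c s e e' : c != 0 -> phi u = tmon c s ->
  e \in tsupp (phi f) -> e' \in tsupp (phi f) ->
  qbeta s (e' - e) = qbeta (e' - e) s.
Proof.
move=> c0 us es es'; have nz x y : qbeta x y != 0 := qbeta_neq0 scal x y.
pose kap := qbeta s e / qbeta e s.
have := @minimal_shift (u * f - kap *: (f * u)) s
  (fun x => c * (qbeta s x - kap * qbeta x s)) e e' _ _ es _ es'.
rewrite /kap => /(_ _ _ _)/eqP; rewrite mulf_eq0 (negPf c0) /= subr_eq0 => h.
rewrite (qbetaDr scal) (qbetaDl scal) (qbetaNr scal) (qbetaNl scal).
apply: (mulIf (nz s e)); rewrite divfK // (eqP (h _ _ _)).
- by field; rewrite nz.
- apply: idealB => //; first exact: idealMl.
  by apply: idealZ => //; apply: Defs.idealMr.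
- move=> x; rewrite linearB linearZ /= !rmorphM /= us tcoefB tcoefZ.
  by rewrite tcoef_monM tcoef_Mmon /=; ring.
- by rewrite divfK ?subrr ?mulr0.
Qed.

(** As for commutation, with [act h f] minus the multiple of f that cancels the term at [e]; the
    support is not translated. *)
Lemma minimal_omega h e e' :
  e \in tsupp (phi f) -> e' \in tsupp (phi f) -> omega h (e' - e) = 1.
Proof.
move=> es es'.
have nz x : omega h x != 0.
  by apply/prodf_neq0 => i _; rewrite expfz_neq0 // (chi_neq0 CGL).
have w : omega h e' = omega h e.
  apply/eqP; rewrite -subr_eq0; apply/eqP.
  apply: (@minimal_shift (act h f - omega h e *: f) 0
    (fun x => omega h x - omega h e) e e' _ _ es _ es') => [|x|].
  - apply: idealB => //; first exact: stableP.
    exact: idealZ.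
  - by rewrite add0r linearB linearZ /= phi_act tcoefB tcoefZ tcoef_diag mulrBl.
  - by rewrite subrr.
by apply: (mulfI (nz e)); rewrite -(omegaD CGL) subrKC mulr1.
Qed.

Lemma minimal_monomial : phi f <> 0 ->
  exists c e, [/\ c != 0, in_lattice e & phi f = tmon c e].
Proof.
move=> /eqP; rewrite -tsupp0P.
case E : (tsupp (phi f)) => [//|e s] _.
have es : e \in tsupp (phi f) by rewrite E mem_head.
have eq_e e' : e' \in tsupp (phi f) -> e' = e.
  move=> es'; apply/eqP; rewrite -subr_eq0; apply/eqP.
  apply: (trivial_charactersP scal canon CGL).
    by apply: in_latticeD; [|apply: in_latticeN]; apply: lattice_supp; eassumption.
  split=> [i lt_i ai|i lt_i bi si|m le_m sm|h].
  - exact: minimal_comm (oner_neq0 k) (phi_XE lt_i ai) es es'.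
  - apply: minimal_comm (phi_YE lt_i si bi) es es'.
    by rewrite invr_eq0 (wq_neq1 scal).
  - exact: minimal_comm (oner_neq0 k) (phi_ZE le_m sm) es es'.
  - exact: minimal_omega.
exists (tcoef (phi f) e), e; split; [by rewrite -mem_tsupp|exact: lattice_supp es|].
rewrite {1}(twisted_sum (phi f)) E; case: s E => [|e' s] E; first by rewrite big_seq1.
have := tsupp_uniq (phi f); rewrite E /= inE negb_or => /andP[/andP[/eqP ne _] _].
by case: ne; apply/esym/eq_e; rewrite E !inE eqxx orbT.
Qed.
End MinimalSupport.

Definition mon_in e := exists f c, [/\ P f, c != 0, phi f = tmon c e & in_lattice e].

Lemma mon_in_exists f : P f -> phi f <> 0 -> exists e, mon_in e.
Proof.
move=> Pf0 f0.
have ex : exists m, `[< exists f', [/\ P f', phi f' <> 0 & size (tsupp (phi f')) = m] >].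
  by exists (size (tsupp (phi f))); apply/asboolP; exists f.
have [m /asboolP[f' [Pf' f'0 sz]] min] := ex_minnP ex.
have [|c [e [c0 le E]]] := minimal_monomial Pf' _ f'0; last by exists e, f', c.
by move=> f'' Pf'' f''0; rewrite sz; apply: min; apply/asboolP; exists f''.
Qed.

Lemma mon_inM e u c s : mon_in e -> c != 0 -> phi u = tmon c s -> in_lattice s ->
  mon_in (e + s).
Proof.
move=> [f [d [Pf d0 fe le]]] c0 us ls; exists (f * u), (d * c * qbeta e s); split.
- exact: Defs.idealMr.
- by apply: mulf_neq0 (mulf_neq0 d0 c0) (qbeta_neq0 scal _ _).
- by rewrite rmorphM /= fe us tmonM.
- exact: in_latticeD.
Qed.

Lemma mon_inX e i : (i < n)%N -> a i -> mon_in e -> mon_in (e + expX i).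
Proof.
move=> lt_i ai me; apply: mon_inM me (oner_neq0 k) (phi_XE lt_i ai) _.
exact: in_latticeX.
Qed.

Lemma mon_inZ e m : (m <= n)%N -> st m -> mon_in e -> mon_in (e + expZ m).
Proof.
move=> le_m sm me; apply: mon_inM me (oner_neq0 k) (phi_ZE le_m sm) _.
exact: in_latticeZ.
Qed.

Lemma mon_inYS e i : (i < n)%N -> ~~ st i -> b i -> mon_in e -> mon_in (e + expY i.+1 i).
Proof.
move=> lt_i si bi me; apply: mon_inM me _ (phi_YE lt_i si bi) _.
  by rewrite invr_eq0 (wq_neq1 scal).
exact: in_latticeYS.
Qed.

(* If b i holds then phi (Y i) is a binomial; a q-commutator of f with Y i cancels its
   term in Z_(i+1), and the other one survives when X_i occurs in e. *)
Lemma mon_inY e i : (i < n)%N -> st i -> e.1`_i != 0 -> mon_in e ->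
  mon_in (e + expY i i).
Proof.
move=> lt_i si ei me.
have q1 := wq_neq1 scal lt_i.
have nz x y : qbeta x y != 0 := qbeta_neq0 scal x y.
have [bi|/negPf bi] := boolP (b i); last first.
  apply: (@mon_inM _ (Y i) (- (q i - 1)^-1)) => //; last exact: in_latticeY.
    by rewrite oppr_eq0 invr_eq0.
  rewrite phi_Y // /phiY bi si tmon0 sub0r scalerN -scaleN1r !scale_tmon.
  by congr (tmon _ _); rewrite mulr1 mulN1r.
have [f [c [Pf c0 fe le]]] := me.
set s := expY i.+1 i; set s' := expY i i.
have ss : s = s' + (expZ i.+1 - expZ i) by rewrite [RHS]addrC addrA subrK.
(* The two exponents of y_i differ by Z_(i+1) - Z_i, which pairs with [e] to 1 on the left and to
   q_i^(e_i) on the right. The surviving coefficient is thus a nonzero multiple of q_i^(e_i) - 1. *)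
have se : qbeta s e = qbeta s' e.
  by rewrite ss !(qbetaDl scal) !(qbetaNl scal) !qbetaZ invr1 !mulr1.
have es : qbeta e s = qbeta e s' * q i ^ e.1`_i.
  rewrite ss (qbetaDr scal); congr (_ * _).
  rewrite (qbetaDr scal) (qbetaNr scal) !qbeta_Z ?(ltnW lt_i) //.
  rewrite big_ord_recr /= mulrAC divff ?mul1r //.
  by apply/prodf_neq0 => j _; rewrite expfz_neq0 // (wq_neq0 scal).
pose rho := qbeta e s / qbeta s e.
exists (f * Y i - rho *: (Y i * f)),
  ((q i - 1)^-1 * c * (rho * qbeta s' e - qbeta e s')); split.
- apply: idealB => //; first exact: Defs.idealMr.
  by apply: idealZ => //; apply: idealMl.
- apply: mulf_neq0; first by apply: mulf_neq0; rewrite ?invr_eq0.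
  rewrite /rho -se divfK // es -[X in _ - X]mulr1 -mulrBr mulf_neq0 // subr_eq0.
  by apply: contra ei => /eqP/(nroot_exprz (wq_nroot scal lt_i)) ->.
- rewrite linearB linearZ /= !rmorphM /= fe phi_Y // /phiY bi si.
  rewrite -scalerAr -scalerAl mulrBr mulrBl !tmonM.
  rewrite ![_ + e]addrC -/s -/s' !scalerBr !scale_tmon.
  rewrite (_ : rho * _ = (q i - 1)^-1 * (c * 1 * qbichar scal e s)); last first.
    by rewrite /rho /=; field; rewrite q1 nz.
  rewrite opprB addrACA addrC addrA subrK -scaleN1r scale_tmon -tmonD.
  by congr (tmon _ _); rewrite /rho /=; field; rewrite q1 nz.
- by apply: in_latticeD => //; apply: in_latticeY.
Qed.

Hypothesis PX : forall i, (i < n)%N -> a i <-> ~ P (X i).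
Hypothesis PY : forall i, (i < n)%N -> ~~ st i -> b i <-> ~ P (Y i).
Hypothesis PZ : forall m, (m <= n)%N -> st m <-> ~ P (zed m).

(** * Exponents of products of elements normal modulo P *)

Lemma absz_pred_lt (z : int) m : 0 < z -> (absz z < m.+1)%N -> (absz (z - 1)%R < m)%N.
Proof. lia. Qed.

Lemma absz_succ_lt (z : int) m : z < 0 -> (absz z < m.+1)%N -> (absz (z + 1)%R < m)%N.
Proof. lia. Qed.

(* The exponents at i of the products of those elements x_i, y_i, z_(i+1) that are
   normal modulo P and not in P. *)
Definition good e i : Prop :=
  if st i then e.1`_i = 0 /\ 0 <= e.2`_i else 0 <= e.2`_i /\ 0 <= e.1`_i + e.2`_i.

Definition good_below l e := mon_in e /\ forall i, (i < l)%N -> good e i.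

Lemma mon_in_lattice e : mon_in e -> in_lattice e.
Proof. by move=> [f [c []]]. Qed.

(** The corrections made at index [l] may raise Z-exponents below [l], as X_l^-1 Z_l does, but leave
    the X-exponents there alone; both cases of [good] tolerate this. *)
Lemma good_belowD l e d : (forall i, (i < l)%N -> d.1`_i = 0 /\ 0 <= d.2`_i) ->
  (mon_in e -> mon_in (e + d)) -> good_below l e -> good_below l (e + d).
Proof.
move=> dl ed [me ge]; split=> [|i il]; first exact: ed.
have [d1 d2] := dl i il; have := ge i il; rewrite /good /= !coefD d1 addr0.
case: (st i) => [[-> e2]|[e2 e12]]; split=> //; first exact: addr_ge0.
  exact: addr_ge0.
by rewrite addrA addr_ge0.
Qed.

Lemma expX_below l i : (i < l)%N -> (expX l).1`_i = 0 /\ 0 <= (expX l).2`_i.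
Proof. by move=> il; rewrite /= coef0 coefXn_ne // neq_ltn il. Qed.

Lemma expZ_ge0 m i : 0 <= (expZ m).2`_i.
Proof. by case: m => [|m]; rewrite /= ?coef0 // coefXn; case: eqP. Qed.

Lemma expY_below m l i : (i < l)%N -> (expY m l).1`_i = 0 /\ 0 <= (expY m l).2`_i.
Proof.
move=> il; rewrite /= sub0r subr0 coefN coefXn_ne ?oppr0 ?neq_ltn ?il //.
by split=> //; apply: expZ_ge0.
Qed.

(** If [st l] holds, x_l and y_l first bring the X-exponent to 0 from either side, then z_(l+1)
    raises the Z-exponent. Whenever the required element is excluded, membership in the lattice
    already gives the condition. *)
Lemma good_belowS l : (l < n)%N ->
  (exists e, good_below l e) -> exists e, good_below l.+1 e.
Proof.
move=> lt_l [e0 ge0].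
suff [e [ge gl]] : exists e, good_below l e /\ good e l.
  exists e; split=> [|i]; first by case: ge.
  by rewrite ltnS leq_eqVlt => /orP[/eqP ->//|il]; apply: ge.2.
have latt e : good_below l e -> in_lattice e by move=> [/mon_in_lattice].
rewrite /good; have [sl|sl] := boolP (st l).
  have [e1 [ge1 e1l]] : exists e, good_below l e /\ e.1`_l = 0.
    have [m] := ubnP (absz (e0.1`_l)%R); elim: m e0 ge0 => // m IHm e0 ge0 lt_m.
    case: (ltrgt0P e0.1`_l) => [gt|lt|e0l]; last by exists e0.
      apply: (IHm (e0 + expY l l)).
        apply: good_belowD ge0 => [i|]; first exact: expY_below.
        by apply: mon_inY => //; rewrite gt_eqF.
      by rewrite /= sub0r coefD coefN coefXn_id; apply: absz_pred_lt.
    apply: (IHm (e0 + expX l)).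
      apply: good_belowD ge0 => [i|]; first exact: expX_below.
      by apply: mon_inX => //; apply: canon.
    by rewrite /= coefD coefXn_id; apply: absz_succ_lt.
  have [bl|bl] := boolP (b l); last first.
    have [_ /(_ bl) e2] := (latt _ ge1).2 l lt_l.
    by exists e1; rewrite e1l e2.
  have sl1 : st l.+1 by rewrite /= bl canon.
  have [m] := ubnP (absz (e1.2`_l)%R); elim: m e1 ge1 e1l => // m IHm e1 ge1 e1l lt_m.
  case: (lerP 0 e1.2`_l) => [ge|lt]; first by exists e1.
  apply: (IHm (e1 + expZ l.+1)).
  - apply: good_belowD ge1 => [i il|]; last exact: mon_inZ.
    by rewrite coef0; split=> //; apply: expZ_ge0.
  - by rewrite /= coefD coef0 addr0.
  - by rewrite /= coefD coefXn_id; apply: absz_succ_lt.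
(* Here y_l raises the Z-exponent and keeps the sum of both exponents; afterwards x_l raises the sum
   and keeps the Z-exponent. *)
have [e1 [ge1 e1l]] : exists e, good_below l e /\ 0 <= e.2`_l.
  have [bl|bl] := boolP (b l); last first.
    have [_ /(_ bl) e2] := (latt _ ge0).2 l lt_l.
    by exists e0; rewrite e2.
  have [m] := ubnP (absz (e0.2`_l)%R); elim: m e0 ge0 => // m IHm e0 ge0 lt_m.
  case: (lerP 0 e0.2`_l) => [ge|lt]; first by exists e0.
  apply: (IHm (e0 + expY l.+1 l)).
    apply: good_belowD ge0 => [i|]; first exact: expY_below.
    exact: mon_inYS.
  by rewrite /= subr0 coefD coefXn_id; apply: absz_succ_lt.
have [al|al] := boolP (a l); last first.
  have [/(_ al) e12 _] := (latt _ ge1).2 l lt_l.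
  by exists e1; rewrite e12.
have [m] := ubnP (absz (e1.1`_l + e1.2`_l)%R).
elim: m e1 ge1 e1l => // m IHm e1 ge1 e1l lt_m.
case: (lerP 0 (e1.1`_l + e1.2`_l)) => [ge|lt]; first by exists e1.
apply: (IHm (e1 + expX l)).
- apply: good_belowD ge1 => [i|]; first exact: expX_below.
  exact: mon_inX.
- by rewrite /= coefD coef0 addr0.
- by rewrite /= !coefD coef0 coefXn_id addr0 addrAC; apply: absz_succ_lt.
Qed.

Lemma good_exponent_exists e : mon_in e -> exists e, good_below n e.
Proof.
move=> me; have: (n <= n)%N by []; elim: {1 3}n => [|l IHl] lt_l.
  by exists e; split.
by apply: good_belowS => //; apply: IHl; apply: ltnW.
Qed.

Definition regular u := forall w, P (u * w) -> P w.

(** The annihilator-type ideals [I] and [J] contain u and w respectively, and I J lies in P by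
    construction; no elements of generated ideals have to be written as sums. *)
Lemma prime_elementwise u w : (forall v, P (u * v * w)) -> P u \/ P w.
Proof.
move=> uw.
pose I : set A := [set c | forall v, P (c * v * w)].
pose J : set A := [set d | forall c, I c -> forall v, P (c * v * d)].
have [||c d Ic Jd|IP|JP] := @prime_mul _ _ primeP I J.
- split=> [v|c d Ic Id v|c d Id v|c d Ic v].
  + by rewrite !mul0r; apply: ideal0.
  + by rewrite !mulrDl; apply: idealD.
  + by rewrite -!mulrA; apply: idealMl => //; rewrite mulrA.
  + by rewrite -[c * d * v]mulrA.
- split=> [c Ic v|d d' Jd Jd' c Ic v|d d' Jd' c Ic v|d d' Jd c Ic v].
  + by rewrite mulr0; apply: ideal0.
  + by rewrite mulrDr; apply: idealD => //; [apply: Jd|apply: Jd'].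
  + by rewrite mulrA -[c * v * d]mulrA; apply: Jd'.
  + by rewrite mulrA; apply: Defs.idealMr => //; apply: Jd.
- by rewrite -[c]mulr1; apply: Jd.
- by left; apply: IP.
- by right; apply: JP => c.
Qed.

(** Normality spreads from the generators to all v: u v is congruent to some v' u. So if u w lies in
    P, then u v w does for every v, and primeness applies. *)
Lemma regular_normal u : ~ P u ->
  (forall i, (i < n)%N -> (exists c, P (u * X i - c *: (X i * u))) /\
                          (exists c, P (u * Y i - c *: (Y i * u)))) ->
  regular u.
Proof.
move=> Pu nu w Puw.
pose S : set A := [set v | exists v', P (u * v - v' * u)].
have ST : S = setT.
  apply: genA => [|i lt_i]; last first.
    have [[c hX] [d hY]] := nu i lt_i.
    by split; [exists (c *: X i)|exists (d *: Y i)]; rewrite -scalerAl.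
  split.
  - by exists 1; rewrite mulr1 mul1r subrr; apply: ideal0.
  - move=> c v1 v2 [v1' h1] [v2' h2]; exists (c *: v1' + v2').
    rewrite mulrDr mulrDl -scalerAr -scalerAl opprD addrACA -scalerBr.
    by apply: idealD => //; apply: idealZ.
  - move=> v1 v2 [v1' h1] [v2' h2]; exists (v1' * v2').
    rewrite -(subrK (v1' * u * v2) (u * _)) mulrA -mulrBl -addrA.
    rewrite -[v1' * u * v2]mulrA -[v1' * v2' * u]mulrA -mulrBr.
    by apply: idealD => //; [apply: Defs.idealMr|apply: idealMl].
suff /prime_elementwise[]: forall v, P (u * v * w) by [].
move=> v.
have : S v by rewrite ST.
move=> [v' h]; rewrite -(subrK (v' * u) (u * v)) mulrDl.
apply: idealD => //; first exact: Defs.idealMr.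
by rewrite -mulrA; apply: idealMl.
Qed.

Lemma qcomm_normal u v : qcomm u v -> exists c, P (u * v - c *: (v * u)).
Proof. by move=> [c _ ->]; exists c; rewrite subrr; apply: ideal0. Qed.

Lemma regularZ m : (m <= n)%N -> st m -> regular (zed m).
Proof.
move=> le_m /(PZ le_m) Pz; apply: regular_normal => // i lt_i.
by split; apply: qcomm_normal; [apply: (qcomm_zedX scal rel)|apply: (qcomm_zedY scal rel)].
Qed.

Lemma P_zed i : (i < n)%N -> ~~ st i -> P (zed i).
Proof. by move=> lt_i si; apply: contrapT => /(PZ (ltnW lt_i)); apply/negP. Qed.

(** Normality of x_i holds only modulo P: the obstruction x_i y_i - q_i y_i x_i is z_i, which lies
    in P as [st i] fails. *)
Lemma regularX i : (i < n)%N -> ~~ st i -> a i -> regular (X i).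
Proof.
move=> lt_i si /(PX lt_i) Px; apply: regular_normal => // j lt_j.
split; first by apply: qcomm_normal; apply: (qcommXX scal rel).
have [->|ne] := eqVneq j i; last first.
  by apply: qcomm_normal; apply: (qcommXY scal rel); rewrite 1?eq_sym.
by exists (q i); rewrite (rXYe rel lt_i) addrC addKr; apply: P_zed.
Qed.

Lemma regularY i : (i < n)%N -> ~~ st i -> b i -> regular (Y i).
Proof.
move=> lt_i si /(PY lt_i si) Py; apply: regular_normal => // j lt_j.
split; last by apply: qcomm_normal; apply: (qcommYY scal rel).
have [->|ne] := eqVneq j i; last first.
  by apply: qcomm_normal; apply: qcomm_sym; apply: (qcommXY scal rel).
exists (q i)^-1; rewrite (rXYe rel lt_i) scalerDr scalerA mulVf ?(wq_neq0 scal) //.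
rewrite scale1r opprD addrA subrr add0r; apply: idealN => //.
by apply: idealZ => //; apply: P_zed.
Qed.

Lemma regular1 : regular 1.
Proof. by move=> w; rewrite mul1r. Qed.

Lemma regularM u v : regular u -> regular v -> regular (u * v).
Proof. by move=> ru rv w; rewrite -mulrA => /ru /rv. Qed.

Lemma regularXn u m : ((0 < m)%N -> regular u) -> regular (u ^+ m).
Proof.
case: m => [_|m /(_ isT) ru]; first exact: regular1.
by elim: m => [|m IHm]; rewrite // exprS; apply: regularM.
Qed.

Definition mon_part e l : expo := \sum_(i < l) (e.1`_i *: 'X^i, e.2`_i *: 'X^i).

Definition scaled_mon u e := exists2 c, c != 0 & phi u = tmon c e.

Lemma scaled_monM u v d e : scaled_mon u d -> scaled_mon v e -> scaled_mon (u * v) (d + e).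
Proof.
move=> [c c0 uc] [c' c'0 vc]; exists (c * c' * qbeta d e).
  by apply: mulf_neq0 (mulf_neq0 c0 c'0) (qbeta_neq0 scal _ _).
by rewrite rmorphM /= uc vc tmonM.
Qed.

Lemma scaled_mon1 : scaled_mon 1 0.
Proof. by exists 1; rewrite ?oner_neq0 // rmorph1 -(tmon1 T). Qed.

Lemma scaled_monX u e m : ((0 < m)%N -> scaled_mon u e) -> scaled_mon (u ^+ m) (e *+ m).
Proof.
case: m => [_|m /(_ isT) ue]; first exact: scaled_mon1.
elim: m => [|m IHm]; first by rewrite expr1.
by rewrite exprS mulrS; apply: scaled_monM.
Qed.

Lemma regular_monomial e l : (l <= n)%N -> good_below n e ->
  exists2 u, regular u & scaled_mon u (mon_part e l).
Proof.
move=> + [me ge]; have [_ le] := mon_in_lattice me.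
elim: l => [|l IHl] lt_l.
  by exists 1; [exact: regular1|rewrite /mon_part big_ord0; exact: scaled_mon1].
have [u ru su] := IHl (ltnW lt_l); rewrite /mon_part big_ord_recr /=.
suff [v rv sv] : exists2 v, regular v & scaled_mon v (e.1`_l *: 'X^l, e.2`_l *: 'X^l).
  by exists (u * v); [exact: regularM|exact: scaled_monM].
have := ge l lt_l; have [ha hb] := le l lt_l; rewrite /good.
have [sl [e1 e2]|sl [e2 e12]] := boolP (st l).
  have hs : (0 < (absz (e.2`_l)%R))%N -> st l.+1.
    move=> nz; rewrite /= (canon lt_l sl); apply: contraTT nz => /hb ->.
    by rewrite absz0.
  exists (zed l.+1 ^+ (absz (e.2`_l)%R)).
    by apply: regularXn => /hs; apply: regularZ.
  have -> : (e.1`_l *: 'X^l, e.2`_l *: 'X^l) = expZ l.+1 *+ (absz (e.2`_l)%R) :> expo.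
    rewrite [RHS]surjective_pairing fstMn sndMn /= e1 scale0r mul0rn.
    by rewrite -{1}(gez0_abs e2) -scaler_nat -natz.
  by apply: scaled_monX => /hs sl1; exists 1; rewrite ?oner_neq0 // phi_ZE.
have hY : (0 < (absz (e.2`_l)%R))%N -> b l.
  by apply: contraTT => /hb ->; rewrite absz0.
have hX : (0 < (absz (e.1`_l + e.2`_l)%R))%N -> a l.
  by apply: contraTT => /ha ->; rewrite absz0.
(* Each y_l contributes X_l^-1 Z_(l+1), so reaching X-exponent e_1 takes e_1 + e_2 factors x_l;
   [good] makes both numbers nonnegative. *)
exists (Y l ^+ (absz (e.2`_l)%R) * X l ^+ (absz (e.1`_l + e.2`_l)%R)).
  apply: regularM; apply: regularXn; first by move=> /hY; apply: regularY.
  by move=> /hX; apply: regularX.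
have -> : (e.1`_l *: 'X^l, e.2`_l *: 'X^l) =
    expY l.+1 l *+ (absz (e.2`_l)%R) + expX l *+ (absz (e.1`_l + e.2`_l)%R) :> expo.
  rewrite [RHS]surjective_pairing /= !fstMn !sndMn /= sub0r subr0 mul0rn addr0.
  rewrite mulNrn -!scaler_nat !natz !gez0_abs // scalerDl addrC addrK.
  by [].
apply: scaled_monM; apply: scaled_monX.
  move=> /hY bl; exists (q l - 1)^-1; last by rewrite phi_YE.
  by rewrite invr_eq0 (wq_neq1 scal).
by move=> /hX al; exists 1; rewrite ?oner_neq0 // phi_XE.
Qed.

Lemma mon_part_n e : in_lattice e -> mon_part e n = e.
Proof.
move=> [e0 _].
suff E (p : {poly int}) : (forall i, (n <= i)%N -> p`_i = 0) ->
    \sum_(i < n) p`_i *: 'X^i = p.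
  rewrite /mon_part [RHS]surjective_pairing -[in RHS](E e.1) => [|i /e0[]//].
  rewrite -[in RHS](E e.2) => [|i /e0[]//].
  by elim/big_ind3: _ => // [? ? ? ? ? ? -> ->].
move=> p0; apply/polyP => j; rewrite coef_sum.
have [nj|jn] := leqP n j.
  rewrite p0 // big1 // => i _; rewrite coefZ coefXn_ne ?mulr0 //.
  by rewrite neq_ltn (leq_trans (ltn_ord i) nj) orbT.
rewrite (bigD1 (Ordinal jn)) //= coefZ coefXn_id mulr1 big1 ?addr0 // => i ne.
by rewrite coefZ coefXn_ne ?mulr0 // eq_sym (ne : val i != j).
Qed.

Lemma P_contains_gens : contains_gens n q X Y a b P.
Proof.
split=> i lt_i.
- by move=> ai; apply: contrapT => /(PX lt_i); apply/negP.
- by move=> bi si; apply: contrapT => /(PY lt_i si); apply/negP.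
- by move=> si; apply: contrapT => /(PZ lt_i); apply/negP.
Qed.

Lemma Hprime_eq_ker : P = ker phi.
Proof.
have kerP : ker phi `<=` P.
  exact: (ker_sub canon rel genA phi_X phi_Y idP P_contains_gens).
apply/seteqP; split=> // f Pf; apply: contrapT => /(mon_in_exists Pf)[e0 me0].
have [e ge] := good_exponent_exists me0; have [me _] := ge.
have [u ru [c c0 uc]] := regular_monomial (leqnn n) ge.
have [f' [d [Pf' d0 fe le]]] := me.
rewrite (mon_part_n le) in uc.
(* The images of u and f' are proportional, so u is a multiple of f' modulo the kernel, which lies
   in P. Regularity of u then puts 1 in P. *)
have Pu : P u.
  rewrite -(subrK (c / d *: f') u); apply: idealD => //; last exact: idealZ.
  apply: kerP; rewrite /ker /= linearB linearZ /= uc fe scale_tmon divfK //.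
  exact: subrr.
have P1 : P 1 by apply: ru; rewrite mulr1.
case/eqP: (prime_proper primeP); apply/seteqP; split=> // v _.
by rewrite -[v]mulr1; apply: idealMl.
Qed.

End Classification.

(** * Strong exchange *)

Section CoxeterExchange.
Variables (I : choiceType) (M : coxeter_matrix I).
Local Notation W := (cox_word M).
Local Notation s := (cox_gen M).
Local Open Scope group_scope.
Implicit Types (u v w : seq I) (t : coxeter M).

Lemma cox_cat u v : W (u ++ v) = W u * W v.
Proof. by rewrite -cox_mulE. Qed.

Lemma cox_nil : W [::] = 1. Proof. by []. Qed.

Lemma cox_cons i u : W (i :: u) = s i * W u.
Proof. exact: (cox_cat [:: i]). Qed.

Lemma cox_wordV u : (W u)^-1 = W (rev u).
Proof. exact: cox_invE. Qed.

Lemma cox_genV i : (s i)^-1 = s i.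
Proof. by rewrite cox_wordV. Qed.

Lemma cox_genK i : s i * s i = 1.
Proof. by rewrite -{1}cox_genV mulVg. Qed.

Lemma cox_pow i j m : W (flatten (nseq m [:: i; j])) = (s i * s j) ^+ m.
Proof. by elim: m => //= m IHm; rewrite !cox_cons IHm expgS mulgA. Qed.

Lemma cox_rel_pow i j : (s i * s j) ^+ M i j = 1.
Proof. by rewrite -cox_pow -cox_nil; apply/cox_wordP/Cox_rel. Qed.

(** The reflections attached to the letters of a word: multiplying on the right by the one of a
    letter deletes that letter. *)
Fixpoint reflections u : seq (coxeter M) :=
  if u is i :: v then ((W v)^-1 * s i * W v) :: reflections v else [::].

(* The parity depends only on the element W u (eta_word), whence strong exchange. *)
Definition eta u t := odd (count_mem t (reflections u)).

Lemma count_reflections_cat u v t : count_mem t (reflections (u ++ v)) =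
  (count_mem (W v * t * (W v)^-1)%g (reflections u) + count_mem t (reflections v))%N.
Proof.
elim: u => //= i u ->; rewrite addnA; congr (_ + _ + _)%N; congr nat_of_bool.
set r := (W u)^-1 * s i * W u.
have -> : (W (u ++ v))^-1 * s i * W (u ++ v) = (W v)^-1 * r * W v.
  by rewrite cox_cat invgM /r !mulgA.
by apply/eqP/eqP => [<-|->]; rewrite !mulgA ?mulgV ?mulVg mul1g ?mulgK ?mulgVK.
Qed.

Lemma eta_cat u v t : eta (u ++ v) t = eta u (W v * t * (W v)^-1) (+) eta v t.
Proof. by rewrite /eta count_reflections_cat oddD. Qed.

Lemma reflections_rel i j m : reflections (flatten (nseq m [:: i; j])) =
  rev [seq s j * (s i * s j) ^+ l | l <- iota 0 (m + m)].
Proof.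
pose r := s i * s j.
have rV l : r ^- l * s j = s j * r ^+ l.
  elim: l => [|l IHl]; first by rewrite !expg0 invg1 mul1g mulg1.
  rewrite [in LHS]expgSr invgM -mulgA IHl expgS !mulgA; congr (_ * _).
  by rewrite /r invgM !cox_genV.
elim: m => [//|m IHm].
have -> : flatten (nseq m.+1 [:: i; j]) = i :: j :: flatten (nseq m [:: i; j]) by [].
have -> : (m.+1 + m.+1 = (m + m) + 2)%N by lia.
rewrite iotaD map_cat rev_cat -IHm add0n.
rewrite [reflections (i :: _)]/= cox_cons cox_pow -/r /rev /=.
congr [:: _, _ & _]; last by rewrite rV -mulgA -expgnDr.
rewrite invgM cox_genV -!mulgA [s i * _]mulgA -/r mulgA rV -!mulgA.
by rewrite [s i * _]mulgA -/r -expgS -expgnDr addnS.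
Qed.

(** For a relator, (s_i s_j)^M = 1 makes the second half of the list of reflections repeat the
    first, so every reflection occurs an even number of times. *)
Lemma eta_equiv u v t : cox_equiv M u v -> eta u t = eta v t.
Proof.
move=> uv; elim: uv t => {u v} [//|u v _ IH|u v w _ IH1 _ IH2|u u' v v' _ IH1 vv IH2|i j] t.
- by rewrite IH.
- by rewrite IH1.
- by rewrite !eta_cat IH1 IH2 (iffRL (cox_wordP M v v') vv).
rewrite /eta reflections_rel count_rev iotaD map_cat count_cat add0n.
have -> : iota (M i j) (M i j) = [seq (M i j + l)%N | l <- iota 0 (M i j)].
  by rewrite -iotaDl addn0.
rewrite -map_comp; set c1 := count _ _; set c2 := count _ _.
suff -> : c2 = c1 by rewrite addnn odd_double.
rewrite /c2 /c1; congr count; apply: eq_map => l /=.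
by rewrite expgnDr cox_rel_pow mul1g.
Qed.

Lemma eta_word u v t : W u = W v -> eta u t = eta v t.
Proof. by move/cox_wordP; apply: eta_equiv. Qed.

Lemma reflections_del u t : t \in reflections u ->
  exists u1 i u2, u = u1 ++ i :: u2 /\ W u * t = W (u1 ++ u2).
Proof.
elim: u => //= i u IHu; rewrite inE => /orP[/eqP ->|/IHu[u1 [j [u2 [-> E]]]]].
  exists [::], i, u; split=> //.
  by rewrite cox_cons !mulgA mulgK cox_genK mul1g.
by exists (i :: u1), j, u2; split=> //; rewrite cox_cons -mulgA E /= cox_cons.
Qed.

Lemma cox_length_le u : (cox_length (W u) <= size u)%N.
Proof.
rewrite /cox_length; case: ex_minnP => m _; apply.
by apply/asboolP; exists u.
Qed.

Lemma cox_length_word (x : coxeter M) : exists2 u, x = W u & size u = cox_length x.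
Proof. by rewrite /cox_length; case: ex_minnP => m /asboolP. Qed.

Lemma cox_lengthV (w : coxeter M) : cox_length w^-1 = cox_length w.
Proof.
suff le x : (cox_length (x^-1 : coxeter M)%g <= cox_length x)%N.
  by apply/eqP; rewrite eqn_leq le -{1}[w]invgK le.
have [u -> <-] := cox_length_word x.
by rewrite cox_wordV -(size_rev u); apply: cox_length_le.
Qed.

Lemma reflection_sqr t : is_reflection t -> t * t = 1.
Proof. by move=> [g [i ->]]; rewrite !mulgA mulgVK -[g * s i * s i]mulgA cox_genK mulg1 mulgV. Qed.

(** As the parity depends only on the element, a palindromic word x i rev(x) may be used: its two
    halves contribute equal parities and the middle letter contributes 1. *)
Lemma eta_reflection u t : W u = t -> is_reflection t -> eta u t.
Proof.
move=> ut [g [i tE]]; have [x gx] := cox_word_surj g.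
have etaV : eta (rev x) t = eta x (s i).
  have := eta_cat x (rev x) t; rewrite (@eta_word (x ++ rev x) [::]); last first.
    by rewrite cox_cat -cox_wordV mulgV.
  rewrite -cox_wordV invgK -gx tE !mulgA mulVg mul1g mulgVK.
  by rewrite {1}/eta /=; case: (eta (rev x) _); case: (eta x _).
rewrite (@eta_word u (x ++ i :: rev x)); last first.
  by rewrite ut tE gx cox_cat cox_cons -cox_wordV mulgA.
have sP : s i * s i * s i = s i by rewrite cox_genK mul1g.
have tg : (W x)^-1 * t * W x = s i.
  by rewrite tE gx !mulgA mulVg mul1g mulgVK.
rewrite eta_cat -cat1s eta_cat etaV -cox_wordV invgK tg.
rewrite (cox_cons i (rev x)) -cox_wordV invgM invgK cox_genV.
have -> : s i * (W x)^-1 * t * (W x * s i) = s i.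
  by rewrite -!mulgA [_^-1 * _]mulgA [_ * (W x * _)]mulgA tg mulgA cox_genK mul1g.
rewrite [eta [:: i] _]/eta /= cox_nil invg1 mul1g mulg1 eqxx /=.
by case: eta.
Qed.

(** The parity of [t] is even for u and odd for a word of t, hence odd for a shortest word of u t.
    So [t] is a reflection of that word, and deleting its letter gives a shorter word of u. *)
Lemma cox_length_up u t : is_reflection t -> t \notin reflections u ->
  (cox_length (W u) < cox_length (W u * t)%g)%N.
Proof.
move=> rt nt; have [x tx] := cox_word_surj t.
have [y yE <-] := cox_length_word (W u * t)%g.
have : eta y t.
  rewrite (@eta_word y (u ++ x)); last by rewrite cox_cat -tx yE.
  rewrite eta_cat (eta_reflection (esym tx) rt) -tx mulgK.
  by rewrite /eta (count_memPn nt).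
rewrite /eta => odd_t; have /reflections_del[y1 [i [y2 [ye E]]]] : t \in reflections y.
  by rewrite -has_pred1 has_count; case: count odd_t.
have -> : W u = W (y1 ++ y2) by rewrite -E -yE -mulgA reflection_sqr // mulg1.
by apply: leq_ltn_trans (cox_length_le _) _; rewrite ye !size_cat /= addnS.
Qed.

(** Strong exchange; the word [u] is arbitrary, reduced or not, so the lemma can be iterated along a
    Bruhat chain. *)
Lemma bruhat_step_del (x : coxeter M) u : bruhat_step x (W u) ->
  exists u1 i u2, u = u1 ++ i :: u2 /\ x = W (u1 ++ u2).
Proof.
move=> [[t rt ut] lt]; have vE : W u * t = x by rewrite ut -mulgA reflection_sqr // mulg1.
have [/reflections_del[u1 [i [u2 [ue E]]]]|/(cox_length_up rt)] := boolP (t \in reflections u).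
  by exists u1, i, u2; rewrite -E.
by rewrite vE ltnNge (ltnW lt).
Qed.

Definition reduced u := cox_length (W u) = size u.

Lemma bruhat_del u i v : reduced (u ++ i :: v) -> bruhat_step (W (u ++ v)) (W (u ++ i :: v)).
Proof.
move=> red; split.
  exists ((W v)^-1 * s i * W v).
    by exists (W v)^-1, i; rewrite invgK.
  by rewrite !cox_cat cox_cons !mulgA mulgK.
by rewrite red; apply: leq_ltn_trans (cox_length_le _) _; rewrite !size_cat /= addnS.
Qed.

Lemma reduced_rcons u i : reduced u ->
  (forall u1 j u2, u = u1 ++ j :: u2 -> W u * s i <> W (u1 ++ u2)) ->
  reduced (u ++ [:: i]).
Proof.
move=> red nodel; apply/eqP; rewrite /reduced eqn_leq cox_length_le /= cox_cat.
rewrite size_cat addn1 -red; apply: cox_length_up.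
  by exists 1, i; rewrite mul1g invg1 mulg1.
by apply/negP => /reflections_del[u1 [j [u2 [ue]]]]; apply: nodel ue.
Qed.

Lemma reduced_cons u i : reduced u ->
  (forall u1 j u2, u = u1 ++ j :: u2 -> s i * W u <> W (u1 ++ u2)) ->
  reduced (i :: u).
Proof.
have red_rev v : reduced v -> reduced (rev v).
  by rewrite /reduced -cox_wordV cox_lengthV size_rev.
move=> red nodel; rewrite -[i :: u]revK rev_cons -cats1; apply: (red_rev).
apply: reduced_rcons; first exact: red_rev.
move=> u1 j u2 ue E; apply: (nodel (rev u2) j (rev u1)).
  by rewrite -[u]revK ue rev_cat rev_cons cat_rcons.
by rewrite -rev_cat -cox_wordV -E -cox_wordV invgM invgK cox_genV.
Qed.

End CoxeterExchange.

Lemma cat_cons_split (T : Type) (u v u1 u2 : seq T) c : u ++ v = u1 ++ c :: u2 ->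
  (exists v1, u = u1 ++ c :: v1 /\ u2 = v1 ++ v) \/
  (exists v1, u1 = u ++ v1 /\ v = v1 ++ c :: u2).
Proof.
elim: u u1 => [|x u IHu] u1 E; first by right; exists u1.
case: u1 E => [[<- <-]|y u1 [<- /IHu]]; first by left; exists u.
case=> [[v1 [-> ->]]|[v1 [-> ->]]]; [left|right]; by exists v1.
Qed.

Lemma nseq_split (T : Type) (x : T) (d : bool) u1 c u2 :
  nseq d x = u1 ++ c :: u2 -> [/\ d, u1 = [::] & u2 = [::]].
Proof. by case: d u1 => [] [|? [|? ?]] //= [_ <-]. Qed.

(** * The Bruhat interval below w_n *)

Section TypeAWords.
Variable n' : nat.
Let n := n'.+1.
Local Notation M := (typeA n).
Local Notation W := (cox_word M).
Local Notation s := (cox_gen M).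
Implicit Types (a b : nat -> bool) (u v : seq 'I_n).

Let L (m : nat) : 'I_n := inord m.

Lemma letterE m : (m < n)%N -> L m = m :> nat.
Proof. exact: inordK. Qed.

(** * Words acting as permutations *)

Definition swap c x := if x == c then c.+1 else if x == c.+1 then c else x.

(** By [pact_word] this depends only on the Coxeter element, and so serves as an invariant to tell
    elements apart. *)
Definition word_act u (x : nat) := foldr (fun (c : 'I_n) => swap c) x u.

Lemma pact_cat u v x : word_act (u ++ v) x = word_act u (word_act v x).
Proof. by rewrite /word_act foldr_cat. Qed.

Lemma swapK c : involutive (swap c).
Proof.
move=> x; rewrite /swap; have [->|xc] := eqVneq x c; first by rewrite gtn_eqF ?eqxx.
have [->|xc1] := eqVneq x c.+1; first by rewrite eqxx.
by rewrite (negPf xc) (negPf xc1).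
Qed.

Lemma swapP c x : (x = c /\ swap c x = c.+1) \/ (x = c.+1 /\ swap c x = c) \/
  (x <> c /\ x <> c.+1 /\ swap c x = x).
Proof.
rewrite /swap; case: (x =P c) => [|xc]; first by left.
by case: (x =P c.+1) => [|xc1]; right; [left|right].
Qed.

Local Ltac swap_cases := repeat match goal with |- context [swap ?c ?x] =>
  lazymatch x with
  | context [swap _ _] => fail
  | _ => let E := fresh in
         destruct (swapP c x) as [[? E]|[[? E]|[? [? E]]]]; rewrite E; clear E;
         try (exfalso; lia)
  end end.

Lemma swap_rel (i j : 'I_n) x : word_act (flatten (nseq (typeA_m i j) [:: i; j])) x = x.
Proof.
rewrite /typeA_m; case: eqVneq => [->|ne]; first by rewrite /= swapK.
have {}ne : (i : nat) <> j by move=> /val_inj/eqP; apply/negP.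
move: ne; case: ifP => /= + ne; move: (i : nat) (j : nat) ne => {}i {}j ne ij; swap_cases; lia.
Qed.

Lemma pact_word u v x : W u = W v -> word_act u x = word_act v x.
Proof.
move/cox_wordP => uv.
elim: uv x => {u v} [//|u v _ IH|u v w _ IH1 _ IH2|u u' v v' _ IH1 _ IH2|i j] x.
- by rewrite IH.
- by rewrite IH1.
- by rewrite !pact_cat IH2 IH1.
- exact: swap_rel.
Qed.

Lemma pact_below u m x : (forall c, c \in u -> (c < m)%N) ->
  ((m < x)%N -> word_act u x = x) /\ ((x <= m)%N -> (word_act u x <= m)%N).
Proof.
elim: u => [//|c u IHu] cm; have [//|h1 h2] := IHu _.
  by move=> d du; apply: cm; rewrite inE du orbT.
have lt_c : (c < m)%N by apply: cm; rewrite mem_head.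
split=> mx; rewrite /= /swap.
  by rewrite -/(word_act u x) h1 // gtn_eqF ?gtn_eqF // (leq_trans _ mx) // ltnW.
by rewrite -/(word_act u x); have := h2 mx; do 2 case: eqP => //; lia.
Qed.

Lemma gen_commute u m : (m < n)%N -> (forall c, c \in u -> (c.+1 < m)%N) ->
  (s (L m) * W u = W u * s (L m))%g.
Proof.
move=> lt_m; elim: u => [|c u IHu] cm; first by rewrite cox_nil mulg1 mul1g.
have lt_c : (c.+1 < m)%N by apply: cm; rewrite mem_head.
rewrite cox_cons -[RHS]mulgA -IHu => [|d du]; last by apply: cm; rewrite inE du orbT.
rewrite !mulgA; congr (_ * _)%g.
have := cox_rel_pow M (L m) c; rewrite /= /typeA_m.
have -> : (L m == c) = false by apply/negbTE/eqP => /(congr1 val) /=; rewrite letterE; lia.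
rewrite letterE //; have -> : (m.+1 == c) || (c.+1 == m) = false by lia.
move=> E; apply: (mulIg (s (L m) * s c)%g); rewrite -expg2 E.
by rewrite -!mulgA [(s (L m) * (s (L m) * _))%g]mulgA cox_genK mul1g cox_genK.
Qed.

(* a i deletes the left occurrence of s_(i+1) in the word of w_n, b i the right one. *)
Fixpoint bit_word a b m : seq 'I_n :=
  if m is l.+1 then nseq (~~ a l) (L l) ++ bit_word a b l ++ nseq (~~ b l) (L l) else [::].

Lemma wd_below a b m c : (m <= n)%N -> c \in bit_word a b m -> (c < m)%N.
Proof.
elim: m => //= m IHm lt_m; rewrite !mem_cat => /or3P[|/(IHm (ltnW lt_m))/ltnW//|];
  by case: (~~ _); rewrite // inE => /eqP ->; rewrite letterE.
Qed.

Lemma wd_eq a b a' b' m : (forall i, (i < m)%N -> a i = a' i /\ b i = b' i) ->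
  bit_word a b m = bit_word a' b' m.
Proof.
elim: m => //= m IHm ab; have [-> ->] := ab m (ltnSn m).
by rewrite IHm // => i im; apply: ab; apply: ltnW.
Qed.

Lemma st_eq a b a' b' m : (forall i, (i < m)%N -> a i = a' i /\ b i = b' i) ->
  st a b m = st a' b' m.
Proof. by case: m => //= m ab; have [-> ->] := ab m (ltnSn m). Qed.

(** For m > 0, [st a b m] deletes both letters of index m - 1; the remaining ones are then not
    adjacent to m. *)
Lemma wd_st a b m c : (m <= n)%N -> st a b m -> c \in bit_word a b m -> (c.+1 < m)%N.
Proof.
case: m => [//|m] /= lt_m /andP[-> ->]; rewrite /= cats0.
by move=> /(wd_below (ltnW lt_m)).
Qed.

Lemma wd_commute a b m : (m < n)%N -> st a b m ->
  (s (L m) * W (bit_word a b m) = W (bit_word a b m) * s (L m))%g.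
Proof. by move=> lt_m sm; apply: gen_commute => // c; apply: wd_st => //; apply: ltnW. Qed.

(* A subword may be replaced by one with admissible bits: if st a b i holds then
   s_(i+1) commutes with the letters between its two occurrences, so that one
   remaining occurrence can be placed on the right, and two cancel. *)
Fixpoint canon_st a b m := if m is l.+1
  then if canon_st a b l then a l == b l else a l && b l else true.
Definition canon_a a b m := canon_st a b m || a m.
Definition canon_b a b m := if canon_st a b m then a m == b m else b m.

Lemma st_canon a b m : st (canon_a a b) (canon_b a b) m = canon_st a b m.
Proof. by case: m => //= m; rewrite /canon_a /canon_b; case: (canon_st a b m). Qed.

Definition canonical a b := forall i, (i < n)%N -> st a b i -> a i.

Lemma canonical_canon a b : canonical (canon_a a b) (canon_b a b).
Proof. by move=> i _; rewrite st_canon /canon_a => ->. Qed.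

Lemma cst_canonical a b m : (m <= n)%N -> canonical a b -> canon_st a b m = st a b m.
Proof.
move=> + cab; elim: m => //= m IHm lt_m; rewrite IHm ?(ltnW lt_m) //.
by case: ifP => // sm; rewrite (cab m lt_m sm).
Qed.

Lemma wd_canon a b m : (m <= n)%N ->
  W (bit_word (canon_a a b) (canon_b a b) m) = W (bit_word a b m).
Proof.
elim: m => //= m IHm lt_m; have {}IHm := IHm (ltnW lt_m).
have := @wd_commute (canon_a a b) (canon_b a b) m lt_m; rewrite st_canon IHm !cox_cat IHm.
rewrite {1}/canon_a {1}/canon_b; case: (canon_st a b m) => //= /(_ isT) com.
rewrite cox_nil mul1g.
case: (a m) (b m) => [] [] //=; rewrite ?cox_nil ?mul1g ?mulg1 //.
by rewrite -[W [:: _]]/(s (L m)) mulgA com -mulgA cox_genK mulg1.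
Qed.

Definition raise (d : nat -> bool) j i := (i == j) || d i.

Lemma wd_del a b m u1 c u2 : bit_word a b m = u1 ++ c :: u2 -> exists a' b',
  [/\ forall i, a i -> a' i, forall i, b i -> b' i,
      forall i, (m <= i)%N -> a' i = a i /\ b' i = b i & bit_word a' b' m = u1 ++ u2].
Proof.
elim: m u1 c u2 => [|m IHm] u1 c u2; first by case: u1.
have upE (d : nat -> bool) j i : (i < j)%N -> raise d j i = d i.
  by move=> ij; rewrite /raise ltn_eqF.
have upE' (d : nat -> bool) j i : (j < i)%N -> raise d j i = d i.
  by move=> ij; rewrite /raise gtn_eqF.
have wdu : bit_word (raise a m) b m = bit_word a b m /\ bit_word a (raise b m) m = bit_word a b m.
  by split; apply: wd_eq => i im; rewrite upE.
move=> /= E0; case: (cat_cons_split E0) => {E0} [[v1 [E ->]]|[v1 [-> E]]].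
  have [na -> ->] := nseq_split E.
  exists (raise a m), b; split=> // [i ai|i mi|]; first by rewrite /raise ai orbT.
    by rewrite upE'.
  by rewrite /= wdu.1 /raise eqxx.
case: (cat_cons_split E) => {E} [[v2 [E ->]]|[v2 [-> E]]].
  have [a' [b' [ha hb hm hw]]] := IHm _ _ _ E.
  exists a', b'; split=> // [i mi|]; first by apply: hm; apply: ltnW.
  by have [-> ->] := hm m (leqnn m); rewrite /= hw !catA.
have [nb -> ->] := nseq_split E.
exists a, (raise b m); split=> // [i bi|i mi|]; first by rewrite /raise bi orbT.
  by rewrite upE'.
by rewrite /= wdu.2 /raise eqxx !cats0.
Qed.

Lemma wd_raise a b m j : (j < m)%N -> exists c,
  (~~ a j -> exists u1 u2, bit_word a b m = u1 ++ c :: u2 /\ bit_word (raise a j) b m = u1 ++ u2) /\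
  (~~ b j -> exists u1 u2, bit_word a b m = u1 ++ c :: u2 /\ bit_word a (raise b j) m = u1 ++ u2).
Proof.
move=> jm; exists (L j); elim: m jm => // m IHm; rewrite ltnS leq_eqVlt.
case/orP=> [/eqP ->|jm].
  have wdu : bit_word (raise a m) b m = bit_word a b m /\ bit_word a (raise b m) m = bit_word a b m.
    by split; apply: wd_eq => i im; rewrite /raise ltn_eqF.
  split=> nd; rewrite /= nd /raise eqxx /= -/(raise _ _).
    exists [::], (bit_word a b m ++ nseq (~~ b m) (L m)); split=> //.
    by rewrite -/(raise a m) wdu.1.
  exists (nseq (~~ a m) (L m) ++ bit_word a b m), [::]; split; first by rewrite catA.
  by rewrite -/(raise b m) wdu.2 !cats0.
have [h1 h2] := IHm jm.
split=> [/h1|/h2] [u1 [u2 [E1 E2]]]; exists (nseq (~~ a m) (L m) ++ u1),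
    (u2 ++ nseq (~~ b m) (L m)); by rewrite /= /raise gtn_eqF //= E1 E2 -!catA.
Qed.

Lemma pact_wd_out a b m x : (m <= n)%N -> (m < x)%N -> word_act (bit_word a b m) x = x.
Proof. by move=> le_m mx; apply: (pact_below _ (fun c => wd_below le_m)).1. Qed.

Lemma pact_wd_le a b m x : (m <= n)%N -> (x <= m)%N -> (word_act (bit_word a b m) x <= m)%N.
Proof. by move=> le_m mx; apply: (pact_below _ (fun c => wd_below le_m)).2. Qed.

Lemma pact_st a b m : (m <= n)%N -> st a b m -> word_act (bit_word a b m) m = m.
Proof.
case: m => [//|m] /= lt_m /andP[-> ->]; rewrite /= cats0.
exact: pact_wd_out (ltnW lt_m) (ltnSn m).
Qed.

Lemma pact_wdS a b m x : (m < n)%N -> word_act (bit_word a b m.+1) x =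
  (if a m then id else swap m) (word_act (bit_word a b m) ((if b m then id else swap m) x)).
Proof.
move=> lt_m; rewrite /= !pact_cat.
by case: (a m) (b m) => [] []; rewrite /= ?letterE.
Qed.

(** With [pact_st], the image of m detects [st a b m] for admissible bits: m is fixed if it holds
    and is moved down otherwise. *)
Lemma pact_nst a b m : (m <= n)%N -> canonical a b -> ~~ st a b m ->
  (word_act (bit_word a b m) m < m)%N.
Proof.
move=> + cab; elim: m => [//|m IHm] lt_m nst; rewrite pact_wdS //.
have le_m := ltnW lt_m.
have := @pact_wd_le a b m m le_m (leqnn m); have := @pact_wd_out a b m m.+1 le_m (ltnSn m).
have [sm|sm] := boolP (st a b m).
  move: nst => /=; rewrite (cab m lt_m sm) /= => /negPf -> _.
  by rewrite /swap gtn_eqF // eqxx ltnS.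
have := IHm le_m sm; move: nst => /=.
case: (a m) (b m) => [] [] //= _; set p := word_act _ m => pm pS _; rewrite /swap.
- by rewrite gtn_eqF // eqxx -/p ltnS ltnW.
- by rewrite pS gtn_eqF // eqxx.
by rewrite [m.+1 == m]gtn_eqF // eqxx -/p (ltn_eqF pm) ltn_eqF ?(ltn_trans pm) // ltnW.
Qed.

(** Let p be the image of m under the inner word. The images of m and m + 1 under the whole word are
    (p, m+1), (m+1, p), (p, m), (m, p) for bits (a, b) at m equal to (1,1), (1,0), (0,1), (0,0). As
    p < m, or p = m and a = 1, these determine the bits, and the outer letters cancel. *)
Lemma wd_inj a b a' b' m : (m <= n)%N -> canonical a b -> canonical a' b' ->
  W (bit_word a b m) = W (bit_word a' b' m) -> forall i, (i < m)%N -> a i = a' i /\ b i = b' i.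
Proof.
move=> + cab cab'; elim: m => // m IHm lt_m E; have le_m := ltnW lt_m.
have eq_m : a m = a' m /\ b m = b' m.
  have := pact_word m E; have := pact_word m.+1 E; rewrite !pact_wdS //.
  have := @pact_wd_out a b m m.+1 le_m (ltnSn m).
  have := @pact_wd_out a' b' m m.+1 le_m (ltnSn m).
  have : (word_act (bit_word a b m) m < m)%N \/ (word_act (bit_word a b m) m = m /\ a m).
    have [sm|sm] := boolP (st a b m); [right|left; exact: pact_nst].
    by split; [exact: pact_st|exact: cab].
  have : (word_act (bit_word a' b' m) m < m)%N \/ (word_act (bit_word a' b' m) m = m /\ a' m).
    have [sm|sm] := boolP (st a' b' m); [right|left; exact: pact_nst].
    by split; [exact: pact_st|exact: cab'].
  have sw1 : swap m m = m.+1 by rewrite /swap eqxx.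
  have sw2 : swap m m.+1 = m by rewrite /swap gtn_eqF ?eqxx.
  have sw3 p : (p < m)%N -> swap m p = p.
    by move=> pm; rewrite /swap (ltn_eqF pm) ltn_eqF // ltnW.
  set p := word_act (bit_word a b m) m; set p' := word_act (bit_word a' b' m) m => hp' hp E1 E2.
  case: (a m) hp (a' m) hp' (b m) (b' m) => hp [] hp' [] [] //=;
    rewrite ?sw1 ?sw2 ?E1 ?E2 -/p -/p' ?sw1 ?sw2;
    case: hp => [lp|[ep//]]; case: hp' => [lp'|[ep'//]];
    rewrite ?(sw3 _ lp) ?(sw3 _ lp') ?ep ?ep' ?sw1; lia.
have [eqa eqb] := eq_m.
have Em : W (bit_word a b m) = W (bit_word a' b' m).
  move: E; rewrite /= !cox_cat eqa eqb => E.
  by apply: (mulIg (W (nseq (~~ b' m) (L m)))); apply: (mulgI (W (nseq (~~ a' m) (L m)))).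
move=> i; rewrite ltnS leq_eqVlt => /orP[/eqP ->//|im].
exact: IHm.
Qed.

Lemma mem_del (u1 u2 : seq 'I_n) j m : (forall c, c \in u1 ++ j :: u2 -> (c < m)%N) ->
  forall c, c \in u1 ++ u2 -> (c < m)%N.
Proof.
move=> h c; rewrite mem_cat => cu; apply: h; rewrite mem_cat inE.
by case/orP: cu => ->; rewrite ?orbT.
Qed.

(** By exchange, a failure would be a deletion, and the image of m + 1 excludes it: deleting inside
    the inner word leaves m + 1 fixed by that word. With both outer letters kept, m + 1 goes to p <
    m, against m + 1 or m after a deletion. *)
Lemma reduced_bit_word a b m : (m <= n)%N -> canonical a b -> reduced M (bit_word a b m).
Proof.
move=> + cab; elim: m => [_|m IHm lt_m].
  by apply/eqP; rewrite eqn_leq cox_length_le.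
have le_m := ltnW lt_m; have red := IHm le_m.
have sw1 : swap m m = m.+1 by rewrite /swap eqxx.
have sw2 : swap m m.+1 = m by rewrite /swap gtn_eqF ?eqxx.
have out := @pact_wd_out a b m m.+1 le_m (ltnSn m).
have le_p := @pact_wd_le a b m m le_m (leqnn m).
set u := bit_word a b m in red out le_p.
have del u1 j u2 : u = u1 ++ j :: u2 -> word_act (u1 ++ u2) m.+1 = m.+1.
  move=> ue; apply: (pact_below (m := m) _ _).1 => //; apply: (mem_del (j := j)).
  by rewrite -ue => c; apply: wd_below.
have red_r : reduced M (u ++ [:: L m]).
  apply: reduced_rcons => // u1 j u2 ue; rewrite -cox_cat => /(pact_word m.+1).
  by rewrite pact_cat (del _ _ _ ue) /= letterE // sw2; move: le_p; lia.
have red_l : reduced M (L m :: u).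
  apply: reduced_cons => // u1 j u2 ue; rewrite -cox_cons => /(pact_word m.+1).
  by rewrite (del _ _ _ ue) /= -/(word_act u _) out letterE // sw2; lia.
rewrite /= -/u; have := cab m lt_m; have := @pact_nst a b m le_m cab.
case: (a m) (b m) => [] [] //= np hs; rewrite ?cats0 //.
have {np} : (word_act u m < m)%N by apply: np; apply/negP => /hs.
move=> pm; apply: (@reduced_rcons _ M (L m :: u)) => // u1 j u2.
case: u1 => [[_ <-]|c u1 [<- ue]]; rewrite -cox_cat => /(pact_word m.+1).
  rewrite /= -/(word_act _ _) pact_cat /= letterE // sw2 out /swap.
  by rewrite (ltn_eqF pm) ltn_eqF ?(ltnW pm) //; move: pm; rewrite -/u; lia.
rewrite /= -/(word_act _ _) -/(word_act _ _) (del _ _ _ ue) pact_cat /= letterE // sw2.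
by have := swapP m (word_act u m); move: pm; lia.
Qed.

(** Reverse inclusion of the sets of z_m, x_i and y_i lying outside the two primes;
    [b i || st a b i] says that y_i lies outside, which is automatic when z_i does. *)
Definition bits_le a b a' b' :=
  [/\ forall m, (m <= n)%N -> st a' b' m -> st a b m,
      forall i, (i < n)%N -> a' i -> a i
    & forall i, (i < n)%N -> b' i || st a' b' i -> b i || st a b i].

Lemma bits_le_canon a b a' b' : canonical a' b' ->
  (forall i, a' i -> a i) -> (forall i, b' i -> b i) ->
  bits_le (canon_a a b) (canon_b a b) a' b'.
Proof.
move=> cab' ha hb; have hs m : (m <= n)%N -> st a' b' m -> canon_st a b m.
  elim: m => //= m IHm lt_m /andP[/ha -> /hb ->].
  by case: ifP.
split=> [m le_m|i lt_i /ha ai|i lt_i]; rewrite ?st_canon; first exact: hs.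
  by rewrite /canon_a ai orbT.
have := hs i (ltnW lt_i); rewrite /canon_b.
case: (canon_st a b i) => /= [_|ns]; rewrite ?orbT // orbF => /orP[/hb //|/ns].
exact.
Qed.

Lemma bruhat_bit_word x y a b : bruhat x y -> y = W (bit_word a b n) ->
  exists a' b', [/\ forall i, a i -> a' i, forall i, b i -> b' i & x = W (bit_word a' b' n)].
Proof.
move=> xy; elim: xy a b => {x y} [x y xy|x|x y z _ IH1 _ IH2] a b E.
- move: xy; rewrite E => /bruhat_step_del[u1 [c [u2 [/wd_del[a' [b' [ha hb _ hw]]] xE]]]].
  by exists a', b'; rewrite xE -hw.
- by exists a, b.
have [a1 [b1 [ha1 hb1 /IH1[a2 [b2 [ha2 hb2 ->]]]]]] := IH2 _ _ E.
by exists a2, b2; split=> // i; [move/ha1/ha2|move/hb1/hb2].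
Qed.

Lemma bits_le_of_bruhat a b a' b' : canonical a b -> canonical a' b' ->
  bruhat (W (bit_word a b n)) (W (bit_word a' b' n)) -> bits_le a b a' b'.
Proof.
move=> cab cab' /bruhat_bit_word /(_ erefl) [a1 [b1 [ha hb E]]].
rewrite -[RHS]wd_canon // in E.
have eq_ab := wd_inj (leqnn n) cab (@canonical_canon a1 b1) E.
have [h1 h2 h3] := bits_le_canon cab' ha hb.
have eq_st m : (m <= n)%N -> st a b m = st (canon_a a1 b1) (canon_b a1 b1) m.
  by move=> le_m; apply: st_eq => i im; apply: eq_ab; apply: leq_trans le_m.
split=> [m le_m /h1|i lt_i /h2|i lt_i /h3]; first by rewrite eq_st //; apply.
  by have [-> _] := eq_ab i lt_i; apply.
by have [_ ->] := eq_ab i lt_i; rewrite eq_st ?(ltnW lt_i) //; apply.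
Qed.

Lemma bruhat_step_raise a b c d j : (j < n)%N -> canonical a b ->
  (~~ a j /\ c = raise a j /\ d = b) \/ (~~ b j /\ c = a /\ d = raise b j) ->
  bruhat_step (W (bit_word c d n)) (W (bit_word a b n)).
Proof.
move=> lt_j cab; have [x [ha hb]] := wd_raise a b lt_j.
have red := reduced_bit_word (leqnn n) cab.
case=> [[/ha[u1 [u2 [E1 E2]]] [-> ->]]|[/hb[u1 [u2 [E1 E2]]] [-> ->]]];
  by rewrite E2; rewrite E1 in red *; apply: bruhat_del.
Qed.

(* A letter of the first position where the bits differ can be deleted, unless this
   changes st at the next position while both letters there are present: the left one
   of these is then deleted instead. *)
Lemma bits_le_raise a b a' b' : canonical a b -> canonical a' b' ->
  bits_le a b a' b' -> (exists2 i, (i < n)%N & (a i, b i) <> (a' i, b' i)) ->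
  exists c d, bits_le a b (canon_a c d) (canon_b c d) /\
    bruhat_step (W (bit_word c d n)) (W (bit_word a' b' n)).
Proof.
move=> cab cab' [hs ha hb] [i0 lt_i0 /eqP ne0].
have exi : exists i, (a i, b i) != (a' i, b' i) by exists i0.
have [i ne mini] := ex_minnP exi.
have lt_i : (i < n)%N := leq_ltn_trans (mini _ ne0) lt_i0.
have same l : (l < i)%N -> a l = a' l /\ b l = b' l.
  move=> li; have := contraNN (mini l); rewrite -ltnNge => /(_ li).
  by rewrite negbK => /eqP[-> ->].
have eq_st : st a b i = st a' b' i by apply: st_eq.
have stc m : (m <= n)%N -> canon_st a' b' m = st a' b' m.
  by move=> le_m; apply: cst_canonical.
(* Reduces the comparison with the canonical form of arbitrary bits to conditions on these bits. *)
have leI c d : (forall m, (m <= n)%N -> canon_st c d m -> st a b m) ->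
    (forall l, (l < n)%N -> c l -> a' l \/ a l) ->
    (forall l, (l < n)%N -> d l -> b' l \/ b l) -> bits_le a b (canon_a c d) (canon_b c d).
  move=> hst hc hd; split=> [m le_m|l lt_l|l lt_l]; rewrite ?st_canon.
  - exact: hst.
  - by case/orP=> [/(hst _ (ltnW lt_l))/(cab _ lt_l)//|/(hc _ lt_l)[/(ha _ lt_l)|]].
  - have := hst l (ltnW lt_l); rewrite /canon_b; case: (canon_st c d l) => [/(_ isT) ->|_].
      by rewrite !orbT.
    rewrite orbF => /(hd _ lt_l)[bl|->//].
    by apply: hb => //; rewrite bl.
have same_cst c d m : (forall l, (l < m)%N -> c l = a' l /\ d l = b' l) ->
    canon_st c d m = canon_st a' b' m.
  elim: m => //= m IHm cd; have [-> ->] := cd m (ltnSn m).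
  by rewrite IHm // => l lm; apply: cd; apply: ltnW.
have raiseE d j l : l != j -> raise d j l = d l by move=> /negPf lj; rewrite /raise lj.
have raisejj d j : raise d j j by rewrite /raise eqxx.
have sti : st a' b' i = canon_st a' b' i by rewrite stc // ltnW.
have [c [d [[step nst] [hc hd] same_cd st1]]] : exists c d,
  [/\ bruhat_step (W (bit_word c d n)) (W (bit_word a' b' n)) /\ ~~ st a' b' i.+1,
      (forall l, c l -> a' l \/ a l) /\ (forall l, d l -> b' l \/ b l),
      forall l, l != i -> c l = a' l /\ d l = b' l
    & canon_st c d i.+1 -> st a b i.+1].
  have [eq_a|ne_a] := eqVneq (a i) (a' i).
    (* In the opposite case the order gives st at i for both pairs, then st at i+1 for a', b' by
       admissibility, hence for a, b, which requires [b i]. *)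
    have bi : b i /\ ~~ b' i.
      have ne_b : b i != b' i by move: ne; rewrite eq_a xpair_eqE eqxx.
      have [b'i|b'i] := boolP (b' i); last by move: ne_b; rewrite (negPf b'i); case: (b i).
      have nb : ~~ b i by move: ne_b; rewrite b'i; case: (b i).
      have si : st a b i by have := hb i lt_i; rewrite b'i (negPf nb); apply.
      have : st a b i.+1.
        by apply: hs => //=; rewrite b'i andbT; apply: cab' => //; rewrite -eq_st.
      by rewrite /= (negPf nb) andbF.
    exists a', (raise b' i); split.
    - split; last by rewrite /= negb_and bi.2 orbT.
      by apply: (bruhat_step_raise lt_i cab'); right; rewrite bi.2.
    - split=> l; first by left.
      by rewrite /raise => /orP[/eqP ->|]; [right; exact: bi.1|left].
    - by move=> l li; rewrite raiseE.
    - by rewrite /= raisejj bi.1 eq_a; case: ifP => _; case: (a' i).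
  have ai : a i /\ ~~ a' i by move: ne_a (ha i lt_i); case: (a i) (a' i) => [] [] // _ /(_ isT).
  have nsi : st a' b' i = false by apply/negbTE; apply: contra ai.2; apply: cab'.
  exists (raise a' i), b'; split.
  - split; last by rewrite /= negb_and ai.2.
    by apply: (bruhat_step_raise lt_i cab'); left; rewrite ai.2.
  - split=> l; last by left.
    by rewrite /raise => /orP[/eqP ->|]; [right; exact: ai.1|left].
  - by move=> l li; rewrite raiseE.
  rewrite /= same_cst => [|l li]; last by rewrite raiseE // ltn_eqF.
  rewrite -sti nsi raisejj ai.1 /= => bi'.
  by have := hb i lt_i; rewrite bi' eq_st nsi => /(_ isT); rewrite orbF.
(* Here st becomes true at i+1 and the two letters there would cancel, making st true at i+2 as
   well. The left one is deleted instead: st at i+1 for a, b forces [a i.+1]. *)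
have [/and4P[ci lt_i1 na nb]|nexc] :=
    boolP [&& canon_st c d i.+1, (i.+1 < n)%N, ~~ a' i.+1 & ~~ b' i.+1].
  exists (raise a' i.+1), b'; split; last first.
    by apply: (bruhat_step_raise lt_i1 cab'); left.
  apply: leI => [m le_m|l lt_l|l lt_l]; last by left.
    suff -> : canon_st (raise a' i.+1) b' m = st a' b' m by apply: hs.
    elim: m le_m => //= m IHm lt_m; rewrite IHm ?(ltnW lt_m) //.
    have [->|mi] := eqVneq m i.+1; first by rewrite (negPf nst) (negPf nb) !andbF.
    by rewrite raiseE //; case: ifP => // /(cab' m lt_m) ->.
  rewrite /raise => /orP[/eqP ->|]; last by left.
  by right; apply: cab => //; apply: st1.
exists c, d; split=> //; apply: leI => [m le_m|l _|l _]; [|exact: hc|exact: hd].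
have [mi|im|->//] := ltngtP m i.+1.
  rewrite same_cst ?stc // => [|l lm]; first exact: hs.
  by apply: same_cd; rewrite neq_ltn (leq_trans lm).
(* Past i+1 nothing changes: the value at i+2 would differ only if st became true at i+1 with both
   letters kept there, the case just excluded. *)
suff -> : canon_st c d m = st a' b' m by apply: hs.
elim: m im le_m => // m IHm; rewrite ltnS leq_eqVlt => /orP[/eqP <-|im] lt_m; last first.
  have [e1 e2] := same_cd m (negbT (gtn_eqF (ltnW im))).
  rewrite /= IHm ?(ltnW lt_m) // e1 e2.
  by case: ifP => // /(cab' m lt_m) ->.
have [e1 e2] := same_cd i.+1 (negbT (gtn_eqF (ltnSn i))).
have -> : canon_st c d i.+2 =
    if canon_st c d i.+1 then c i.+1 == d i.+1 else c i.+1 && d i.+1 by [].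
have -> : st a' b' i.+2 = a' i.+1 && b' i.+1 by [].
move: nexc; rewrite lt_m e1 e2; case: (canon_st c d i.+1) => //.
by case: (a' i.+1) (b' i.+1) => [] [].
Qed.

Lemma bruhat_of_bits_le a b a' b' : canonical a b -> canonical a' b' ->
  bits_le a b a' b' -> bruhat (W (bit_word a b n)) (W (bit_word a' b' n)).
Proof.
move=> cab; have [m] := ubnP (cox_length (W (bit_word a' b' n))).
elim: m a' b' => // m IHm a' b' lt_m cab' leab.
have [ne|eq] := pselect (exists2 i, (i < n)%N & (a i, b i) <> (a' i, b' i)); last first.
  rewrite (@wd_eq a b a' b') => [|i lt_i]; first exact: rt_refl.
  suff [-> ->] : (a i, b i) = (a' i, b' i) by [].
  by apply: contrapT => ne; apply: eq; exists i.
have [c [d [lecd step]]] := bits_le_raise cab cab' leab ne.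
apply: (rt_trans _ _ _ (W (bit_word c d n))); last exact: rt_step.
rewrite -[W (bit_word c d n)]wd_canon //; apply: IHm => //; last exact: canonical_canon.
by rewrite wd_canon //; apply: leq_trans step.2 lt_m.
Qed.

(** The letter s_1 occurs once in w_n; of its two occurrences in the palindromic word the left one
    is deleted, as admissibility at index 0 demands. *)
Lemma typeA_wnE : typeA_wn n = W (bit_word (fun i => i == 0%N) (fun=> false) n).
Proof.
rewrite /typeA_wn; congr cox_word.
have -> : enum 'I_n = map L (iota 0 n).
  by rewrite -val_enum_ord -map_comp map_id_in // => i _ /=; apply: inord_val.
suff h m : bit_word (fun i => i == 0%N) (fun=> false) m.+1 =
    rev (map L (iota 0 m.+1)) ++ map L (iota 1 m) by rewrite h.
have iotaS i l : iota i l.+1 = iota i l ++ [:: (i + l)%N] by rewrite -addn1 iotaD.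
elim: m => // m IHm; rewrite [in rev _]iotaS [iota 1 m.+1]iotaS !map_cat rev_cat.
by rewrite -catA [rev (map _ (iota 0 m.+1)) ++ _]catA -IHm.
Qed.

Lemma bruhat_wn x : bruhat x (typeA_wn n) <->
  exists a b, canonical a b /\ x = W (bit_word a b n).
Proof.
rewrite typeA_wnE; split=> [/bruhat_bit_word/(_ erefl)[a [b [_ _ ->]]]|[a [b [cab ->]]]].
  by exists (canon_a a b), (canon_b a b); split; [exact: canonical_canon|rewrite wd_canon].
apply: bruhat_of_bits_le => //; first by case=> [|i] _ //=; rewrite andbF.
split=> [[|m] //= _|i lt_i /eqP ->|[|i] lt_i] /=; rewrite ?andbF ?orbT //.
exact: cab.
Qed.

Lemma bruhat_bit_wordE a b a' b' : canonical a b -> canonical a' b' ->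
  bruhat (W (bit_word a b n)) (W (bit_word a' b' n)) <-> bits_le a b a' b'.
Proof.
by move=> cab cab'; split; [exact: bits_le_of_bruhat|exact: bruhat_of_bits_le].
Qed.

End TypeAWords.

Lemma bruhat_length (I : choiceType) (M : coxeter_matrix I) (x y : coxeter M) :
  bruhat x y -> x = y \/ (cox_length x < cox_length y)%N.
Proof.
elim=> {x y} [x y [_ lt]|x|x y z _ xy _ yz]; [by right|by left|].
case: xy yz => [->//|xy] [<-|yz]; right => //; exact: ltn_trans xy yz.
Qed.

Lemma bruhat_anti (I : choiceType) (M : coxeter_matrix I) (x y : coxeter M) :
  bruhat x y -> bruhat y x -> x = y.
Proof.
move=> /bruhat_length[//|xy] /bruhat_length[//|/(ltn_trans xy)].
by rewrite ltnn.
Qed.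

(** * Universal property of Y_n *)

Section Presentation.
Variables (k : fieldType) (n : nat) (Q : 'I_n -> k) (G : 'M[k]_n).
Hypothesis nrQ : forall i, not_root_of_unity (Q i).
Hypothesis asymG : mult_antisymmetric G.
Local Notation A := (weyl_alg nrQ asymG).

Definition extend_ord (R : Type) (d : R) (F : 'I_n -> R) (m : nat) : R :=
  if insub m is Some i then F i else d.

Lemma extend_ordE (R : Type) (d : R) (F : 'I_n -> R) (i : 'I_n) : extend_ord d F i = F i.
Proof. by rewrite /extend_ord valK. Qed.

Definition wq := extend_ord 1 Q.
Definition wg i j := extend_ord 1 (fun i' => extend_ord 1 (fun j' => G i' j') j) i.
Definition wx := extend_ord 0 (@weyl_x _ _ _ _ nrQ asymG).
Definition wy := extend_ord 0 (@weyl_y _ _ _ _ nrQ asymG).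

Lemma wgE (i j : 'I_n) : wg i j = G i j.
Proof. by rewrite /wg !extend_ordE. Qed.

Lemma weyl_scalarsP : (forall i, Q i != 0) -> weyl_scalars n wq wg.
Proof.
move=> Q0; split.
- move=> i; rewrite /wq /extend_ord; by case: insub => [i'|]; rewrite ?Q0 ?oner_neq0.
- by move=> i lt_i; rewrite -[i]/(val (Ordinal lt_i)) /wq extend_ordE.
- move=> i; rewrite /wg /extend_ord; by case: (insub i) => [i'|] //; exact: asymG.1.
move=> i j; rewrite /wg /extend_ord; case: (insub i) => [i'|]; case: (insub j) => [j'|];
  rewrite ?mulr1 //; exact: asymG.2.
Qed.

Lemma zed_sum (B : algType k) (X Y : 'I_n -> B) (X' Y' : nat -> B) m :
    (forall i : 'I_n, X' i = X i) -> (forall i : 'I_n, Y' i = Y i) -> (m <= n)%N ->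
  zed wq X' Y' m = 1 + \sum_(l < n | (l < m)%N) (Q l - 1) *: (Y l * X l).
Proof.
move=> eX eY; elim: m => [|m IHm] lt_m; first by rewrite big_pred0 ?addr0.
rewrite zedS (IHm (ltnW lt_m)) -addrA; congr (_ + _).
rewrite [RHS](bigD1 (Ordinal lt_m)) //= addrC; congr (_ + _).
  have := extend_ordE 1 Q (Ordinal lt_m); rewrite /wq /= => ->.
  by rewrite -[X' m]/(X' (Ordinal lt_m)) -[Y' m]/(Y' (Ordinal lt_m)) eX eY.
apply: eq_bigl => l; rewrite ltnS ltn_neqAle andbC; congr (_ && _).
Qed.

Lemma weyl_rels_relators (B : algType k) (X Y : 'I_n -> B) (X' Y' : nat -> B) :
    (forall i : 'I_n, X' i = X i) -> (forall i : 'I_n, Y' i = Y i) ->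
  weyl_rels n wq wg X' Y' <-> (forall f, weyl_relator Q G X Y f -> f = 0).
Proof.
move=> eX eY; split=> [rel f|rel].
  case=> [i j|i j ij|i j ij|i j ij|i]; apply/eqP; rewrite subr_eq0; apply/eqP.
  - by have := rYY rel (ltn_ord i) (ltn_ord j); rewrite !eY wgE.
  - by have := rXYlt rel ij (ltn_ord j); rewrite !eX !eY wgE.
  - by have := rXYgt rel ij (ltn_ord i); rewrite !eX !eY wgE /wq extend_ordE.
  - by have := rXX rel ij (ltn_ord j); rewrite !eX wgE /wq extend_ordE.
  have := rXYe rel (ltn_ord i).
  by rewrite (zed_sum eX eY) ?(ltnW (ltn_ord i)) // !eX !eY /wq extend_ordE addrA.
have E u v : weyl_relator Q G X Y (u - v) -> u = v.
  by move/rel/eqP; rewrite subr_eq0 => /eqP.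
have toX i (lt_i : (i < n)%N) : X' i = X (Ordinal lt_i) by rewrite -eX.
have toY i (lt_i : (i < n)%N) : Y' i = Y (Ordinal lt_i) by rewrite -eY.
have toQ i (lt_i : (i < n)%N) : wq i = Q (Ordinal lt_i) by rewrite -(extend_ordE 1 Q).
have toG i j (lt_i : (i < n)%N) (lt_j : (j < n)%N) :
  wg i j = G (Ordinal lt_i) (Ordinal lt_j) by rewrite -wgE.
split.
- move=> i j lt_i lt_j; rewrite (toY i lt_i) (toY j lt_j) (toG i j lt_i lt_j).
  by apply: E; constructor.
- move=> i j ij lt_j; have lt_i := ltn_trans ij lt_j.
  rewrite (toX i lt_i) (toY j lt_j) (toG j i lt_j lt_i).
  by apply: E; constructor.
- move=> i j ji lt_i; have lt_j := ltn_trans ji lt_i.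
  rewrite (toX i lt_i) (toY j lt_j) (toG j i lt_j lt_i) (toQ j lt_j).
  by apply: E; constructor.
- move=> i j ij lt_j; have lt_i := ltn_trans ij lt_j.
  rewrite (toX i lt_i) (toX j lt_j) (toG i j lt_i lt_j) (toQ i lt_i).
  by apply: E; constructor.
move=> i lt_i; rewrite (zed_sum eX eY) ?(ltnW lt_i) // (toX i lt_i) (toY i lt_i).
by rewrite (toQ i lt_i) addrA; apply: E; apply: Weyl_xy_eq.
Qed.

(** Used in one direction for the projection from the free algebra and in the other for evaluation
    on it. *)
Lemma relators_image (B B' : algType k) (X Y : 'I_n -> B) (h : B -> B') :
    {morph h : u v / u + v} -> {morph h : u v / u * v} ->
    (forall c, {morph h : u / c *: u}) -> h 1 = 1 ->
  (forall f, weyl_relator Q G X Y f -> h f = 0) <->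
  (forall f, weyl_relator Q G (h \o X) (h \o Y) f -> f = 0).
Proof.
move=> hD hM hZ h1; have hN u : h (- u) = - h u by rewrite -!scaleN1r hZ.
have h0 : h 0 = 0 by rewrite -(scale0r 0) hZ scale0r.
have hS (R : pred 'I_n) F : h (\sum_(i | R i) F i) = \sum_(i | R i) h (F i).
  exact: (big_morph h hD h0).
pose E := (hD, hN, hZ, hM, h1).
split=> hr f; case=> [i j|i j ij|i j ij|i j ij|i].
- by have := hr _ (Weyl_yy Q G X Y i j); rewrite !E.
- by have := hr _ (Weyl_xy_lt Q G X Y ij); rewrite !E.
- by have := hr _ (Weyl_xy_gt Q G X Y ij); rewrite !E.
- by have := hr _ (Weyl_xx Q G X Y ij); rewrite !E.
- have := hr _ (Weyl_xy_eq Q G X Y i); rewrite !E hS.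
  by under eq_bigr do rewrite !E.
- by have := hr _ (Weyl_yy Q G (h \o X) (h \o Y) i j); rewrite !E.
- by have := hr _ (Weyl_xy_lt Q G (h \o X) (h \o Y) ij); rewrite !E.
- by have := hr _ (Weyl_xy_gt Q G (h \o X) (h \o Y) ij); rewrite !E.
- by have := hr _ (Weyl_xx Q G (h \o X) (h \o Y) ij); rewrite !E.
rewrite !E hS; under eq_bigr do rewrite !E.
exact: hr _ (Weyl_xy_eq Q G (h \o X) (h \o Y) i).
Qed.

Local Open Scope quotient_scope.
Local Notation pi := (\pi_(quot_alg (weyl_ideal nrQ asymG))).

Lemma weyl_relations : weyl_rels n wq wg wx wy.
Proof.
apply/(@weyl_rels_relators A (@weyl_x _ _ _ _ nrQ asymG) (@weyl_y _ _ _ _ nrQ asymG)).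
- by move=> i; apply: extend_ordE.
- by move=> i; apply: extend_ordE.
have [||||R _] := @relators_image (weyl_free k n) A (@weyl_free_x k n)
  (@weyl_free_y k n) (fun f => pi f : A).
- exact: (@pi_quot_add _ _ (weyl_ideal nrQ asymG)).
- exact: (@pi_quot_mul _ _ (weyl_ideal nrQ asymG)).
- exact: (@pi_quot_scale _ _ (weyl_ideal nrQ asymG)).
- by [].
apply: R => f rf.
have -> : (0 : A) = pi 0 by [].
by apply/quotE; rewrite subr0 => I [_]; apply.
Qed.

Section Universal.
Variables (B : algType k) (X Y : 'I_n -> B).
Hypothesis rel : forall f, weyl_relator Q G X Y f -> f = 0.

Definition free_image (t : 'I_n + 'I_n) : B :=
  match t with inl i => X i | inr i => Y i end.

Definition word_image (m : fmonom ('I_n + 'I_n)%type) : B :=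
  \prod_(t <- m) free_image t.

Lemma word_image_morphism : mmorphism word_image.
Proof.
split; last by rewrite /word_image fm1 big_nil.
by move=> a b; rewrite /word_image fmM big_cat.
Qed.

HB.instance Definition _ :=
  monalg.isMultiplicative.Build _ _ word_image word_image_morphism.

Definition free_eval (f : weyl_free k n) : B := mmap (in_alg B) word_image f.

Lemma free_evalD : {morph free_eval : f g / f + g}.
Proof. exact: mmapD. Qed.

Lemma free_evalZ c f : free_eval (c *: f) = c *: free_eval f.
Proof. by rewrite /free_eval mmapZ mulr_algl. Qed.

Lemma free_evalM : {morph free_eval : f g / f * g}.
Proof.
apply: (commr_mmap_is_multiplicative _).1 => f m m'.
by rewrite /GRing.comm mulr_algl mulr_algr.
Qed.

Lemma free_eval1 : free_eval 1 = 1.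
Proof. exact: mmap1. Qed.

Lemma free_eval_gen t : free_eval (free_gen k t) = free_image t.
Proof. by rewrite /free_eval mmapU /word_image fmU big_seq1 /= scale1r mul1r. Qed.

Lemma free_eval_ideal f : pideal (weyl_ideal nrQ asymG) f -> free_eval f = 0.
Proof.
move=> /(_ [set u | free_eval u = 0]); apply; split.
  split=> /= [|u v u0 v0|u v v0|u v u0].
  - by rewrite -(scale0r 0) free_evalZ scale0r.
  - by rewrite free_evalD u0 v0 addr0.
  - by rewrite free_evalM v0 mulr0.
  - by rewrite free_evalM u0 mul0r.
have [||||_ R] := @relators_image (weyl_free k n) B (@weyl_free_x k n)
  (@weyl_free_y k n) free_eval.
- exact: free_evalD.
- exact: free_evalM.
- exact: free_evalZ.
- exact: free_eval1.
move=> u; apply: R => v rv; apply: rel.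
suff [-> ->] : X = free_eval \o @weyl_free_x k n /\ Y = free_eval \o @weyl_free_y k n.
  exact: rv.
by split; apply: funext => i; rewrite /= free_eval_gen.
Qed.

Definition weyl_eval (u : A) : B := free_eval (repr u).

Lemma weyl_evalE f : weyl_eval (pi f) = free_eval f.
Proof.
apply/eqP; rewrite -subr_eq0 -scaleN1r -free_evalZ -free_evalD scaleN1r; apply/eqP.
exact/free_eval_ideal/quot_repr.
Qed.

Lemma weyl_eval_linear : linear weyl_eval.
Proof.
move=> c u v; elim/quot_ind: u => f; elim/quot_ind: v => g.
rewrite [X in weyl_eval X](_ : _ = pi (c *: f + g)); last first.
  by rewrite pi_quot_add pi_quot_scale.
by rewrite !weyl_evalE free_evalD free_evalZ.
Qed.

Lemma weyl_eval_multiplicative : GRing.monoid_morphism weyl_eval.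
Proof.
split=> [|u v]; first by rewrite -[1]/(pi 1) weyl_evalE free_eval1.
elim/quot_ind: u => f; elim/quot_ind: v => g.
rewrite [X in weyl_eval X](_ : _ = pi (f * g)); last by rewrite pi_quot_mul.
by rewrite !weyl_evalE free_evalM.
Qed.

HB.instance Definition _ := GRing.isLinear.Build k A B _ weyl_eval weyl_eval_linear.
HB.instance Definition _ :=
  GRing.isMonoidMorphism.Build A B weyl_eval weyl_eval_multiplicative.

Lemma weyl_universal : exists phi : {lrmorphism A -> B},
  (forall i, phi (weyl_x nrQ asymG i) = X i) /\
  (forall i, phi (weyl_y nrQ asymG i) = Y i).
Proof.
by exists weyl_eval; split=> i; rewrite /= weyl_evalE free_eval_gen.
Qed.

End Universal.
End Presentation.

(** * Weights in a CGL extension *)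

Section OreCommutation.
Variables (k : fieldType) (A : algType k).

Lemma subalg0 (B : set A) : is_subalgebra B -> B 0.
Proof.
move=> sB; rewrite -(subrr 1) -scaleN1r addrC.
by apply: (subalgZD sB); apply: (subalg1 sB).
Qed.

Lemma subalgZ (B : set A) c u : is_subalgebra B -> B u -> B (c *: u).
Proof.
move=> sB Bu; rewrite -[c *: u]addr0.
by apply: (subalgZD sB) => //; apply: subalg0.
Qed.

Lemma subalgebra_genP (S : set A) : is_subalgebra (subalgebra_gen S).
Proof.
split.
- by move=> B [sB _]; apply: (subalg1 sB).
- by move=> c u v Su Sv B SB; apply: (subalgZD SB.1); [apply: Su|apply: Sv].
- by move=> u v Su Sv B SB; apply: (subalgM SB.1); [apply: Su|apply: Sv].
Qed.

Lemma subalgebra_gen_sub (S : set A) : S `<=` subalgebra_gen S.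
Proof. exact: sub_smallest. Qed.

(* The polynomials (c w) X and (c w) z over B take the same value at z. *)
Lemma ore_degree1_eq0 (B C : set A) z tau delta c w : is_subalgebra B ->
  is_ore_extension B z tau delta C -> B w -> w != 0 -> B ((c *: w) * z) -> c = 0.
Proof.
move=> sB [_ _ _ /set_bij_inj inj] Bw w0 Bcwz.
have Bcw : B (c *: w) by apply: subalgZ.
have B0 : B 0 by apply: subalg0.
have : (c *: w)%:P * 'X = ((c *: w) * z)%:P :> {poly A}.
  apply: inj; [apply: mem_set => i|apply: mem_set => i|].
  - by rewrite coefMX coefC; case: i => [|[|i]].
  - by rewrite coefC; case: i.
  - by rewrite hornerMX !hornerC.
move=> /(congr1 (fun p : {poly A} => p`_1)); rewrite coefMX !coefC /= => /eqP.
by rewrite scaler_eq0 (negPf w0) orbF => /eqP.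
Qed.

(** The Ore relation and the hypothesis give two expressions of z x; their coefficients of degree
    one in z must agree. This determines an eigenvalue of an otherwise unknown [tau]. *)
Lemma ore_weight (B C : set A) z tau delta (c e : k) x w : is_subalgebra B ->
  is_ore_extension B z tau delta C -> B x -> x != 0 -> B w -> tau x = c *: x ->
  z * x = e *: (x * z) + w -> c = e.
Proof.
move=> sB ore Bx x0 Bw tx E.
apply/eqP; rewrite -subr_eq0; apply/eqP; apply: (ore_degree1_eq0 sB ore Bx x0).
have := ore_comm ore Bx; rewrite E tx -scalerAl => E'.
have -> : (c - e) *: x * z = -1 *: delta x + w.
  rewrite scalerBl mulrBl -!scalerAl scaleN1r; apply/eqP; rewrite subr_eq; apply/eqP.
  by rewrite -addrA [w + _]addrC E' addrCA addNr addr0.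
by apply: (subalgZD sB) => //; apply: (der_fun (ore_der ore)).
Qed.

Lemma scaler_injl (c d : k) (x : A) : x != 0 -> c *: x = d *: x -> c = d.
Proof.
move=> x0 /eqP; rewrite -subr_eq0 -scalerBl scaler_eq0 (negPf x0) orbF subr_eq0.
by move/eqP.
Qed.

(** Scaling x and y multiplies x y - q y x = z by c d. *)
Lemma weights_inverse (q c d : k) (x y z : A) : z != 0 -> x * y = q *: (y * x) + z ->
  (c *: x) * (d *: y) = q *: ((d *: y) * (c *: x)) + z -> c * d = 1.
Proof.
move=> z0 E; rewrite -!scalerAl -!scalerAr !scalerA E scalerDr scalerA.
rewrite (_ : q * d * c = c * d * q) => [/addrI|]; last by ring.
by rewrite -{2}[z]scale1r; apply: scaler_injl.
Qed.

End OreCommutation.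

Lemma nth_pairs (R : nmodType) (I : Type) (F1 F2 : I -> R) (s : seq I) (i0 : I) i :
  (i < size s)%N ->
  (flatten [seq [:: F1 i; F2 i] | i <- s])`_(i.*2) = F1 (nth i0 s i) /\
  (flatten [seq [:: F1 i; F2 i] | i <- s])`_(i.*2.+1) = F2 (nth i0 s i).
Proof. by elim: s i => //= x s IHs [|i] //= /IHs. Qed.

Lemma size_pairs (R I : Type) (F1 F2 : I -> R) (s : seq I) :
  size (flatten [seq [:: F1 i; F2 i] | i <- s]) = (size s).*2.
Proof. by elim: s => //= x s ->. Qed.

Section CGL.
Variables (k : fieldType) (n : nat) (Q : 'I_n -> k) (G : 'M[k]_n).
Hypothesis Q_neq0 : forall i, Q i != 0.
Hypothesis nrQ : forall i, not_root_of_unity (Q i).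
Hypothesis asymG : mult_antisymmetric G.
Local Notation A := (weyl_alg nrQ asymG).
Variables (r : nat) (act : torus k r -> {lrmorphism A -> A}).
Hypothesis cgl : is_CGL_extension act (weyl_gens nrQ asymG).

Let scal := weyl_scalarsP nrQ asymG Q_neq0.
Let rel := weyl_relations nrQ asymG.
Local Notation q := (wq Q).
Variable T : twisted_algebra (qbichar scal).
Local Notation g := (wg G).
Local Notation X := (wx nrQ asymG).
Local Notation Y := (wy nrQ asymG).
Local Notation zed := (zed q X Y).
Local Notation gens := (weyl_gens nrQ asymG).

Lemma size_gens : size gens = n.*2.
Proof. by rewrite size_pairs size_enum_ord. Qed.

Lemma nth_gens i : (i < n)%N -> gens`_(i.*2) = X i /\ gens`_(i.*2.+1) = Y i.
Proof.
move=> lt_i; have := @nth_pairs A _ (@weyl_x _ _ _ _ nrQ asymG)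
  (@weyl_y _ _ _ _ nrQ asymG) (enum 'I_n) (Ordinal lt_i) i.
rewrite size_enum_ord => /(_ lt_i) [-> ->].
rewrite (_ : nth _ _ _ = Ordinal lt_i); last by apply: val_inj; rewrite /= nth_enum_ord.
rewrite -(extend_ordE 0 (@weyl_x _ _ _ _ nrQ asymG)).
by rewrite -(extend_ordE 0 (@weyl_y _ _ _ _ nrQ asymG)).
Qed.

Lemma weyl_gen (S : set A) : is_subalgebra S ->
  (forall i, (i < n)%N -> S (X i) /\ S (Y i)) -> S = setT.
Proof.
move=> sS SXY; apply/seteqP; split=> // u _.
have : subalgebra_gen [set` gens] u by rewrite (cgl_gen cgl).
apply; split=> // v /= /(nthP 0)[j]; rewrite size_gens => lt_j <-.
rewrite -(odd_double_half j); have lt_h : (j./2 < n)%N by lia.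
by have [h1 h2] := nth_gens lt_h; have [s1 s2] := SXY _ lt_h; case: (odd j); rewrite /= ?h1 ?h2.
Qed.

Lemma point_exists a b : (forall i, (i < n)%N -> st a b i -> a i) ->
  exists phi : {lrmorphism A -> T},
    (forall i, (i < n)%N -> phi (X i) = phiX T a i) /\
    (forall i, (i < n)%N -> phi (Y i) = phiY T a b i).
Proof.
move=> cab.
have relT f : weyl_relator Q G (fun i : 'I_n => phiX T a i)
    (fun i : 'I_n => phiY T a b i) f -> f = 0.
  by apply: (iffLR (@weyl_rels_relators _ _ Q G T _ _ (phiX T a) (phiY T a b)
    (fun=> erefl) (fun=> erefl))); apply: phi_rels.
have [phi [hX hY]] := weyl_universal nrQ asymG relT.
exists phi; split=> i lt_i.
  by rewrite -[i]/(val (Ordinal lt_i)) /wx extend_ordE hX.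
by rewrite -[i]/(val (Ordinal lt_i)) /wy extend_ordE hY.
Qed.

(** The point with all bits set sends z_m to the invertible Z_m. *)
Lemma weyl_zed_neq0 m : (m <= n)%N -> zed m != 0.
Proof.
move=> le_m; have cab i : (i < n)%N -> st xpredT xpredT i -> true by [].
have [phi [hX hY]] := point_exists cab.
apply/eqP => z0; have := phi_zed cab hX hY le_m; rewrite z0 linear0.
have -> : st xpredT xpredT m by case: (m).
by move/esym/eqP; rewrite tmon_eq0 oner_eq0.
Qed.

Lemma lt_gens2 i : (i < n)%N -> (i.*2 < size gens)%N.
Proof. by rewrite size_gens ltn_double. Qed.

Lemma lt_gens2S i : (i < n)%N -> (i.*2.+1 < size gens)%N.
Proof. by rewrite size_gens; lia. Qed.

Lemma weights_exist : exists chi : torus k r -> nat -> k,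
  [/\ weights_of_CGL n q g chi,
      forall h i, (i < n)%N -> act h (X i) = chi h i *: X i
    & forall h i, (i < n)%N -> act h (Y i) = (chi h i)^-1 *: Y i].
Proof.
have eig j : exists chi : torus k r -> k, (j < size gens)%N ->
    forall h, act h gens`_j = chi h *: gens`_j.
  have [lt_j|ge_j] := ltnP j (size gens); last by exists (fun=> 1).
  by have [_ [chi hchi]] := cgl_eigen cgl lt_j; exists chi.
have [c hc] := choice eig.
have X0 i : (i < n)%N -> X i != 0.
  move=> lt_i; have [nz _] := cgl_eigen cgl (lt_gens2 lt_i).
  by rewrite (nth_gens lt_i).1 in nz.
have aX h i : (i < n)%N -> act h (X i) = c i.*2 h *: X i.
  by move=> lt_i; rewrite -(nth_gens lt_i).1 hc // lt_gens2.
have aY h i : (i < n)%N -> act h (Y i) = c i.*2.+1 h *: Y i.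
  by move=> lt_i; rewrite -(nth_gens lt_i).2 hc // lt_gens2S.
have inv h i : (i < n)%N -> act h (zed i) = zed i -> c i.*2 h * c i.*2.+1 h = 1.
  move=> lt_i az; have z0 := weyl_zed_neq0 (ltnW lt_i).
  apply: (weights_inverse z0 (rXYe rel lt_i)).
  by rewrite -aX // -aY // -!rmorphM /= (rXYe rel lt_i) linearD linearZ /= az.
(* The elements z_m are fixed by H, hence the weights of x_i and y_i are inverse. *)
have az h m : (m <= n)%N -> act h (zed m) = zed m.
  elim: m => [|m IHm] lt_m; first by rewrite /= rmorph1.
  have iz := inv h m lt_m (IHm (ltnW lt_m)).
  rewrite zedS linearD linearZ rmorphM /= aX // aY // IHm ?(ltnW lt_m) //.
  by rewrite -scalerAl -scalerAr [_ *: (_ *: (_ * _))]scalerA [c _.+1 h * _]mulrC iz scale1r.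
have c1 h i : (i < n)%N -> c i.*2 h * c i.*2.+1 h = 1.
  by move=> lt_i; apply: inv => //; apply: az; apply: ltnW.
have cV h i : (i < n)%N -> c i.*2.+1 h = (c i.*2 h)^-1.
  move=> lt_i; have c0 : c i.*2 h != 0.
    by apply: contra_eq_neq (c1 h i lt_i) => ->; rewrite mul0r eq_sym oner_neq0.
  by apply: (mulfI c0); rewrite c1 // mulfV.
exists (fun h i => if (i < n)%N then c i.*2 h else 1); split; first last.
- by move=> h i lt_i; rewrite lt_i -(cV h i lt_i); apply: aY.
- by move=> h i lt_i; rewrite lt_i; apply: aX.
have [tau [delta [p [hh hore]]]] := cgl_ore cgl.
pose step := step gens.
have sstep j : is_subalgebra (step j) by exact: subalgebra_genP.
have in_step i j : (i < j)%N -> (j < size gens)%N -> step j gens`_i.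
  move=> ij lt_j; apply: subalgebra_gen_sub => /=.
  by rewrite -(nth_take 0 ij) mem_nth // size_take lt_j.
have step_zed m j : (m.*2 <= j)%N -> (m <= n)%N -> (j < size gens)%N -> step j (zed m).
  elim: m => [|m IHm] mj lt_m lt_j; first exact: (subalg1 (sstep j)).
  rewrite zedS addrC; apply: (subalgZD (sstep j)); last first.
    by apply: IHm => //; [apply: leq_trans mj; rewrite leq_double|apply: ltnW].
  apply: (subalgM (sstep j)).
    by rewrite -(nth_gens lt_m).2; apply: in_step => //; apply: leq_trans mj; rewrite doubleS.
  by rewrite -(nth_gens lt_m).1; apply: in_step => //; apply: leq_trans mj; rewrite doubleS.
(* The weight of x_l under h_j is its eigenvalue under tau_j, hence its commutation factor with the
   generator adjoined at step j, up to terms [w] of lower degree. *)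
have key j l e w : (j < size gens)%N -> (l < n)%N -> (l.*2 < j)%N ->
    step j w -> gens`_j * X l = e *: (X l * gens`_j) + w -> c l.*2 (hh j) = e.
  move=> lt_j lt_l lj sw E; have [ore _ _ _ [htau _]] := hore j lt_j.
  have sX : step j (X l) by rewrite -(nth_gens lt_l).1; apply: in_step.
  have tX : tau j (X l) = c l.*2 (hh j) *: X l.
    by rewrite -aX // -(nth_gens lt_l).1 htau.
  exact: (ore_weight (sstep j) ore sX (X0 l lt_l) sw tX E).
split.
- move=> h i; case: ifP => [lt_i|_]; last exact: oner_neq0.
  by apply: contra_eq_neq (c1 h i lt_i) => ->; rewrite mul0r eq_sym oner_neq0.
- move=> i lt_i; have lt_j := lt_gens2 lt_i.
  exists (hh i.*2) => [l li|]; last first.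
    have [_ _ _ _ [_ [lam hlam nlam]]] := hore _ lt_j.
    rewrite lt_i (_ : c _ _ = lam) //; apply: scaler_injl (X0 i lt_i) _.
    by rewrite -(aX _ i lt_i) -(nth_gens lt_i).1.
  have lt_l := ltn_trans li lt_i; rewrite lt_l.
  apply: (key _ _ _ 0) => //; first by rewrite ltn_double.
    exact: (subalg0 (sstep _)).
  rewrite (nth_gens lt_i).1 addr0 (rXX rel li lt_i) scalerA mulVf ?scale1r //.
  exact: (wqg_neq0 scal).
move=> i lt_i; have lt_j := lt_gens2S lt_i.
exists (hh i.*2.+1) => [l li|].
  have lt_l := ltn_trans li lt_i; rewrite lt_l.
  apply: (key _ _ _ 0) => //; first by lia.
    exact: (subalg0 (sstep _)).
  by rewrite (nth_gens lt_i).2 addr0 (rXYlt rel li lt_i) scalerA (wgV scal) scale1r.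
(* Solving the relation for y_i x_i gives the factor q_i^-1 and this remainder, which lies in the
   coefficient algebra because z_i involves earlier generators only. *)
rewrite lt_i; apply: (key _ _ _ (- (q i)^-1 *: zed i)) => //.
  by apply: (subalgZ _ (sstep _)); apply: step_zed => //; apply: ltnW.
rewrite (nth_gens lt_i).2 (rXYe rel lt_i) scalerDr scalerA mulVf ?(wq_neq0 scal) //.
by rewrite scale1r -addrA -scalerDl subrr scale0r addr0.
Qed.

(** What remains of the kernels for comparing them: [J] is the least ideal containing the excluded
    elements and avoids the others, so an inclusion is tested on the excluded elements. *)
Record stratum (a b : nat -> bool) (J : set A) : Prop := {
  str_H : Hspec act J;
  str_gens : contains_gens n q X Y a b J;
  str_min : forall P, is_ideal P -> contains_gens n q X Y a b P -> J `<=` P;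
  str_X : forall i, (i < n)%N -> a i -> ~ J (X i);
  str_Y : forall i, (i < n)%N -> b i || st a b i -> ~ J (Y i);
  str_Z : forall m, (m <= n)%N -> st a b m -> ~ J (zed m) }.

Lemma stratum_ker a b (cab : forall i, (i < n)%N -> st a b i -> a i)
    (phi : {lrmorphism A -> T}) :
  (forall i, (i < n)%N -> phi (X i) = phiX T a i) ->
  (forall i, (i < n)%N -> phi (Y i) = phiY T a b i) -> stratum a b (ker phi).
Proof.
move=> hX hY; have [chi [wt aX aY]] := weights_exist.
split.
- split; first exact: ker_prime.
  by move=> h u; apply: (ker_stable weyl_gen hX hY wt aX aY).
- exact: ker_gens.
- by move=> P idP gP; apply: (ker_sub cab rel weyl_gen hX hY).
- move=> i lt_i ai; rewrite /ker /= hX // /phiX ai => /eqP.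
  by rewrite tmon_eq0 oner_eq0.
- move=> i lt_i bs; rewrite /ker /= hY // => Y0.
  by have := lead_phiY T lt_i bs; rewrite Y0 => /(lead0 expo_posP).
- move=> m le_m sm; rewrite /ker /= (phi_zed cab hX hY le_m) sm => /eqP.
  by rewrite tmon_eq0 oner_eq0.
Qed.

Lemma stratum_exists a b : (forall i, (i < n)%N -> st a b i -> a i) ->
  exists J, stratum a b J.
Proof.
move=> cab; have [phi [hX hY]] := point_exists cab.
by exists (ker phi); apply: stratum_ker.
Qed.

(** The point is that [st] computed from the bits records membership of z_m in P. If z_m lies in P,
    then y_m is normal modulo P, so z_(m+1) lies in P exactly when x_m or y_m does. *)
Lemma Hspec_stratum P : Hspec act P -> exists a b,
  (forall i, (i < n)%N -> st a b i -> a i) /\ stratum a b P.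
Proof.
move=> [primeP stP]; have idP := prime_ideal primeP.
pose a i := `[< ~ P (X i) >].
pose b i := if `[< ~ P (zed i) >] then `[< ~ P (zed i.+1) >] else `[< ~ P (Y i) >].
have nP1 : ~ P 1.
  move=> P1; case/eqP: (prime_proper primeP); apply/seteqP; split=> // u _.
  by rewrite -[u]mulr1; apply: idealMl.
have PX_zed i : (i < n)%N -> P (X i) -> P (zed i).
  move=> lt_i Px; have -> : zed i = X i * Y i - q i *: (Y i * X i).
    by rewrite (rXYe rel lt_i) addrC addKr.
  apply: idealB => //; first exact: Defs.idealMr.
  by apply: idealZ => //; apply: idealMl.
have sE m : (m <= n)%N -> st a b m = `[< ~ P (zed m) >].
  elim: m => [|m IHm] lt_m; first by apply/esym/asboolP.
  rewrite [st _ _ _]/= /a /b; have q1 := wq_neq1 scal lt_m.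
  have [nz|/contrapT z] := asboolP (~ P (zed m)).
    have -> // : `[< ~ P (X m) >] by apply/asboolP => /PX_zed -/(_ lt_m).
  have zS : P (zed m.+1) <-> P (Y m * X m).
    split=> h.
      rewrite -[Y m * X m](scalerK q1); apply: idealZ => //.
      have -> : (q m - 1) *: (Y m * X m) = zed m.+1 - zed m by rewrite zedS [RHS]addrAC subrr add0r.
      exact: idealB.
    by rewrite zedS; apply: idealD => //; apply: idealZ.
  apply/andP/asboolP => [[/asboolP nx /asboolP ny] /zS yx|nzS].
    have regY : regular P (Y m).
      apply: (regular_normal weyl_gen primeP ny) => i lt_i; split; last first.
        by apply: (qcomm_normal primeP); apply: (qcommYY scal rel).
      have [->|ne] := eqVneq i m; last first.
        by apply: (qcomm_normal primeP); apply: qcomm_sym; apply: (qcommXY scal rel).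
      exists (q m)^-1; rewrite (rXYe rel lt_m) scalerDr scalerA mulVf ?(wq_neq0 scal) //.
      rewrite scale1r opprD addrA subrr add0r; apply: idealN => //.
      by apply: idealZ.
    exact: nx (regY _ yx).
  split; apply/asboolP => h; apply: nzS; apply/zS; first exact: idealMl.
  exact: Defs.idealMr.
have cab i : (i < n)%N -> st a b i -> a i.
  move=> lt_i; rewrite sE ?(ltnW lt_i) // => /asboolP nz.
  by apply/asboolP => /PX_zed -/(_ lt_i).
exists a, b; split=> //.
have [phi [hX hY]] := point_exists cab; have [chi [wt aX aY]] := weights_exist.
have -> : P = ker phi; last exact: stratum_ker.
apply: (Hprime_eq_ker cab rel weyl_gen hX hY wt aX aY primeP stP).
- by move=> i lt_i; split=> /asboolP.
- move=> i lt_i; rewrite sE ?(ltnW lt_i) // /b; case: asboolP => // _ _.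
  by split=> /asboolP.
- by move=> m le_m; rewrite sE //; split=> /asboolP.
Qed.

Lemma stratum_le a b a' b' J J' : stratum a b J -> stratum a' b' J' ->
  J `<=` J' <-> [/\ forall m, (m <= n)%N -> st a' b' m -> st a b m,
                    forall i, (i < n)%N -> a' i -> a i
                  & forall i, (i < n)%N -> b' i || st a' b' i -> b i || st a b i].
Proof.
move=> sJ sJ'; split=> [JJ|[hs ha hb]].
  split=> [[//|m] lt_m s'|i lt_i a'i|i lt_i b's].
  - apply: contrapT => /negP ns; apply: (str_Z sJ' lt_m s').
    by apply: JJ; apply: (cgZ (str_gens sJ)).
  - apply: contrapT => /negP na; apply: (str_X sJ' lt_i a'i).
    by apply: JJ; apply: (cgX (str_gens sJ)).
  - apply: contrapT => /negP; rewrite negb_or => /andP[nb ns].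
    apply: (str_Y sJ' lt_i b's).
    by apply: JJ; apply: (cgY (str_gens sJ)).
apply: (str_min sJ); first exact: prime_ideal (str_H sJ').1.
split=> [i lt_i na|i lt_i nb ns|i lt_i ns].
- by apply: (cgX (str_gens sJ')) => //; apply: contra na; apply: ha.
- have : ~~ (b' i || st a' b' i).
    by apply: contra (hb i lt_i) _; rewrite negb_or nb ns.
  by rewrite negb_or => /andP[nb' ns']; apply: (cgY (str_gens sJ')).
- by apply: (cgZ (str_gens sJ')) => //; apply: contra ns; apply: hs.
Qed.

End CGL.

(** * The isomorphism of partially ordered sets *)

Theorem proposition4p5 (k : fieldType) (n : nat) (Q : 'I_n -> k) (G : 'M[k]_n)
    (n_gt0 : (0 < n)%N)
    (Q_neq0 : forall i, Q i != 0)
    (nrQ : forall i, not_root_of_unity (Q i))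
    (asymG : mult_antisymmetric G)
    (r : nat)
    (act : torus k r -> {lrmorphism weyl_alg nrQ asymG -> weyl_alg nrQ asymG})
    (cgl : is_CGL_extension act (weyl_gens nrQ asymG)) :
  exists f : coxeter (typeA n) -> set (weyl_alg nrQ asymG),
    set_bij [set v | bruhat v (typeA_wn n)] (Hspec act) f /\
    (forall u v, bruhat u (typeA_wn n) -> bruhat v (typeA_wn n) ->
      (bruhat u v <-> f u `<=` f v)).
Proof.
case: n Q G n_gt0 Q_neq0 nrQ asymG act cgl => // n Q G _ Q0 nrQ asymG act cgl.
pose T := twisted_group_algebra (qbichar (weyl_scalarsP nrQ asymG Q0)).
(* Outside the Bruhat interval the value is arbitrary; the implication makes the statement total so
   that [choice] applies. *)
have ex v : exists J, bruhat v (typeA_wn n.+1) -> exists a b,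
    [/\ canonical n a b, v = cox_word (typeA n.+1) (bit_word n a b n.+1) & stratum act a b J].
  have [/bruhat_wn[a [b [cab ->]]]|nb] := pselect (bruhat v (typeA_wn n.+1)); last by exists set0.
  by have [J sJ] := stratum_exists cgl T cab; exists J => _; exists a, b.
have [f hf] := choice ex.
have le u v : bruhat u (typeA_wn n.+1) -> bruhat v (typeA_wn n.+1) ->
    bruhat u v <-> f u `<=` f v.
  move=> /hf[a [b [cab -> sa]]] /hf[a' [b' [cab' -> sa']]].
  by rewrite bruhat_bit_wordE // (stratum_le sa sa').
exists f; split; last exact: le.
split=> [u /hf[a [b [_ _ sJ]]]|u v|P HP].
- exact: str_H sJ.
- move=> /set_mem hu /set_mem hv E; apply: bruhat_anti; apply/le => //; rewrite E //.
have [a [b [cab sP]]] := Hspec_stratum cgl T HP.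
have hv : bruhat (cox_word (typeA n.+1) (bit_word n a b n.+1)) (typeA_wn n.+1).
  by apply/bruhat_wn; exists a, b.
exists (cox_word (typeA n.+1) (bit_word n a b n.+1)) => //.
have [a' [b' [cab' E sf]]] := hf _ hv.
(* The bits chosen for f and those of P give the same element, so both inclusions follow from
   reflexivity of the Bruhat order. *)
have bE := bruhat_bit_wordE cab cab'; have bE' := bruhat_bit_wordE cab' cab.
apply/seteqP; split.
- by apply/(stratum_le sf sP)/bE'; rewrite E; apply: rt_refl.
- by apply/(stratum_le sP sf)/bE; rewrite E; apply: rt_refl.
Qed.
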